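(* Let $m\ge1$ and $0<h<2$, and let $P\in\mathfrak{P}_m(\Gamma)$ satisfy $\mathrm{mes}\{t\in\mathbb{T}:|P(e^{it})|\ge h\}=\delta_m(h)$. Then the set $\{t\in\mathbb{T}:|P(e^{it})|\ge h\}$ consists of one (nondegenerate) segment and $m-1$ isolated points.
   Context: $\Gamma$ is the unit circle of $\mathbb{C}$; $\mathfrak{P}_m(\Gamma)$ is the set of polynomials $P(z)=\prod_{j=1}^m(z-e^{i\phi_j})$, $\phi_j\in\mathbb{R}$ (monic, degree $m$, all zeros on $\Gamma$). $\mathbb{T}=[0,2\pi)$ with endpoints identified, with Lebesgue measure $\mathrm{mes}$. For $0\le h\le2$, $\delta_m(h)=\inf\{\mathrm{mes}\{t\in\mathbb{T}:|P(e^{it})|\ge h\}:P\in\mathfrak{P}_m(\Gamma)\}$. *)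

(* Defs.v *)
From Stdlib Require Import Reals Lra List ClassicalEpsilon.
Import ListNotations.
Open Scope R_scope.

Definition C := (R * R)%type.
Definition Cmul (z w : C) : C :=
  (fst z * fst w - snd z * snd w, fst z * snd w + snd z * fst w).
Definition Csub (z w : C) : C := (fst z - fst w, snd z - snd w).
Definition Cmod (z : C) : R := sqrt (fst z ^ 2 + snd z ^ 2).
Definition cexp_i (t : R) : C := (cos t, sin t).

(* P(z) = prod_j (z - e^{i phi_j}); an element of P_m(Gamma) is given by
   the list of its m arguments phi_j (with multiplicity). *)
Definition polyP (phis : list R) (z : C) : C :=
  fold_right (fun phi acc => Cmul (Csub z (cexp_i phi)) acc) (1, 0) phis.

Definition sup_set (phis : list R) (h : R) (t : R) : Prop :=
  0 <= t < 2 * PI /\ Cmod (polyP phis (cexp_i t)) >= h.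

Definition indic (E : R -> Prop) (t : R) : R :=
  if excluded_middle_informative (E t) then 1 else 0.

(* Measure of a subset of T = [0,2pi): the Riemann integral of its indicator
   over [0, 2 pi] (the sets considered here are finite unions of intervals
   and points, so this coincides with Lebesgue measure). *)
Definition mes (E : R -> Prop) : R :=
  epsilon (inhabits 0)
    (fun r => exists pr : Riemann_integrable (indic E) 0 (2 * PI),
                RiemannInt pr = r).

Definition is_inf (S : R -> Prop) (d : R) : Prop :=
  (forall x, S x -> d <= x) /\ (forall y, (forall x, S x -> y <= x) -> y <= d).

Definition delta (m : nat) (h : R) : R :=
  epsilon (inhabits 0)
    (is_inf (fun x => exists phis : list R,
                length phis = m /\ x = mes (sup_set phis h))).

Definition in_arc (a b t : R) : Prop :=
  exists k : Z, a <= t + 2 * IZR k * PI <= b.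

(* Main.v *)
(* Write |P(e^(it))| = |Q(t)| with Q(t) = prod_j 2 sin((t - phi_j)/2).  Between
   consecutive zeros |Q| is strictly log-concave, so E = {|Q| >= h} meets each
   gap in a segment, a point or not at all.  Moving two zeros apart lowers |Q|
   off the arc between them; hence for a minimizer the zeros are simple and E
   meets every gap.  It remains to exclude two nondegenerate segments.

   Let L be the length of the complement of E, A and B the monic polynomials
   with zeros at the right and left ends of the segments, and Y the one with
   zeros at the isolated points, so that P^2 - eta h^2 z^m = A B Y^2.
   A resultant computation gives, for s segments and d = deg (A - B) < s,
     (h/2)^(s-d) = sin(L/4)^m * prod_p |P + A Y|(p) / (h |p|^m)
   over the roots p of A - B.  Each factor exceeds 1: otherwise Q/h would take
   at p a value inside an ellipse, that is, the value of some
   h cos(m t/2 - a), scaled by at most 1; but Q minus this function changes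
   sign m times on the circle, so it has no zero off the circle.  Hence
   sin(L/4)^m < h/2 when s >= 2, and a Chebyshev polynomial of an arc has a
   strictly smaller set E.  The same count of sign changes gives max |Q| >= 2
   and the Chebyshev polynomials themselves. *)

Require Import Defs.
From Stdlib Require Import Reals List.
Open Scope R_scope.

(** The difficulty lies in the factors of the product. At a root p of A - B put u = (P + A Y)/h and
    v = (P - A Y)/h. Then u v = eta p^m and u + v = 2 P/h, so being outside the ellipse means that
    one of |u|, |v| exceeds 1 and the other is below 1. It does not tell which, and with v as the
    large one the inequality would be reversed. A separate count of sign changes, for real
    combinations of P, A Y and B Y with suitable phases, shows that P/(A Y) has nonnegative real
    part at p, whence |v| <= |u|. The number sin(L/4) enters through constant coefficients. Those of
    P^2 - eta h^2 z^m = A B Y^2 give the sum of all ends modulo 2 pi, and interlacing with the zeros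
    of P removes the ambiguity. The half-sums of the left and of the right ends then differ from
    that of the zeros of P by L/4 and pi - L/4. This gives |P + A Y|(0) = 2 cos(L/4) and |A - B|(0)
    = 4 sin(L/4) cos(L/4), and the cosine cancels from the product. *)

Module LevelSets.

From Stdlib Require Import ZArith Lra Lia ClassicalEpsilon Classical Permutation Sorted.
From Coquelicot Require Import Coquelicot.
Require Import Defs.
Import ListNotations.

(** * Integrals of indicators of level sets *)

Section Measure.

Definition level_ind (f : R -> R) (h t : R) : R := if Rle_dec h (f t) then 1 else 0.

Lemma level_ind_1 f h t : h <= f t -> level_ind f h t = 1.
Proof. unfold level_ind; destruct (Rle_dec h (f t)); tauto. Qed.

Lemma level_ind_0 f h t : f t < h -> level_ind f h t = 0.
Proof. unfold level_ind; destruct (Rle_dec h (f t)); lra. Qed.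

Lemma level_ind_bounds f h t : 0 <= level_ind f h t <= 1.
Proof. unfold level_ind; destruct (Rle_dec h (f t)); lra. Qed.

Lemma is_RInt_cst_ext (f : R -> R) (c u v : R) : u <= v ->
  (forall t, u < t < v -> f t = c) -> is_RInt f u v (c * (v - u)).
Proof.
  intros uv H. apply is_RInt_ext with (fun _ => c).
  - intros x Hx. rewrite Rmin_left, Rmax_right in Hx by lra. now rewrite H.
  - replace (c * (v - u)) with (scal (v - u) c) by (unfold scal; simpl; unfold mult; simpl; ring).
    apply (is_RInt_const (V := R_NormedModule)).
Qed.

Lemma is_RInt_level_ind_gap (f : R -> R) (h u v l r : R) : u <= l <= r -> r <= v ->
  (forall t, u < t < v -> (h <= f t <-> l <= t <= r)) ->
  is_RInt (level_ind f h) u v (r - l).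
Proof.
  intros ulr rv H.
  replace (r - l) with (plus (plus (0 * (l - u)) (1 * (r - l))) (0 * (v - r)))
    by (unfold plus; simpl; ring).
  apply (is_RInt_Chasles (V := R_NormedModule)) with r.
  - apply (is_RInt_Chasles (V := R_NormedModule)) with l; apply is_RInt_cst_ext; try lra.
    + intros t Ht; apply level_ind_0, Rnot_le_lt; intros h1; apply H in h1; lra.
    + intros t Ht; apply level_ind_1, H; lra.
  - apply is_RInt_cst_ext; try lra.
    intros t Ht; apply level_ind_0, Rnot_le_lt; intros h1; apply H in h1; lra.
Qed.

Lemma is_RInt_level_ind_empty (f : R -> R) (h u v : R) : u <= v ->
  (forall t, u < t < v -> f t < h) -> is_RInt (level_ind f h) u v 0.
Proof.
  intros uv H. replace 0 with (0 * (v - u)) by ring.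
  apply is_RInt_cst_ext; trivial. intros t Ht; now apply level_ind_0, H.
Qed.

Lemma is_RInt_sum (f : R -> R) (x : nat -> R) (c : nat -> R) (m : nat) :
  (forall i, (i < m)%nat -> is_RInt f (x i) (x (S i)) (c i)) ->
  is_RInt f (x 0%nat) (x m) (fold_right (fun i a => c i + a) 0 (seq 0 m)).
Proof.
  induction m as [|m IH]; intros H.
  - apply (is_RInt_point (V := R_NormedModule)).
  - replace (fold_right (fun i a => c i + a) 0 (seq 0 (S m)))
      with (plus (fold_right (fun i a => c i + a) 0 (seq 0 m)) (c m)).
    + apply (is_RInt_Chasles (V := R_NormedModule)) with (x m); auto.
    + rewrite seq_S, fold_right_app. unfold plus; simpl.
      clear. generalize (seq 0 m) as s. induction s as [|k s IHs]; simpl; [lra|].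
      rewrite <- IHs; lra.
Qed.

(** The measure is taken over [0, 2 pi], whereas the gaps between zeros tile a window that starts at
    the first zero. The piece beyond [T] is translated back onto [0, w]. *)
Lemma RInt_period (f : R -> R) (T w : R) : 0 <= w <= T ->
  (forall t, f (t + T) = f t) -> ex_RInt f w (w + T) ->
  ex_RInt f 0 T /\ RInt f 0 T = RInt f w (w + T).
Proof.
  intros wT per ex.
  assert (ex1 : ex_RInt f w T) by (apply (ex_RInt_Chasles_1 (V := R_CompleteNormedModule)) with (w + T); [lra|trivial]).
  assert (ex2 : ex_RInt f T (w + T)) by (apply (ex_RInt_Chasles_2 (V := R_CompleteNormedModule)) with w; [lra|trivial]).
  assert (sh : is_RInt f 0 w (RInt f T (w + T))).
  { apply is_RInt_ext with (fun t => scal 1 (f (1 * t + T))).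
    - intros t _. unfold scal; simpl; unfold mult; simpl. now rewrite !Rmult_1_l, per.
    - apply (is_RInt_comp_lin (V := R_NormedModule)).
      replace (1 * 0 + T) with T by ring. replace (1 * w + T) with (w + T) by ring.
      now apply (RInt_correct (V := R_CompleteNormedModule)). }
  assert (all : is_RInt f 0 T (plus (RInt f T (w + T)) (RInt f w T))).
  { apply (is_RInt_Chasles (V := R_NormedModule)) with w; trivial.
    now apply (RInt_correct (V := R_CompleteNormedModule)). }
  split; [now exists (plus (RInt f T (w + T)) (RInt f w T))|].
  rewrite (is_RInt_unique (V := R_CompleteNormedModule) _ _ _ _ all).
  rewrite <- (RInt_Chasles (V := R_CompleteNormedModule) f w T (w + T)); trivial.
  unfold plus; simpl; ring.
Qed.

(** A strict comparison of integrals needs a whole interval on which the indicators differ; there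
    the integral gains [y - x]. *)
Lemma RInt_lt_gap (f g : R -> R) (a b x y : R) : a <= x < y -> y <= b ->
  ex_RInt f a b -> ex_RInt g a b -> (forall t, a < t < b -> f t <= g t) ->
  (forall t, x < t < y -> f t + 1 <= g t) -> RInt f a b < RInt g a b.
Proof.
  intros axy yb exf exg fg fg1.
  assert (E : forall k : R -> R, ex_RInt k a b -> ex_RInt k a x /\ ex_RInt k x y /\ ex_RInt k y b).
  { intros k ek.
    assert (e1 : ex_RInt k a y) by (apply (ex_RInt_Chasles_1 (V := R_CompleteNormedModule)) with b; [lra|trivial]).
    split; [|split].
    - apply (ex_RInt_Chasles_1 (V := R_CompleteNormedModule)) with y; [lra|trivial].
    - apply (ex_RInt_Chasles_2 (V := R_CompleteNormedModule)) with a; [lra|trivial].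
    - apply (ex_RInt_Chasles_2 (V := R_CompleteNormedModule)) with a; [lra|trivial]. }
  destruct (E f exf) as (f1 & f2 & f3). destruct (E g exg) as (g1 & g2 & g3).
  assert (S : forall k : R -> R, ex_RInt k a x -> ex_RInt k x y -> ex_RInt k y b ->
     RInt k a b = RInt k a x + RInt k x y + RInt k y b).
  { intros k k1 k2 k3.
    rewrite <- (RInt_Chasles (V := R_CompleteNormedModule) k a y b); trivial.
    - rewrite <- (RInt_Chasles (V := R_CompleteNormedModule) k a x y); trivial.
    - apply (ex_RInt_Chasles (V := R_NormedModule)) with x; trivial. }
  rewrite (S f), (S g) by trivial.
  assert (RInt f a x <= RInt g a x) by (apply RInt_le; trivial; try lra; intros; apply fg; lra).
  assert (RInt f y b <= RInt g y b) by (apply RInt_le; trivial; try lra; intros; apply fg; lra).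
  assert (RInt f x y + (y - x) <= RInt g x y).
  { replace (y - x) with (RInt (fun _ => 1) x y)
      by (rewrite RInt_const; unfold scal; simpl; unfold mult; simpl; ring).
    rewrite <- (RInt_plus (V := R_CompleteNormedModule) f (fun _ => 1)); trivial.
    2: apply ex_RInt_const.
    apply RInt_le; [lra| |trivial|].
    - apply (ex_RInt_plus (V := R_NormedModule)); trivial; apply ex_RInt_const.
    - intros t Ht; unfold plus; simpl; now apply fg1. }
  lra.
Qed.

End Measure.

(** * The sine product and its shape between consecutive zeros *)

Section Sine.

Definition Qf (L : list R) (t : R) : R :=
  fold_right (fun x acc => 2 * sin ((t - x) / 2) * acc) 1 L.

(** Each factor is a chord of the unit circle, of length 2 |sin((t - x)/2)|. Writing t and x through
    their half-sum and half-difference leaves only sin^2 + cos^2 = 1. *)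
Lemma Cmod_polyP L t : Cmod (polyP L (cexp_i t)) = Rabs (Qf L t).
Proof.
  assert (M : forall z w, Cmod (Cmul z w) = Cmod z * Cmod w).
  { intros [a b] [c d]; unfold Cmod, Cmul; simpl.
    rewrite <- sqrt_mult by nra. f_equal; ring. }
  induction L as [|x L IH]; simpl.
  - unfold Cmod; simpl. rewrite Rabs_R1. replace (1 * (1 * 1) + 0 * (0 * 1)) with 1 by ring. apply sqrt_1.
  - rewrite M, IH, Rabs_mult. f_equal.
    unfold Cmod, Csub, cexp_i; simpl.
    rewrite <- sqrt_Rsqr_abs. f_equal. unfold Rsqr.
    replace t with ((t + x) / 2 + (t - x) / 2) at 1 2 3 4 by field.
    replace x with ((t + x) / 2 - (t - x) / 2) at 3 6 9 12 by field.
    rewrite !cos_plus, !sin_plus, !cos_minus, !sin_minus.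
    set (a := (t + x) / 2). set (b := (t - x) / 2).
    assert (Ea := sin2_cos2 a). unfold Rsqr in Ea.
    transitivity (4 * (sin b * sin b) * (sin a * sin a + cos a * cos a)); [ring|].
    rewrite Ea; ring.
Qed.

Lemma Qf_cont L t : continuity_pt (Qf L) t.
Proof.
  induction L as [|x L IH].
  - apply continuity_pt_const; intros ? ?; reflexivity.
  - change (continuity_pt (mult_fct (fun t => 2 * sin ((t - x) / 2)) (Qf L)) t).
    apply continuity_pt_mult; trivial.
    apply derivable_continuous_pt. apply ex_derive_Reals_0. auto_derive. trivial.
Qed.

Lemma absQ_cont L t : continuity_pt (fun t => Rabs (Qf L t)) t.
Proof.
  apply (continuity_pt_comp (Qf L) Rabs); [apply Qf_cont|apply Rcontinuity_abs].
Qed.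

Lemma sin_half_2PI t x : Rabs (sin ((t + 2 * PI - x) / 2)) = Rabs (sin ((t - x) / 2)).
Proof.
  replace ((t + 2 * PI - x) / 2) with ((t - x) / 2 + PI) by field.
  now rewrite neg_sin, Rabs_Ropp.
Qed.

Lemma absQ_2PI L t : Rabs (Qf L (t + 2 * PI)) = Rabs (Qf L t).
Proof.
  induction L as [|x L IH]; simpl; trivial.
  rewrite !Rabs_mult, IH, sin_half_2PI; trivial.
Qed.

Lemma Qf_root L x : In x L -> Qf L x = 0.
Proof.
  induction L as [|y L IH]; simpl; [tauto|]. intros [->|H].
  - replace ((x - x) / 2) with 0 by field. rewrite sin_0; ring.
  - rewrite IH by trivial; ring.
Qed.

(** Every zero lies at most one turn before or after the whole gap, so that no factor sin((t - x)/2)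
    changes sign inside it. *)
Definition gapok (L : list R) (u v : R) : Prop :=
  forall x, In x L -> (x <= u /\ v <= x + 2 * PI) \/ (v <= x /\ x <= u + 2 * PI).

(** Strict midpoint log-concavity of one factor: sin(c - d) sin(c + d) = sin^2 c - sin^2 d. *)
Lemma sin_half_mid (x u v a b : R) :
  (x <= u /\ v <= x + 2 * PI) \/ (v <= x /\ x <= u + 2 * PI) -> u < a < b -> b < v ->
  0 < (2 * sin ((a - x) / 2)) * (2 * sin ((b - x) / 2)) < (2 * sin (((a + b) / 2 - x) / 2)) ^ 2.
Proof.
  intros H uab bv.
  assert (P := PI_RGT_0).
  set (c := ((a + b) / 2 - x) / 2). set (d := (b - a) / 4).
  replace ((a - x) / 2) with (c - d) by (unfold c, d; field).
  replace ((b - x) / 2) with (c + d) by (unfold c, d; field).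
  assert (Sd : 0 < sin d) by (apply sin_gt_0; unfold d; lra).
  assert (S1 : 0 < sin (c - d) * sin (c + d)).
  { destruct H as [H|H].
    - apply Rmult_lt_0_compat; apply sin_gt_0; unfold c, d; lra.
    - replace (sin (c - d) * sin (c + d)) with (sin (- (c - d)) * sin (- (c + d))) by (rewrite !sin_neg; ring).
      apply Rmult_lt_0_compat; apply sin_gt_0; unfold c, d; lra. }
  split; [nra|].
  rewrite sin_plus, sin_minus in *.
  assert (E1 := sin2_cos2 c); assert (E2 := sin2_cos2 d); unfold Rsqr in *.
  nra.
Qed.

Lemma Qf_mid L u v a b : L <> [] -> gapok L u v -> u < a < b -> b < v ->
  0 < Qf L a * Qf L b < Qf L ((a + b) / 2) ^ 2.
Proof.
  intros L0 G uab bv.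
  (* The empty product gives equality only, so the induction carries strictness as an alternative to
     emptiness. *)
  assert (W : (0 < Qf L a * Qf L b) /\ (L = [] /\ Qf L a * Qf L b <= Qf L ((a + b) / 2) ^ 2 \/ Qf L a * Qf L b < Qf L ((a + b) / 2) ^ 2)).
  { clear L0. induction L as [|x L IH].
    - simpl; split; [lra|left; split; [trivial|lra]].
    - destruct IH as [IH1 IH2]; [intros y Hy; apply G; now right|].
      assert (IH3 : Qf L a * Qf L b <= Qf L ((a + b) / 2) ^ 2) by (destruct IH2 as [[_ ?]|?]; lra).
      assert (S := sin_half_mid x u v a b (G x (or_introl eq_refl)) uab bv).
      simpl Qf. set (p := 2 * sin ((a - x) / 2)) in *. set (q := 2 * sin ((b - x) / 2)) in *.
      set (s := 2 * sin (((a + b) / 2 - x) / 2)) in *.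
      replace (p * Qf L a * (q * Qf L b)) with ((p * q) * (Qf L a * Qf L b)) by ring.
      replace ((s * Qf L ((a + b) / 2)) ^ 2) with (s ^ 2 * Qf L ((a + b) / 2) ^ 2) by ring.
      split; [apply Rmult_lt_0_compat; lra|right].
      set (A := Qf L a * Qf L b) in *. set (B := Qf L ((a + b) / 2) ^ 2) in *.
      apply Rlt_le_trans with (s ^ 2 * A).
      + apply Rmult_lt_compat_r; lra.
      + apply Rmult_le_compat_l; nra. }
  destruct W as [W1 [[W2 _]|W2]]; [contradiction|lra].
Qed.

Lemma absQ_mid L u v a b : L <> [] -> gapok L u v -> u < a < b -> b < v ->
  Rabs (Qf L a) * Rabs (Qf L b) < Rabs (Qf L ((a + b) / 2)) ^ 2.
Proof.
  intros L0 G uab bv. destruct (Qf_mid L u v a b L0 G uab bv) as [H1 H2].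
  rewrite <- Rabs_mult, Rabs_right by lra.
  now rewrite pow2_abs.
Qed.

(** Otherwise |Q| has a minimum over [a, b] at an interior point: if it is attained at an end, then
    z is a minimum as well. Two points symmetric about it contradict [absQ_mid]. *)
Lemma absQ_quasi L u v a z b : L <> [] -> gapok L u v -> u < a < z -> z < b < v ->
  Rmin (Rabs (Qf L a)) (Rabs (Qf L b)) < Rabs (Qf L z).
Proof.
  intros L0 G uaz zbv. apply Rnot_le_lt. intros Hz.
  set (f := fun t => Rabs (Qf L t)).
  assert (Key : exists z0, a < z0 < b /\ forall c, a <= c <= b -> f z0 <= f c).
  { destruct (continuity_ab_min f a b) as [z0 [Hmin Hz0]]; [lra|intros; apply absQ_cont|].
    destruct (Req_dec z0 a) as [->|n1]; [|destruct (Req_dec z0 b) as [->|n2]].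
    - exists z; split; [lra|]. intros c Hc. apply Rle_trans with (f a); [|now apply Hmin].
      apply Rle_trans with (1 := Hz). apply Rmin_l.
    - exists z; split; [lra|]. intros c Hc. apply Rle_trans with (f b); [|now apply Hmin].
      apply Rle_trans with (1 := Hz). apply Rmin_r.
    - exists z0; split; [lra|trivial]. }
  destruct Key as [z0 [Hz0 Hmin]].
  set (e := Rmin (z0 - a) (b - z0)).
  assert (e1 : e <= z0 - a) by apply Rmin_l. assert (e2 : e <= b - z0) by apply Rmin_r.
  assert (e0 : 0 < e) by (apply Rmin_glb_lt; lra).
  assert (M := absQ_mid L u v (z0 - e) (z0 + e) L0 G ltac:(lra) ltac:(lra)).
  replace ((z0 - e + (z0 + e)) / 2) with z0 in M by field.
  assert (H1 := Hmin (z0 - e) ltac:(lra)). assert (H2 := Hmin (z0 + e) ltac:(lra)).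
  unfold f in *. assert (P := Rabs_pos (Qf L z0)). nra.
Qed.

Lemma IVT_value (f : R -> R) (a b h : R) : (forall t, continuity_pt f t) -> a < b ->
  (f a - h) * (f b - h) < 0 -> exists z, a < z < b /\ f z = h.
Proof.
  intros fc ab fab.
  destruct (IVT_cor (fun t => f t - h) a b) as [z [Hz fz]]; try lra.
  - intros t. apply (continuity_pt_minus f (fun _ => h)); trivial.
    apply continuity_pt_const; intros ? ?; reflexivity.
  - exists z. assert (f z = h) by lra. split; trivial.
    split; apply Rnot_le_lt; intros Hle.
    + assert (z = a) by lra; subst; nra.
    + assert (z = b) by lra; subst; nra.
Qed.

(** The maximum over the gap decides. Below h the set is empty; above h the intermediate value
    theorem gives both ends and quasi-concavity the rest; at h a second maximum point would force a
    larger value at the midpoint. The last clause records that an isolated point is a point of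
    tangency, which later makes it a double zero of Q^2 - h^2. *)
Lemma gap_structure L u v h : L <> [] -> gapok L u v -> u < v ->
  Qf L u = 0 -> Qf L v = 0 -> 0 < h ->
  (forall t, u <= t <= v -> Rabs (Qf L t) < h) \/
  exists l r, u < l /\ l <= r /\ r < v /\ Rabs (Qf L l) = h /\ Rabs (Qf L r) = h /\
    (forall t, u <= t <= v -> (h <= Rabs (Qf L t) <-> l <= t <= r)) /\
    (l = r -> forall t, u <= t <= v -> Rabs (Qf L t) <= h).
Proof.
  intros L0 G uv Qu Qv h0.
  set (f := fun t => Rabs (Qf L t)).
  assert (fu : f u = 0) by (unfold f; rewrite Qu; apply Rabs_R0).
  assert (fv : f v = 0) by (unfold f; rewrite Qv; apply Rabs_R0).
  destruct (continuity_ab_maj f u v) as [tm [Hmax Htm]]; [lra|intros; apply absQ_cont|].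
  destruct (Rlt_le_dec (f tm) h) as [lt|le].
  { left. intros t Ht. apply Rle_lt_trans with (2 := lt). now apply Hmax. }
  right.
  assert (tmu : tm <> u) by (intros ->; lra). assert (tmv : tm <> v) by (intros ->; lra).
  destruct (Rle_lt_or_eq_dec _ _ le) as [gt|eq].
  - destruct (IVT_value f u tm h) as [l [Hl fl]]; [intros; apply absQ_cont|lra|nra|].
    destruct (IVT_value f tm v h) as [r [Hr fr]]; [intros; apply absQ_cont|lra|nra|].
    exists l, r. repeat (split; [first [lra|assumption]|]). split; [|intros; lra].
    intros t Ht. split.
    + intros ft. split; apply Rnot_lt_le; intros lt.
      * assert (t <> u) by (intros ->; unfold f in fu; lra).
        assert (Q := absQ_quasi L u v t l tm L0 G ltac:(lra) ltac:(lra)).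
        fold (f t) (f tm) (f l) in Q. fold (f t) in ft.
        assert (h <= Rmin (f t) (f tm)) by (apply Rmin_glb; lra). lra.
      * assert (t <> v) by (intros ->; unfold f in fv; lra).
        assert (Q := absQ_quasi L u v tm r t L0 G ltac:(lra) ltac:(lra)).
        fold (f t) (f tm) (f r) in Q. fold (f t) in ft.
        assert (h <= Rmin (f tm) (f t)) by (apply Rmin_glb; lra). lra.
    + intros Hlr. fold (f t).
      destruct (Req_dec t l) as [->|n1]; [lra|]. destruct (Req_dec t r) as [->|n2]; [lra|].
      assert (Q := absQ_quasi L u v l t r L0 G ltac:(lra) ltac:(lra)).
      fold (f l) (f r) (f t) in Q. rewrite fl, fr, Rmin_left in Q; lra.
  - assert (Hle : forall t, u <= t <= v -> f t <= h) by (intros t Ht; rewrite eq; now apply Hmax).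
    exists tm, tm. repeat (split; [first [lra|now symmetry]|]). split; [|intros _; exact Hle].
    intros t Ht; fold (f t). split; [|intros Hlr; replace t with tm by lra; lra].
    intros ft. assert (t <> u) by (intros ->; lra). assert (t <> v) by (intros ->; lra).
    assert (t = tm); [|lra].
    destruct (Rtotal_order t tm) as [lt|[e|gt]]; trivial; exfalso.
    + assert (M := absQ_mid L u v t tm L0 G ltac:(lra) ltac:(lra)).
      fold (f t) (f tm) (f ((t + tm) / 2)) in M.
      assert (K := Hle ((t + tm) / 2) ltac:(lra)).
      assert (0 <= f ((t + tm) / 2)) by apply Rabs_pos. nra.
    + assert (M := absQ_mid L u v tm t L0 G ltac:(lra) ltac:(lra)).
      fold (f t) (f tm) (f ((tm + t) / 2)) in M.
      assert (K := Hle ((tm + t) / 2) ltac:(lra)).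
      assert (0 <= f ((tm + t) / 2)) by apply Rabs_pos. nra.
Qed.

End Sine.

(** * Sorted zeros, integrability, and the infimum of the measures *)

Section Normal.

Lemma Qf_perm L L' t : Permutation L L' -> Qf L t = Qf L' t.
Proof.
  induction 1; simpl; trivial.
  - now rewrite IHPermutation.
  - ring.
  - congruence.
Qed.

Lemma reduce_2PI (w x : R) : exists k : Z, w <= x + 2 * IZR k * PI < w + 2 * PI.
Proof.
  assert (P := PI_RGT_0).
  destruct (archimed ((w - x) / (2 * PI))) as [a1 a2].
  set (k := up ((w - x) / (2 * PI))) in *.
  set (y := (w - x) / (2 * PI)) in *.
  assert (E : w - x = y * (2 * PI)) by (unfold y; field; lra).
  (* [archimed] allows [IZR k = y + 1], which would land on the excluded right end of the window. *)
  destruct (Req_dec (IZR k - y) 1) as [e|ne].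
  - exists (k - 1)%Z. rewrite minus_IZR. assert (IZR k = y + 1) by lra. rewrite H. nra.
  - exists k. nra.
Qed.

Lemma abs_periodic_Z (f : R -> R) : (forall t, f (t + 2 * PI) = f t) ->
  forall (k : Z) t, f (t + 2 * IZR k * PI) = f t.
Proof.
  intros per.
  assert (N : forall n t, f (t + 2 * INR n * PI) = f t).
  { induction n as [|n IH]; intros t.
    - simpl. f_equal; ring.
    - rewrite S_INR. replace (t + 2 * (INR n + 1) * PI) with ((t + 2 * INR n * PI) + 2 * PI) by ring.
      now rewrite per. }
  intros k t. destruct (Z.le_gt_cases 0 k) as [H|H].
  - rewrite <- (Z2Nat.id k), <- INR_IZR_INZ by lia. apply N.
  - rewrite <- (N (Z.to_nat (- k)) (t + 2 * IZR k * PI)).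
    rewrite INR_IZR_INZ, Z2Nat.id, opp_IZR by lia. f_equal; ring.
Qed.

Lemma absQ_Z L (k : Z) t : Rabs (Qf L (t + 2 * IZR k * PI)) = Rabs (Qf L t).
Proof. apply (abs_periodic_Z (fun t => Rabs (Qf L t))), absQ_2PI. Qed.

Lemma absQ_shift L x (k : Z) t : Rabs (Qf (x + 2 * IZR k * PI :: L) t) = Rabs (Qf (x :: L) t).
Proof.
  simpl. rewrite !Rabs_mult. f_equal. f_equal.
  rewrite <- (abs_periodic_Z (fun t => Rabs (sin ((t - (x + 2 * IZR k * PI)) / 2)))
    (fun t => sin_half_2PI t _) k t).
  f_equal; f_equal; field.
Qed.

Lemma absQ_reduced (L : list R) : exists L', length L' = length L /\
  (forall x, In x L' -> 0 <= x < 2 * PI) /\ forall t, Rabs (Qf L' t) = Rabs (Qf L t).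
Proof.
  induction L as [|x L (L' & len & H1 & H2)].
  - exists []. simpl; intuition.
  - destruct (reduce_2PI 0 x) as [k Hk]. rewrite Rplus_0_l in Hk.
    exists (x + 2 * IZR k * PI :: L'). split; [simpl; lia|]. split.
    + intros y [<-|Hy]; [lra|now apply H1].
    + intros t. rewrite absQ_shift. simpl. rewrite !(Rabs_mult (2 * _)). now rewrite H2.
Qed.

Lemma sorted_exists (L : list R) : exists S, Permutation L S /\ StronglySorted Rle S.
Proof.
  assert (Ins : forall x S, StronglySorted Rle S ->
    exists S', Permutation (x :: S) S' /\ StronglySorted Rle S').
  { intros x S. induction S as [|y S IH]; intros HS.
    - exists [x]. split; [apply Permutation_refl|repeat constructor].
    - inversion HS as [|? ? HS1 HS2]; subst.
      destruct (Rle_lt_dec x y) as [xy|yx].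
      + exists (x :: y :: S). split; [apply Permutation_refl|].
        constructor; trivial. constructor; trivial.
        apply Forall_forall. intros z Hz. rewrite Forall_forall in HS2.
        apply Rle_trans with y; auto.
      + destruct (IH HS1) as [S' [P1 P2]]. exists (y :: S'). split.
        * apply perm_trans with (y :: x :: S); [apply perm_swap|now apply perm_skip].
        * constructor; trivial. apply Forall_forall. intros z Hz.
          apply Permutation_in with (l' := x :: S) in Hz; [|now apply Permutation_sym].
          destruct Hz as [<-|Hz]; [lra|]. rewrite Forall_forall in HS2. now apply HS2. }
  induction L as [|x L [S [P1 P2]]].
  - exists []. split; [apply perm_nil|constructor].
  - destruct (Ins x S P2) as [S' [Q1 Q2]]. exists S'. split; trivial.
    apply perm_trans with (x :: S); trivial. now apply perm_skip.
Qed.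

Lemma sorted_nth (S : list R) i j : StronglySorted Rle S -> (i <= j < length S)%nat ->
  nth i S 0 <= nth j S 0.
Proof.
  intros HS. revert i j. induction HS as [|x S HS IH HF]; simpl; intros i j Hij; [lia|].
  destruct i as [|i], j as [|j]; try lia; try lra.
  - rewrite Forall_forall in HF. apply HF, nth_In. lia.
  - apply IH. lia.
Qed.

(** The value at m repeats the first zero one turn later, so that the m gaps from [phi i] to
    [phi (S i)] include the one that closes the circle. *)
Definition normal (phi : nat -> R) (m : nat) : Prop :=
  (forall i, (i < m)%nat -> phi i <= phi (S i)) /\ phi m = phi 0%nat + 2 * PI /\
  (forall i, (i < m)%nat -> 0 <= phi i < 2 * PI).

Definition zeros (phi : nat -> R) (m : nat) : list R := map phi (seq 0 m).

Lemma normal_exists (L : list R) m : length L = m -> (1 <= m)%nat ->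
  exists phi, normal phi m /\ forall t, Rabs (Qf (zeros phi m) t) = Rabs (Qf L t).
Proof.
  intros len m1.
  destruct (absQ_reduced L) as (L' & len' & b & E).
  destruct (sorted_exists L') as (S & P & HS).
  assert (lS : length S = m) by (rewrite <- (Permutation_length P); congruence).
  assert (bS : forall i, (i < m)%nat -> 0 <= nth i S 0 < 2 * PI).
  { intros i Hi. apply b. apply Permutation_in with S; [now apply Permutation_sym|].
    apply nth_In. lia. }
  set (phi := fun i => if (i <? m)%nat then nth i S 0 else nth 0 S 0 + 2 * PI).
  exists phi.
  assert (Z : zeros phi m = S).
  { apply nth_ext with (phi 0%nat) 0; unfold zeros; rewrite length_map, length_seq; [lia|].
    intros n Hn. rewrite map_nth, seq_nth by lia. unfold phi; simpl.
    now rewrite (proj2 (Nat.ltb_lt n m)). }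
  unfold phi in *; clear phi.
  split; [split; [|split]|].
  - intros i Hi. rewrite (proj2 (Nat.ltb_lt i m)) by lia.
    destruct (Nat.ltb_spec (Datatypes.S i) m).
    + apply sorted_nth; trivial; lia.
    + assert (A := bS i Hi). assert (B := bS 0%nat ltac:(lia)). lra.
  - rewrite Nat.ltb_irrefl. now rewrite (proj2 (Nat.ltb_lt 0 m)) by lia.
  - intros i Hi. rewrite (proj2 (Nat.ltb_lt i m)) by lia. now apply bS.
  - intros t. rewrite Z, <- E. now rewrite (Qf_perm L' S t P).
Qed.

Lemma normal_mono phi m i j : normal phi m -> (i <= j <= m)%nat -> phi i <= phi j.
Proof.
  intros (N1 & _) Hij. induction j as [|j IH].
  - replace i with 0%nat by lia. lra.
  - destruct (Nat.eq_dec i (S j)) as [->|ne]; [lra|].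
    apply Rle_trans with (phi j); [apply IH; lia|apply N1; lia].
Qed.

Lemma normal_gapok phi m i : normal phi m -> (i < m)%nat ->
  gapok (zeros phi m) (phi i) (phi (S i)).
Proof.
  intros N Hi x Hx. unfold zeros in Hx. apply in_map_iff in Hx. destruct Hx as [j [<- Hj]].
  apply in_seq in Hj. destruct (proj2 N) as [Nm _].
  destruct (Nat.le_gt_cases j i) as [ji|ij].
  - left. split; [apply normal_mono with m; trivial; lia|].
    assert (A := normal_mono phi m (S i) m N ltac:(lia)).
    assert (B := normal_mono phi m 0 j N ltac:(lia)). lra.
  - right. split; [apply normal_mono with m; trivial; lia|].
    assert (A := normal_mono phi m j m N ltac:(lia)).
    assert (B := normal_mono phi m 0 i N ltac:(lia)). lra.
Qed.

Lemma normal_root phi m i : normal phi m -> (1 <= m)%nat -> (i <= m)%nat ->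
  Qf (zeros phi m) (phi i) = 0.
Proof.
  intros N m1 Hi.
  assert (A : forall j, (j < m)%nat -> Qf (zeros phi m) (phi j) = 0).
  { intros j Hj. apply Qf_root, in_map, in_seq. lia. }
  destruct (Nat.eq_dec i m) as [->|ne]; [|apply A; lia].
  destruct N as (_ & -> & _).
  assert (B := absQ_2PI (zeros phi m) (phi 0%nat)). rewrite A, Rabs_R0 in B by lia.
  destruct (Req_dec (Qf (zeros phi m) (phi 0%nat + 2 * PI)) 0); trivial.
  now apply Rabs_no_R0 in H.
Qed.

Lemma zeros_nonempty phi m : (1 <= m)%nat -> zeros phi m <> [].
Proof. unfold zeros; destruct m; [lia|]; discriminate. Qed.

Definition absQ (L : list R) (t : R) : R := Rabs (Qf L t).

Lemma ex_RInt_normal phi m h : normal phi m -> (1 <= m)%nat -> 0 < h ->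
  ex_RInt (level_ind (absQ (zeros phi m)) h) (phi 0%nat) (phi m).
Proof.
  intros N m1 h0.
  assert (A : forall k, (k <= m)%nat -> ex_RInt (level_ind (absQ (zeros phi m)) h) (phi 0%nat) (phi k)).
  { induction k as [|k IH]; intros Hk.
    - apply (ex_RInt_point (V := R_NormedModule)).
    - apply (ex_RInt_Chasles (V := R_NormedModule)) with (phi k); [apply IH; lia|].
      (* A multiple zero produces a gap of length 0, to which [gap_structure] does not apply. *)
      destruct (Rle_lt_or_eq_dec _ _ (proj1 N k ltac:(lia))) as [lt|eq].
      + destruct (gap_structure (zeros phi m) (phi k) (phi (S k)) h) as [E|(l & r & H1 & H2 & H3 & _ & _ & H4 & _)]; trivial.
        * now apply zeros_nonempty.
        * apply normal_gapok; trivial; lia.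
        * apply normal_root; trivial; lia.
        * apply normal_root; trivial; lia.
        * exists 0. apply is_RInt_level_ind_empty; [lra|]. intros t Ht; apply E; lra.
        * exists (r - l). apply is_RInt_level_ind_gap; [lra|lra|]. intros t Ht; apply H4; lra.
      + rewrite <- eq. apply (ex_RInt_point (V := R_NormedModule)). }
  now apply A.
Qed.

(** [mes] is a value picked by [epsilon] and means something only once integrability is known; this
    comes from sorting the zeros and treating the gaps one by one. *)
Lemma mes_window L h w : L <> [] -> 0 < h -> 0 <= w <= 2 * PI ->
  ex_RInt (level_ind (absQ L) h) w (w + 2 * PI) /\
  mes (sup_set L h) = RInt (level_ind (absQ L) h) w (w + 2 * PI).
Proof.
  intros L0 h0 Hw. assert (P := PI_RGT_0).
  assert (per : forall t, level_ind (absQ L) h (t + 2 * PI) = level_ind (absQ L) h t).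
  { intros t. unfold level_ind, absQ. now rewrite absQ_2PI. }
  assert (ex0 : ex_RInt (level_ind (absQ L) h) 0 (2 * PI)).
  { destruct (normal_exists L (length L) eq_refl) as [phi [N E]].
    { destruct L; [contradiction|simpl; lia]. }
    assert (l1 : (1 <= length L)%nat) by (destruct L; [contradiction|simpl; lia]).
    assert (A := ex_RInt_normal phi (length L) h N l1 h0).
    rewrite (proj1 (proj2 N)) in A.
    assert (B := proj2 (proj2 N) 0%nat ltac:(lia)).
    apply (ex_RInt_ext (V := R_NormedModule)) with (level_ind (absQ (zeros phi (length L))) h).
    { intros t _. unfold level_ind, absQ. now rewrite E. }
    apply (RInt_period _ (2 * PI) (phi 0%nat)); [lra| |trivial].
    intros t. unfold level_ind, absQ. now rewrite absQ_2PI. }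
  assert (exw : ex_RInt (level_ind (absQ L) h) w (w + 2 * PI)).
  (* The window is contained in [0, 4 pi], where integrability follows by translating one period. *)
  { assert (ex1 : ex_RInt (level_ind (absQ L) h) (2 * PI) (4 * PI)).
    { apply (ex_RInt_ext (V := R_NormedModule)) with (fun t => scal 1 (level_ind (absQ L) h (1 * t + - (2 * PI)))).
      - intros t _. unfold scal; simpl; unfold mult; simpl. rewrite !Rmult_1_l.
        rewrite <- per. f_equal; ring.
      - apply (ex_RInt_comp_lin (V := R_NormedModule)).
        replace (1 * (2 * PI) + - (2 * PI)) with 0 by ring.
        replace (1 * (4 * PI) + - (2 * PI)) with (2 * PI) by ring. trivial. }
    assert (ex2 : ex_RInt (level_ind (absQ L) h) 0 (4 * PI))
      by (apply (ex_RInt_Chasles (V := R_NormedModule)) with (2 * PI); trivial).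
    apply (ex_RInt_Chasles_2 (V := R_CompleteNormedModule)) with 0; [lra|].
    apply (ex_RInt_Chasles_1 (V := R_CompleteNormedModule)) with (4 * PI); [lra|trivial]. }
  split; trivial.
  destruct (RInt_period (level_ind (absQ L) h) (2 * PI) w Hw per exw) as [_ <-].
  assert (Ext : forall t, Rmin 0 (2 * PI) < t < Rmax 0 (2 * PI) ->
     level_ind (absQ L) h t = indic (sup_set L h) t).
  { intros t Ht. rewrite Rmin_left, Rmax_right in Ht by lra.
    unfold level_ind, indic, absQ, sup_set. rewrite Cmod_polyP.
    destruct (Rle_dec h (Rabs (Qf L t))); destruct excluded_middle_informative as [e|e]; trivial; exfalso.
    - apply e; split; lra.
    - destruct e; lra. }
  assert (exI : ex_RInt (indic (sup_set L h)) 0 (2 * PI))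
    by (apply (ex_RInt_ext (V := R_NormedModule)) with (level_ind (absQ L) h); trivial).
  rewrite (RInt_ext (V := R_CompleteNormedModule) _ _ _ _ Ext).
  unfold mes.
  destruct (epsilon_spec (inhabits 0) (fun r => exists pr : Riemann_integrable (indic (sup_set L h)) 0 (2 * PI),
                RiemannInt pr = r)) as [pr Hpr].
  - set (pr := ex_RInt_Reals_0 _ _ _ exI). now exists (RiemannInt pr), pr.
  - rewrite <- Hpr. symmetry. apply RInt_Reals.
Qed.

Lemma mes_ge0 L h : L <> [] -> 0 < h -> 0 <= mes (sup_set L h).
Proof.
  intros L0 h0. assert (P := PI_RGT_0).
  destruct (mes_window L h 0 L0 h0 ltac:(lra)) as [ex ->].
  apply RInt_ge_0; [lra|trivial|]. intros t _; apply level_ind_bounds.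
Qed.

Lemma delta_le m h L : (1 <= m)%nat -> 0 < h -> length L = m ->
  delta m h <= mes (sup_set L h).
Proof.
  intros m1 h0 len.
  assert (NE : forall L : list R, length L = m -> L <> []) by (intros [|? ?] ?; simpl in *; [lia|discriminate]).
  set (E := fun x => exists phis : list R, length phis = m /\ x = mes (sup_set phis h)).
  assert (I : exists d, is_inf E d).
  (* [delta] is an [epsilon] as well: the infimum is shown to exist as the negative of the supremum
     of the reflected set, bounded since measures are nonnegative. *)
  { destruct (completeness (fun y => E (- y))) as [M [M1 M2]].
    - exists 0. intros y (L' & l' & Ey). assert (A := mes_ge0 L' h (NE L' l') h0). lra.
    - exists (- mes (sup_set L h)), L. split; trivial; ring.
    - exists (- M). split.
      + intros x Ex. assert (- x <= M); [|lra]. apply M1. now rewrite Ropp_involutive.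
      + intros y Hy. assert (M <= - y); [|lra]. apply M2.
        intros z Ez. assert (A := Hy _ Ez). lra. }
  assert (H := epsilon_spec (inhabits 0) (is_inf E) I).
  apply H. now exists L.
Qed.

End Normal.

(** * Moving two zeros apart, and the shape of a minimizer *)

Section Widening.

Lemma Qf_bound L t : Rabs (Qf L t) <= 2 ^ length L.
Proof.
  induction L as [|x L IH]; simpl; [rewrite Rabs_R1; lra|].
  rewrite !Rabs_mult, (Rabs_right 2) by lra.
  assert (A : Rabs (sin ((t - x) / 2)) <= 1) by (apply Rabs_le, SIN_bound).
  assert (B := Rabs_pos (sin ((t - x) / 2))). assert (D := Rabs_pos (Qf L t)).
  assert (0 < 2 ^ length L) by (apply pow_lt; lra). nra.
Qed.

Lemma Qf_pair x1 x2 L t : Qf (x1 :: x2 :: L) t =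
  2 * (cos ((x2 - x1) / 2) - cos (t - (x1 + x2) / 2)) * Qf L t.
Proof.
  simpl. replace ((x2 - x1) / 2) with ((t - x1) / 2 - (t - x2) / 2) by field.
  replace (t - (x1 + x2) / 2) with ((t - x1) / 2 + (t - x2) / 2) by field.
  rewrite cos_minus, cos_plus. ring.
Qed.

Lemma cos_lt_outer e s : 0 <= e -> e < s < 2 * PI - e -> cos s < cos e.
Proof.
  intros e0 Hs.
  replace s with ((s + e) / 2 + (s - e) / 2) by field.
  replace e with ((s + e) / 2 - (s - e) / 2) at 3 by field.
  rewrite cos_plus, cos_minus.
  assert (0 < sin ((s + e) / 2)) by (apply sin_gt_0; lra).
  assert (0 < sin ((s - e) / 2)) by (apply sin_gt_0; lra). nra.
Qed.

Lemma cos_diff_le d e : 0 < e -> Rabs (cos (d + e) - cos d) <= e.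
Proof.
  intros e0.
  replace (d + e) with ((d + e / 2) + e / 2) by field.
  replace d with ((d + e / 2) - e / 2) at 2 by field.
  rewrite cos_plus, cos_minus.
  match goal with |- Rabs ?x <= _ => replace x with (- (2 * sin (d + e / 2) * sin (e / 2))) by ring end.
  rewrite Rabs_Ropp, !Rabs_mult, (Rabs_right 2) by lra.
  assert (A : Rabs (sin (d + e / 2)) <= 1) by (apply Rabs_le, SIN_bound).
  assert (A' := Rabs_pos (sin (d + e / 2))).
  assert (B : Rabs (sin (e / 2)) <= e / 2).
  { apply Rabs_le. assert (B1 := sin_lt_x (e / 2) ltac:(lra)). split; [|lra].
    destruct (Rle_lt_dec (e / 2) PI) as [le|gt].
    - assert (0 <= sin (e / 2)) by (apply sin_ge_0; lra). lra.
    - assert (B2 := SIN_bound (e / 2)). assert (P := PI2_3_2). lra. }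
  assert (B' := Rabs_pos (sin (e / 2))). nra.
Qed.

Lemma absQ_window L w t : exists t', w <= t' < w + 2 * PI /\ absQ L t' = absQ L t.
Proof.
  destruct (reduce_2PI w t) as [k Hk]. exists (t + 2 * IZR k * PI).
  split; trivial. apply absQ_Z.
Qed.

Lemma continuity_pt_near (f : R -> R) (x c : R) : continuity_pt f x -> f x < c ->
  exists e, 0 < e /\ forall t, Rabs (t - x) < e -> f t < c.
Proof.
  intros fc lt. destruct (fc (c - f x) ltac:(lra)) as [e [e0 He]].
  exists e. split; trivial. intros t Ht.
  destruct (Req_dec t x) as [->|ne]; trivial.
  assert (A := He t). simpl in A. unfold R_dist in A.
  assert (B : Rabs (f t - f x) < c - f x).
  { apply A. split; trivial. split; [exact I|]. now apply not_eq_sym. }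
  apply Rabs_def2 in B. lra.
Qed.

(** The intermediate value theorem alone does not keep f above h after the crossing; the supremum of
    the points with f <= h does. Next to it lies the interval by which the measure strictly drops in
    [widening]. *)
Lemma last_crossing (f : R -> R) (a b h : R) : (forall t, continuity_pt f t) -> a < b ->
  f a < h -> h < f b -> exists x, a < x < b /\ f x = h /\ forall t, x < t <= b -> h < f t.
Proof.
  intros fc ab fa fb.
  destruct (completeness (fun t => a <= t <= b /\ f t <= h)) as [x [U1 U2]].
  - exists b. intros t Ht; lra.
  - exists a. lra.
  - assert (ax : a <= x) by (apply U1; lra).
    assert (xb : x <= b) by (apply U2; intros t Ht; lra).
    assert (after : forall t, x < t <= b -> h < f t).
    { intros t Ht. apply Rnot_le_lt. intros le. assert (t <= x) by (apply U1; lra). lra. }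
    assert (fx1 : f x <= h).
    { apply Rnot_lt_le. intros gt.
      destruct (continuity_pt_near (fun t => - f t) x (- h)) as [e [e0 He]].
      - apply continuity_pt_opp, fc.
      - lra.
      - assert (x <= x - e); [|lra]. apply U2. intros t Ht.
        apply Rnot_lt_le. intros lt. assert (t <= x) by (apply U1; lra).
        assert (A := He t ltac:(apply Rabs_def1; lra)). lra. }
    assert (fx2 : h <= f x).
    { apply Rnot_lt_le. intros lt.
      destruct (continuity_pt_near f x h) as [e [e0 He]]; trivial.
      assert (xb' : x < b) by (destruct (Req_dec x b); [subst; lra|lra]).
      set (d := Rmin (e / 2) (b - x)).
      assert (d1 : d <= e / 2) by apply Rmin_l. assert (d2 : d <= b - x) by apply Rmin_r.
      assert (d0 : 0 < d) by (apply Rmin_glb_lt; lra).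
      assert (A := after (x + d) ltac:(lra)).
      assert (B := He (x + d) ltac:(apply Rabs_def1; lra)). lra. }
    exists x. split; [|split; [lra|trivial]].
    split; [destruct (Req_dec a x); [subst; lra|lra]|destruct (Req_dec x b); [subst; lra|lra]].
Qed.

(* [4 sin((t-x1)/2) sin((t-x2)/2) = 2 (cos d - cos(t-c))], so that moving the
   two zeros apart lowers |Q| outside the arc [x1, x2]. *)
Lemma widening L x1 x2 rest h : 0 < h -> 0 <= x1 < 2 * PI -> x1 <= x2 <= x1 + 2 * PI ->
  (forall t, absQ L t = absQ (x1 :: x2 :: rest) t) ->
  (forall t, x1 <= t <= x2 -> absQ L t < h) ->
  (exists t, h < absQ L t) ->
  exists L', length L' = S (S (length rest)) /\ (L <> [] -> mes (sup_set L' h) < mes (sup_set L h)).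
Proof.
  intros h0 x1b x12 EL small [t0 Ht0].
  assert (P := PI_RGT_0).
  assert (Ac : forall L t, continuity_pt (absQ L) t) by (intros; apply absQ_cont).
  set (f := absQ L) in *.
  assert (fper : forall t, f (t + 2 * PI) = f t) by (intros; apply absQ_2PI).
  assert (fx1 : f x1 = 0) by (rewrite EL; unfold absQ; rewrite Qf_root; [apply Rabs_R0|now left]).
  assert (fx2 : f x2 = 0) by (rewrite EL; unfold absQ; rewrite Qf_root; [apply Rabs_R0|now right; left]).
  destruct (absQ_window L x1 t0) as [ts [Hts Ets]]. fold f in Ets.
  assert (ts2 : x2 < ts).
  { apply Rnot_le_lt. intros le. assert (A := small ts ltac:(lra)). lra. }
  destruct (continuity_ab_maj f x1 x2) as [tm [Hmax Htm]]; [lra|intros; apply Ac|].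
  (* [M] is a bound below h that holds on the closed arc and, thanks to h / 2, also near its ends,
     where f vanishes. *)
  set (M := Rmax (f tm) (h / 2)).
  assert (Mh : M < h) by (apply Rmax_lub_lt; [now apply small|lra]).
  assert (M1 : f tm <= M) by apply Rmax_l. assert (M2 : h / 2 <= M) by apply Rmax_r.
  destruct (continuity_pt_near f x1 (h / 2)) as [e1 [e10 He1]]; [apply Ac|lra|].
  destruct (continuity_pt_near f x2 (h / 2)) as [e2 [e20 He2]]; [apply Ac|lra|].
  set (eta := Rmin e1 e2).
  assert (eta1 : eta <= e1) by apply Rmin_l. assert (eta2 : eta <= e2) by apply Rmin_r.
  assert (eta0 : 0 < eta) by (apply Rmin_glb_lt; lra).
  assert (near : forall t, x1 - eta < t < x2 + eta -> f t <= M).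
  { intros t Ht. destruct (Rlt_le_dec t x1) as [lt|ge].
    - apply Rlt_le, Rlt_le_trans with (h / 2); trivial. apply He1, Rabs_def1; lra.
    - destruct (Rlt_le_dec x2 t) as [gt|le].
      + apply Rlt_le, Rlt_le_trans with (h / 2); trivial. apply He2, Rabs_def1; lra.
      + apply Rle_trans with (f tm); trivial. apply Hmax; lra. }
  assert (tsb : x2 + eta <= ts <= x1 + 2 * PI - eta).
  { split; apply Rnot_lt_le; intros lt.
    - assert (A := near ts ltac:(lra)). lra.
    - assert (A := near (ts - 2 * PI) ltac:(lra)).
      rewrite <- fper in A. replace (ts - 2 * PI + 2 * PI) with ts in A by ring. lra. }
  set (K := 2 ^ length rest). assert (K0 : 0 < K) by (apply pow_lt; lra).
  (* The first bound keeps the moved zeros inside the neighbourhood where f <= M. The second keeps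
     the growth there, at most 2 K e with K bounding the product over [rest], below h - M. *)
  set (e := Rmin (eta / 2) ((h - M) / (4 * K))).
  assert (ea : e <= eta / 2) by apply Rmin_l.
  assert (eb : e <= (h - M) / (4 * K)) by apply Rmin_r.
  assert (e0 : 0 < e) by (apply Rmin_glb_lt; [lra|apply Rdiv_lt_0_compat; lra]).
  assert (eK : 2 * K * e < h - M).
  { apply Rmult_le_compat_l with (r := 4 * K) in eb; [|lra].
    replace (4 * K * ((h - M) / (4 * K))) with (h - M) in eb by (field; lra). nra. }
  set (L' := x1 - e :: x2 + e :: rest).
  exists L'. split; [reflexivity|]. intros Lne.
  set (g := absQ L'). set (d := (x2 - x1) / 2). set (c := (x1 + x2) / 2).
  assert (gE : forall t, g t = Rabs (2 * (cos (d + e) - cos (t - c))) * absQ rest t).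
  { intros t. unfold g, absQ, L'. rewrite Qf_pair, Rabs_mult. do 3 f_equal. f_equal; f_equal; unfold c, d; field. }
  assert (fE : forall t, f t = Rabs (2 * (cos d - cos (t - c))) * absQ rest t).
  { intros t. rewrite EL. unfold absQ. now rewrite Qf_pair, Rabs_mult. }
  assert (inner : forall t, x1 - eta < t < x2 + eta -> g t < h).
  { intros t Ht. assert (A := near t Ht).
    assert (B : g t <= f t + 2 * K * e); [|lra].
    rewrite gE, fE.
    assert (R1 : 0 <= absQ rest t) by apply Rabs_pos.
    assert (R2 : absQ rest t <= K) by apply Qf_bound.
    assert (D := cos_diff_le d e e0).
    assert (T : Rabs (2 * (cos (d + e) - cos (t - c))) <= Rabs (2 * (cos d - cos (t - c))) + 2 * e).
    { replace (2 * (cos (d + e) - cos (t - c))) with (2 * (cos d - cos (t - c)) + 2 * (cos (d + e) - cos d)) by ring.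
      apply Rle_trans with (1 := Rabs_triang _ _).
      rewrite (Rabs_mult 2 (cos (d + e) - cos d)), (Rabs_right 2) by lra. lra. }
    assert (X0 := Rabs_pos (2 * (cos d - cos (t - c)))).
    apply Rle_trans with ((Rabs (2 * (cos d - cos (t - c))) + 2 * e) * absQ rest t).
    - now apply Rmult_le_compat_r.
    - nra. }
  assert (outer : forall t, x2 + e < t < x1 + 2 * PI - e -> g t <= f t /\ (0 < f t -> g t < f t)).
  { intros t Ht. rewrite gE, fE.
    assert (C1 : cos (t - c) < cos (d + e)) by (apply cos_lt_outer; unfold c, d; lra).
    assert (C2 : cos (d + e) < cos d) by (apply cos_lt_outer; unfold c, d in *; lra).
    rewrite !Rabs_right by lra.
    assert (R1 : 0 <= absQ rest t) by apply Rabs_pos. split; [nra|].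
    intros pos. assert (0 < absQ rest t) by (destruct R1 as [R1|R1]; [trivial|rewrite <- R1 in pos; lra]). nra. }
  (* At the crossing x the old value is h and the new one is smaller. By continuity the new set
     misses an interval to the right of x that the old set contains. *)
  destruct (last_crossing f x2 ts h) as (x & Hx & fx & after); [intros; apply Ac|lra|lra|lra|].
  assert (xo : x2 + e < x < x1 + 2 * PI - e).
  { split; [|lra]. apply Rnot_le_lt. intros le. assert (A := near x ltac:(lra)). lra. }
  assert (gx : g x < h) by (destruct (outer x xo) as [_ A]; rewrite <- fx; apply A; lra).
  destruct (continuity_pt_near g x h) as [e3 [e30 He3]]; [apply Ac|trivial|].
  set (y := Rmin (x + e3) ts).
  assert (y1 : y <= x + e3) by apply Rmin_l. assert (y2 : y <= ts) by apply Rmin_r.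
  assert (xy : x < y) by (apply Rmin_glb_lt; lra).
  destruct (mes_window L h x1 Lne h0 ltac:(lra)) as [exf ->].
  destruct (mes_window L' h x1 ltac:(discriminate) h0 ltac:(lra)) as [exg ->].
  apply RInt_lt_gap with x y; trivial; try lra.
  - intros t Ht. fold f g.
    destruct (Rlt_le_dec (g t) h) as [lt|ge]; [rewrite (level_ind_0 g) by trivial; apply level_ind_bounds|].
    rewrite (level_ind_1 f); [apply level_ind_bounds|].
    apply Rle_trans with (1 := ge). apply outer. split.
    + apply Rnot_le_lt. intros le. assert (A := inner t ltac:(lra)). lra.
    + apply Rnot_le_lt. intros le. assert (A := inner (t - 2 * PI) ltac:(lra)).
      assert (B : g (t - 2 * PI) = g t).
      { replace t with (t - 2 * PI + 2 * PI) at 2 by ring. symmetry. apply absQ_2PI. }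
      lra.
  - intros t Ht. fold f g. rewrite (level_ind_0 g), (level_ind_1 f); [lra| |].
    + apply Rlt_le, after; lra.
    + apply He3, Rabs_def1; lra.
Qed.

Lemma Qf_split L L1 x y L2 : L = L1 ++ x :: y :: L2 ->
  forall t, Qf L t = Qf (x :: y :: L1 ++ L2) t.
Proof.
  intros -> t. apply Qf_perm.
  apply perm_trans with (x :: L1 ++ y :: L2); [apply Permutation_sym, Permutation_middle|].
  apply perm_skip, Permutation_sym, Permutation_middle.
Qed.

(** [widening] admits x1 = x2, so one competitor excludes both a double zero and a gap that the
    level set misses. *)
Lemma minimal_gap phi m h L i : normal phi m -> (1 <= m)%nat -> 0 < h -> length L = m ->
  (forall t, absQ (zeros phi m) t = absQ L t) ->
  (exists t, h < absQ L t) -> (forall L', length L' = m -> mes (sup_set L h) <= mes (sup_set L' h)) ->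
  (i < m)%nat -> phi i < phi (S i) /\ exists t, phi i <= t <= phi (S i) /\ h <= absQ L t.
Proof.
  intros N m1 h0 len E ex min Hi.
  assert (P := PI_RGT_0).
  assert (Lne : L <> []) by (destruct L; simpl in *; [lia|discriminate]).
  assert (Le := proj1 N i Hi). assert (Nm := proj1 (proj2 N)).
  assert (bi := proj2 (proj2 N) i Hi).
  apply NNPP. intros H.
  assert (small : forall t, phi i <= t <= phi (S i) -> absQ L t < h).
  { intros t Ht. apply Rnot_le_lt. intros le.
    destruct (Rle_lt_or_eq_dec _ _ Le) as [lt|eq]; [apply H; split; [trivial|now exists t]|].
    assert (t = phi i) by lra. subst t. rewrite <- E in le. unfold absQ in le.
    rewrite (normal_root phi m i), Rabs_R0 in le by (trivial; lia). lra. }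
  (* A single zero leaves no pair to move apart; its only gap is the whole circle, where h is
     exceeded. *)
  destruct (Nat.eq_dec m 1) as [->|m2].
  { assert (i = 0%nat) by lia. subst i. destruct ex as [t0 Ht0].
    destruct (absQ_window L (phi 0%nat) t0) as [t [Ht Et]].
    assert (A := small t ltac:(lra)). lra. }
  (* The last gap ends at the first zero shifted by one turn, which changes the sine product by a
     sign at most. *)
  assert (W : exists rest x2, phi (S i) = x2 /\ S (S (length rest)) = m /\
     forall t, absQ L t = absQ (phi i :: x2 :: rest) t).
  { destruct (Nat.eq_dec (S i) m) as [eq|ne].
    - exists (map phi (seq 1 (m - 2))), (phi 0%nat + 2 * PI).
      split; [now rewrite eq|]. split; [rewrite length_map, length_seq; lia|].
      intros t. rewrite <- E. unfold absQ, zeros.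
      replace (seq 0 m) with (0%nat :: seq 1 (m - 2) ++ [i]).
      + rewrite (Qf_perm (phi i :: phi 0%nat + 2 * PI :: map phi (seq 1 (m - 2)))
          (phi 0%nat + 2 * PI :: phi i :: map phi (seq 1 (m - 2)))) by apply perm_swap.
        replace (phi 0%nat + 2 * PI) with (phi 0%nat + 2 * IZR 1 * PI) by (simpl; ring).
        rewrite absQ_shift. f_equal. apply Qf_perm. simpl. apply perm_skip.
        rewrite map_app. simpl. apply Permutation_sym, Permutation_cons_append.
      + replace m with (S (S (m - 2))) at 2 by lia. rewrite seq_S. simpl.
        do 2 f_equal. f_equal. lia.
    - exists (map phi (seq 0 i) ++ map phi (seq (S (S i)) (m - i - 2))), (phi (S i)).
      split; [trivial|]. split; [rewrite length_app, !length_map, !length_seq; lia|].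
      intros t. rewrite <- E. unfold absQ. f_equal. apply Qf_split.
      unfold zeros. replace m with (i + S (S (m - i - 2)))%nat at 1 by lia.
      rewrite seq_app, map_app. reflexivity. }
  destruct W as (rest & x2 & <- & lr & EL).
  assert (up : phi (S i) <= phi i + 2 * PI).
  { assert (A := normal_mono phi m (S i) m N ltac:(lia)).
    assert (B := normal_mono phi m 0 i N ltac:(lia)). lra. }
  destruct (widening L (phi i) (phi (S i)) rest h) as (L' & l' & HL'); trivial; try lra.
  assert (A := HL' Lne). assert (B := min L' ltac:(lia)). lra.
Qed.

Lemma minimal_structure phi m h L : normal phi m -> (1 <= m)%nat -> 0 < h -> length L = m ->
  (forall t, absQ (zeros phi m) t = absQ L t) ->
  (exists t, h < absQ L t) -> (forall L', length L' = m -> mes (sup_set L h) <= mes (sup_set L' h)) ->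
  exists l r : nat -> R,
    (forall i, (i < m)%nat -> phi i < l i /\ l i <= r i /\ r i < phi (S i) /\
       absQ L (l i) = h /\ absQ L (r i) = h /\
       (forall t, phi i <= t <= phi (S i) -> (h <= absQ L t <-> l i <= t <= r i)) /\
       (l i = r i -> forall t, phi i <= t <= phi (S i) -> absQ L t <= h)) /\
    mes (sup_set L h) = fold_right (fun i a => (r i - l i) + a) 0 (seq 0 m).
Proof.
  intros N m1 h0 len E ex min.
  assert (Lne : L <> []) by (destruct L; simpl in *; [lia|discriminate]).
  (* The pair (0, 0) is a default beyond the last gap, so that the ends can be chosen as functions
     on all of [nat]. *)
  assert (C : forall i, exists p : R * R, (i < m)%nat -> phi i < fst p /\ fst p <= snd p /\ snd p < phi (S i) /\
       absQ L (fst p) = h /\ absQ L (snd p) = h /\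
       (forall t, phi i <= t <= phi (S i) -> (h <= absQ L t <-> fst p <= t <= snd p)) /\
       (fst p = snd p -> forall t, phi i <= t <= phi (S i) -> absQ L t <= h)).
  { intros i. destruct (Nat.lt_ge_cases i m) as [Hi|]; [|exists (0, 0); lia].
    destruct (minimal_gap phi m h L i) as [lt [t [Ht le]]]; trivial.
    destruct (gap_structure (zeros phi m) (phi i) (phi (S i)) h) as [A|(l & r & H1 & H2 & H3 & H4 & H5 & H6 & H7)]; trivial.
    - now apply zeros_nonempty.
    - now apply normal_gapok.
    - apply normal_root; trivial; lia.
    - apply normal_root; trivial; lia.
    - exfalso. assert (B := A t Ht). change (absQ (zeros phi m) t < h) in B. rewrite E in B. lra.
    - exists (l, r). intros _. simpl.
      change (absQ (zeros phi m) l = h) in H4. change (absQ (zeros phi m) r = h) in H5.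
      rewrite E in H4, H5. do 5 (split; [trivial|]). split.
      + intros s Hs. rewrite <- E. now apply H6.
      + intros lr s Hs. rewrite <- E. now apply H7. }
  set (p := fun i => proj1_sig (constructive_indefinite_description _ (C i))).
  assert (Hp : forall i, (i < m)%nat -> phi i < fst (p i) /\ fst (p i) <= snd (p i) /\ snd (p i) < phi (S i) /\
       absQ L (fst (p i)) = h /\ absQ L (snd (p i)) = h /\
       (forall t, phi i <= t <= phi (S i) -> (h <= absQ L t <-> fst (p i) <= t <= snd (p i))) /\
       (fst (p i) = snd (p i) -> forall t, phi i <= t <= phi (S i) -> absQ L t <= h)).
  { intros i. exact (proj2_sig (constructive_indefinite_description _ (C i))). }
  exists (fun i => fst (p i)), (fun i => snd (p i)). split; [exact Hp|].
  assert (b0 := proj2 (proj2 N) 0%nat ltac:(lia)).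
  destruct (mes_window L h (phi 0%nat) Lne h0 ltac:(lra)) as [_ ->].
  rewrite <- (proj1 (proj2 N)).
  apply (is_RInt_unique (V := R_CompleteNormedModule)).
  apply (is_RInt_sum _ phi (fun i => snd (p i) - fst (p i))).
  intros i Hi. destruct (Hp i Hi) as (H1 & H2 & H3 & _ & _ & H6 & _).
  apply is_RInt_level_ind_gap; [lra|lra|]. intros t Ht. apply H6; lra.
Qed.

End Widening.

(** * From the ends of the segments to the stated description *)

Section Conclusion.

Lemma small_period (k : Z) : Rabs (2 * IZR k * PI) < 2 * PI -> k = 0%Z.
Proof.
  intros H. assert (P := PI_RGT_0). apply Rabs_def2 in H.
  assert (H1 : IZR k < 1) by nra. assert (H2 : -1 < IZR k) by nra.
  apply lt_IZR in H1. apply lt_IZR in H2. lia.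
Qed.

Lemma find_gap (phi : nat -> R) (m : nat) t : (1 <= m)%nat -> phi 0%nat <= t <= phi m ->
  exists i, (i < m)%nat /\ phi i <= t <= phi (S i).
Proof.
  intros m1 Ht. induction m as [|m IH]; [lia|].
  destruct (Rle_lt_dec (phi m) t) as [le|lt]; [exists m; split; [lia|lra]|].
  destruct m as [|m]; [lra|].
  destruct IH as [i [Hi Hi']]; [lia|lra|]. exists i; split; [lia|trivial].
Qed.

(** The window of a sorted list of zeros lies in [0, 4 pi), so subtracting one turn at most returns
    to [0, 2 pi). *)
Definition reduce (p : R) : R := if Rlt_dec p (2 * PI) then p else p - 2 * PI.

Lemma reduce_Z p : exists k : Z, reduce p = p + 2 * IZR k * PI.
Proof.
  unfold reduce; destruct Rlt_dec; [exists 0%Z|exists (-1)%Z]; simpl; ring.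
Qed.

Lemma NoDup_map_inj (A B : Type) (f : A -> B) s :
  (forall x y, In x s -> In y s -> f x = f y -> x = y) -> NoDup s -> NoDup (map f s).
Proof.
  intros inj H. induction H as [|x s nx H IH]; simpl; constructor.
  - intros Hin. apply in_map_iff in Hin. destruct Hin as [y [Ey Hy]].
    apply nx. replace x with y; trivial. apply inj; simpl; auto.
  - apply IH. intros; apply inj; simpl; auto.
Qed.

Lemma one_segment phi m h L (l r : nat -> R) i0 : normal phi m -> (i0 < m)%nat ->
  (forall i, (i < m)%nat -> phi i < l i /\ l i <= r i /\ r i < phi (S i) /\
     absQ L (l i) = h /\
     (forall t, phi i <= t <= phi (S i) -> (h <= absQ L t <-> l i <= t <= r i))) ->
  l i0 < r i0 -> (forall i, (i < m)%nat -> i <> i0 -> l i = r i) ->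
  exists (a b : R) (pts : list R),
    a < b /\ b - a < 2 * PI /\
    length pts = (m - 1)%nat /\ NoDup pts /\
    (forall p, In p pts -> 0 <= p < 2 * PI /\ ~ in_arc a b p) /\
    (forall t, 0 <= t < 2 * PI ->
       (sup_set L h t <-> in_arc a b t \/ In t pts)).
Proof.
  intros N Hi0 H lr0 others. assert (P := PI_RGT_0).
  assert (Nm := proj1 (proj2 N)). assert (b0 := proj2 (proj2 N) 0%nat ltac:(lia)).
  assert (win : forall i, (i < m)%nat -> phi 0%nat <= phi i /\ phi (S i) <= phi 0%nat + 2 * PI).
  { intros i Hi. rewrite <- Nm. split; apply normal_mono with m; trivial; lia. }
  assert (sep : forall i j, (i < j < m)%nat -> r i < l j).
  { intros i j Hij. destruct (H i) as (_ & _ & A & _); [lia|]. destruct (H j) as (B & _); [lia|].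
    assert (D := normal_mono phi m (S i) j N ltac:(lia)). lra. }
  (* All segments lie inside a single period, so none meets a translate of another. This yields both
     that the reduced points are distinct and that they avoid the arc. *)
  assert (inj : forall i j (k : Z), (i < m)%nat -> (j < m)%nat ->
     l i <= l j + 2 * IZR k * PI <= r i -> i = j).
  { intros i j k Hi Hj Hk.
    destruct (H i Hi) as (i1 & i2 & i3 & _). destruct (H j Hj) as (j1 & j2 & j3 & _).
    assert (Wi := win i Hi). assert (Wj := win j Hj).
    assert (k0 : k = 0%Z) by (apply small_period, Rabs_def1; lra).
    subst k. destruct (Nat.lt_trichotomy i j) as [lt|[eq|gt]]; trivial; exfalso.
    - assert (A := sep i j ltac:(lia)). lra.
    - assert (A := sep j i ltac:(lia)). lra. }
  set (idx := seq 0 i0 ++ seq (S i0) (m - S i0)).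
  assert (spl : seq 0 m = seq 0 i0 ++ i0 :: seq (S i0) (m - S i0)).
  { replace m with (i0 + S (m - S i0))%nat at 1 by lia. now rewrite seq_app. }
  assert (idxP : forall i, In i idx <-> (i < m)%nat /\ i <> i0).
  { intros i. unfold idx. rewrite in_app_iff, !in_seq. lia. }
  assert (nd : NoDup idx).
  { apply NoDup_remove_1 with i0. rewrite <- spl. apply seq_NoDup. }
  exists (l i0), (r i0), (map (fun i => reduce (l i)) idx).
  destruct (H i0 Hi0) as (a1 & a2 & a3 & a4 & a5). assert (W0 := win i0 Hi0).
  split; [trivial|]. split; [lra|].
  split; [rewrite length_map; unfold idx; rewrite length_app, !length_seq; lia|].
  split; [|split].
  - apply NoDup_map_inj; trivial. intros i j Hi Hj E.
    apply idxP in Hi. apply idxP in Hj.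
    destruct (reduce_Z (l i)) as [k1 K1]. destruct (reduce_Z (l j)) as [k2 K2].
    apply (inj i j (k2 - k1)%Z); try tauto.
    destruct (H i) as (_ & A & _); [tauto|]. rewrite minus_IZR. lra.
  - intros p Hp. apply in_map_iff in Hp. destruct Hp as [i [<- Hi]]. apply idxP in Hi.
    destruct (H i) as (i1 & i2 & i3 & _); [tauto|]. assert (Wi := win i ltac:(tauto)).
    split; [unfold reduce; destruct Rlt_dec; lra|].
    intros [k Hk]. destruct (reduce_Z (l i)) as [k1 K1]. rewrite K1 in Hk.
    apply (proj2 Hi). symmetry. apply (inj i0 i (k1 + k)%Z); try tauto.
    rewrite plus_IZR. lra.
  - intros t Ht.
    assert (S1 : sup_set L h t <-> h <= absQ L t).
    { unfold sup_set, absQ. rewrite Cmod_polyP. lra. }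
    rewrite S1. split.
    + intros ht.
      (* The representative of t in the window of the gaps, chosen so that [reduce] undoes the
         choice. *)
      assert (T : exists t', phi 0%nat <= t' < phi 0%nat + 2 * PI /\ reduce t' = t /\ exists k : Z, t' = t + 2 * IZR k * PI).
      { destruct (Rle_lt_dec (phi 0%nat) t) as [le|lt].
        - exists t. split; [lra|]. split; [unfold reduce; destruct Rlt_dec; lra|exists 0%Z; simpl; ring].
        - exists (t + 2 * PI). split; [lra|]. split; [unfold reduce; destruct Rlt_dec; lra|exists 1%Z; simpl; ring]. }
      destruct T as (t' & T1 & T2 & k & T3).
      assert (ht' : h <= absQ L t') by (rewrite T3; unfold absQ; now rewrite absQ_Z).
      destruct (find_gap phi m t') as [i [Hi Hti]]; [lia|lra|].
      destruct (H i Hi) as (i1 & i2 & i3 & i4 & i5). apply i5 in ht'; trivial.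
      destruct (Nat.eq_dec i i0) as [->|ne].
      * left. exists k. now rewrite <- T3.
      * right. apply in_map_iff. exists i. split; [|now apply idxP].
        rewrite <- T2. f_equal. assert (A := others i Hi ne). lra.
    + intros [[k Hk]|Hp].
      * assert (A : h <= absQ L (t + 2 * IZR k * PI)) by (apply a5; lra).
        unfold absQ in *. now rewrite absQ_Z in A.
      * apply in_map_iff in Hp. destruct Hp as [i [<- Hi]]. apply idxP in Hi.
        destruct (H i) as (_ & _ & _ & A & _); [tauto|].
        destruct (reduce_Z (l i)) as [k ->]. unfold absQ in *. rewrite absQ_Z. lra.
Qed.

(** The condition |cos(t/2)| <= sin alpha describes the arc of length 4 alpha centred at pi, since
    cos(t/2) = - sin((t - pi)/2). *)
Lemma mes_le_of_small_arc L h (alpha : R) : L <> [] -> 0 < h -> 0 < alpha < PI / 2 ->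
  (forall t, Rabs (cos (t / 2)) <= sin alpha -> absQ L t < h) ->
  mes (sup_set L h) <= 2 * PI - 4 * alpha.
Proof.
  intros L0 h0 Ha small. assert (P := PI_RGT_0).
  destruct (mes_window L h 0 L0 h0 ltac:(lra)) as [ex ->]. rewrite Rplus_0_l in *.
  set (f := level_ind (absQ L) h) in *.
  set (x := PI - 2 * alpha). set (y := PI + 2 * alpha).
  assert (e1 : ex_RInt f 0 y) by (apply (ex_RInt_Chasles_1 (V := R_CompleteNormedModule)) with (2 * PI); [unfold y; lra|trivial]).
  assert (e2 : ex_RInt f 0 x) by (apply (ex_RInt_Chasles_1 (V := R_CompleteNormedModule)) with y; [unfold x, y; lra|trivial]).
  assert (e3 : ex_RInt f x y) by (apply (ex_RInt_Chasles_2 (V := R_CompleteNormedModule)) with 0; [unfold x, y; lra|trivial]).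
  assert (e4 : ex_RInt f y (2 * PI)) by (apply (ex_RInt_Chasles_2 (V := R_CompleteNormedModule)) with 0; [unfold y; lra|trivial]).
  rewrite <- (RInt_Chasles (V := R_CompleteNormedModule) f 0 y (2 * PI)) by trivial.
  rewrite <- (RInt_Chasles (V := R_CompleteNormedModule) f 0 x y) by trivial.
  assert (B : forall u v, u <= v -> ex_RInt f u v -> RInt f u v <= v - u).
  { intros u v uv e. replace (v - u) with (RInt (fun _ => 1) u v)
      by (rewrite RInt_const; unfold scal; simpl; unfold mult; simpl; ring).
    apply RInt_le; trivial; [apply ex_RInt_const|]. intros t _; apply level_ind_bounds. }
  assert (M : RInt f x y = 0).
  { apply (is_RInt_unique (V := R_CompleteNormedModule)).
    apply is_RInt_level_ind_empty; [unfold x, y; lra|].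
    intros t Ht. apply small. unfold x, y in Ht.
    rewrite cos_sin. replace (PI / 2 + t / 2) with (PI + (t - PI) / 2) by field.
    replace (PI + (t - PI) / 2) with ((t - PI) / 2 + PI) by ring. rewrite neg_sin, Rabs_Ropp.
    apply Rabs_le. split.
    - rewrite <- sin_neg. apply sin_incr_1; lra.
    - apply sin_incr_1; lra. }
  assert (B1 := B 0 x ltac:(unfold x; lra) e2). assert (B2 := B y (2 * PI) ltac:(unfold y; lra) e4).
  unfold plus; simpl. rewrite M. unfold x, y in *. lra.
Qed.

Lemma sin_pow_near (m : nat) (g c : R) : sin g ^ m < c -> g < PI / 2 ->
  exists alpha, g < alpha < PI / 2 /\ sin alpha ^ m < c.
Proof.
  intros H Hg.
  destruct (continuity_pt_near (fun t => sin t ^ m) g c) as [e [e0 He]]; trivial.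
  - apply derivable_continuous_pt, ex_derive_Reals_0. auto_derive. trivial.
  - set (d := Rmin (e / 2) ((PI / 2 - g) / 2)).
    assert (d1 : d <= e / 2) by apply Rmin_l. assert (d2 : d <= (PI / 2 - g) / 2) by apply Rmin_r.
    assert (d0 : 0 < d) by (apply Rmin_glb_lt; lra).
    exists (g + d). split; [lra|]. apply He, Rabs_def1; lra.
Qed.

(* Two segments are excluded by comparing with a Chebyshev polynomial of an arc
   of length [4 alpha], [alpha] slightly above [g]. *)
Lemma one_segment_of_bounds m h L :
  (1 <= m)%nat -> 0 < h < 2 -> length L = m ->
  (exists t, h < absQ L t) ->
  (forall c, 0 < c < 1 -> exists L', length L' = m /\
     forall t, Rabs (cos (t / 2)) <= c -> absQ L' t <= 2 * c ^ m) ->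
  (forall phi l r : nat -> R, normal phi m ->
     (forall i, (i < m)%nat -> phi i < l i /\ l i <= r i /\ r i < phi (S i) /\
       absQ (zeros phi m) (l i) = h /\ absQ (zeros phi m) (r i) = h /\
       (l i = r i -> forall t, phi i <= t <= phi (S i) -> absQ (zeros phi m) t <= h)) ->
     (exists i j, (i < m)%nat /\ (j < m)%nat /\ i <> j /\ l i < r i /\ l j < r j) ->
     let g := (2 * PI - fold_right (fun i a => (r i - l i) + a) 0 (seq 0 m)) / 4 in
     0 < g < PI / 2 /\ sin g ^ m < h / 2) ->
  mes (sup_set L h) = delta m h ->
  exists (a b : R) (pts : list R),
    a < b /\ b - a < 2 * PI /\
    length pts = (m - 1)%nat /\ NoDup pts /\
    (forall p, In p pts -> 0 <= p < 2 * PI /\ ~ in_arc a b p) /\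
    (forall t, 0 <= t < 2 * PI ->
       (sup_set L h t <-> in_arc a b t \/ In t pts)).
Proof.
  intros m1 h02 len ex cheb banded minE.
  assert (min : forall L', length L' = m -> mes (sup_set L h) <= mes (sup_set L' h)).
  { intros L' l'. rewrite minE. apply delta_le; trivial; lra. }
  destruct (normal_exists L m len m1) as [phi [N E]].
  destruct (minimal_structure phi m h L) as (l & r & H & ME); trivial; [lra|].
  destruct (classic (exists i0, (i0 < m)%nat /\ l i0 < r i0)) as [[i0 [Hi0 lr0]]|none].
  - destruct (classic (exists j, (j < m)%nat /\ j <> i0 /\ l j < r j)) as [[j [Hj [ne lrj]]]|single].
    + exfalso.
      destruct (banded phi l r N) as [gb gh].
      * intros i Hi. destruct (H i Hi) as (H1 & H2 & H3 & H4 & H5 & _ & H7).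
        unfold absQ in *. rewrite !E. do 5 (split; [trivial|]).
        intros lr t Ht. rewrite E. now apply H7.
      * exists i0, j. repeat split; trivial. now apply not_eq_sym.
      * rewrite <- ME in gb, gh.
        set (g := (2 * PI - mes (sup_set L h)) / 4) in *.
        destruct (sin_pow_near m g (h / 2) gh (proj2 gb)) as [al [al1 al2]].
        assert (P := PI_RGT_0).
        assert (s0 : 0 < sin al) by (apply sin_gt_0; lra).
        assert (s1 : sin al < 1) by (rewrite <- sin_PI2; apply sin_increasing_1; lra).
        destruct (cheb (sin al)) as [L' [l' HL']]; [lra|].
        assert (A : mes (sup_set L' h) <= 2 * PI - 4 * al).
        { apply mes_le_of_small_arc; [destruct L'; simpl in *; [lia|discriminate]|lra|lra|].
          intros t Ht. assert (B := HL' t Ht). lra. }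
        assert (B := min L' l'). unfold g in *. lra.
    + apply (one_segment phi m h L l r i0); trivial.
      * intros i Hi. destruct (H i Hi) as (H1 & H2 & H3 & H4 & H5 & H6 & _). auto.
      * intros i Hi ne. destruct (H i Hi) as (_ & H2 & _).
        destruct H2 as [lt|]; trivial. exfalso. apply single. exists i; auto.
  (* If every segment were a point, tangency would give |Q| <= h on every gap, against the value
     above h. *)
  - exfalso. destruct ex as [t Ht].
    destruct (absQ_window L (phi 0%nat) t) as [t' [T1 T2]].
    destruct (find_gap phi m t') as [i [Hi Hti]]; trivial.
    { rewrite (proj1 (proj2 N)). lra. }
    destruct (H i Hi) as (_ & H2 & _ & _ & _ & _ & H7).
    assert (A : l i = r i) by (destruct H2 as [lt|]; trivial; exfalso; apply none; exists i; auto).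
    assert (B := H7 A t' Hti). lra.
Qed.

End Conclusion.

End LevelSets.

Module BandedLevel.

From mathcomp Require Import all_boot all_order all_algebra.
From mathcomp Require Import complex ring lra zify Rstruct.
Set Implicit Arguments. Unset Strict Implicit. Unset Printing Implicit Defensive.
Import Order.TTheory GRing.Theory Num.Theory.
Local Open Scope ring_scope.
Local Open Scope complex_scope.

(** * The real-valued modulus on complex numbers *)

Section Norm.
Variable R : rcfType.
Implicit Types z w : R[i].
Local Notation nc := (@Normc.normc R).

Lemma nc_ge0 z : 0 <= nc z.
Proof. by case: z => a b; rewrite /Normc.normc sqrtr_ge0. Qed.

Lemma nc_eq0 z : (nc z == 0) = (z == 0).
Proof.
by apply/eqP/eqP => [/Normc.eq0_normc//|->]; rewrite Normc.normc0.
Qed.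

Lemma nc_gt0 z : (0 < nc z) = (z != 0).
Proof. by rewrite lt_neqAle nc_ge0 andbT eq_sym nc_eq0. Qed.

Lemma ncX z n : nc (z ^+ n) = nc z ^+ n.
Proof.
elim: n => [|n IH]; first by rewrite !expr0 Normc.normc1.
by rewrite !exprS Normc.normcM IH.
Qed.

Lemma nc_real (x : R) : nc x%:C = `|x|.
Proof. by rewrite /= expr0n addr0 sqrtr_sqr. Qed.

Lemma ncJ z : nc (conjc z) = nc z.
Proof. by case: z => a b; rewrite /= sqrrN. Qed.

Lemma mulJ_nc z : z * (conjc z) = (nc z ^+ 2)%:C.
Proof.
case: z => a b; rewrite /= sqr_sqrtr ?addr_ge0 ?sqr_ge0//.
by simpc; congr (_ +i* _); ring.
Qed.

Lemma nc_prod (I : Type) (s : seq I) (F : I -> R[i]) :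
  nc (\prod_(i <- s) F i) = \prod_(i <- s) nc (F i).
Proof.
elim: s => [|x s IH]; first by rewrite !big_nil Normc.normc1.
by rewrite !big_cons Normc.normcM IH.
Qed.

Lemma prod_exp (I : Type) (A : comPzSemiRingType) (s : seq I) (F : I -> A) n :
  \prod_(i <- s) F i ^+ n = (\prod_(i <- s) F i) ^+ n.
Proof. by elim/big_rec2: _ => [|i x y _ ->]; rewrite ?expr1n ?exprMn. Qed.

Lemma ncB_sym z w : nc (z - w) = nc (w - z).
Proof. by rewrite -normcN opprB. Qed.

Lemma nc_subge z w : nc z - nc w <= nc (z - w).
Proof. by rewrite lerBlDr -{1}(subrK w z) le_normcD. Qed.

End Norm.

Lemma conj_div_real (R : rcfType) (a b : R[i]) (d : R) :
  (conjc (a * b / d%:C)) = (conjc a) * (conjc b) / d%:C.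
Proof.
rewrite (rmorphM conjc) (rmorphM conjc); congr (_ * _).
by rewrite (fmorphV conjc) /= oppr0.
Qed.

(** * The resultant identity and the ellipse *)

Section Core.
Variable R : rcfType.
Local Notation C := R[i].
Local Notation nc := (@Normc.normc R).

Lemma horner_XsubC_prod (s : seq C) x :
  (\prod_(z <- s) ('X - z%:P)).[x] = \prod_(z <- s) (x - z).
Proof. by rewrite horner_prod; apply: eq_bigr => z _; rewrite hornerXsubC. Qed.

(** Both sides are the double product of |u - v| times a power of |c|: the symmetry of the resultant
    up to sign. *)
Lemma nc_prod_swap (c : C) (us vs : seq C) :
  nc c ^+ size vs * \prod_(u <- us) nc (\prod_(v <- vs) ('X - v%:P)).[u] =
  \prod_(v <- vs) nc (c *: \prod_(u <- us) ('X - u%:P)).[v].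
Proof.
under [RHS]eq_bigr => v _ do
  rewrite hornerZ Normc.normcM horner_XsubC_prod nc_prod.
rewrite big_split /= big_const_seq count_predT iter_mulr_1; congr (_ * _).
rewrite exchange_big /=; apply: eq_bigr => u _.
by rewrite horner_XsubC_prod nc_prod; apply: eq_bigr => v _; rewrite ncB_sym.
Qed.

(** The form [?= iff] keeps the empty product, where only equality holds, in one statement with the
    strict case; it occurs when A - B is constant. *)
Lemma prod_ler_strict (s : seq C) (F G : C -> R) :
  (forall x, x \in s -> 0 <= F x) -> (forall x, x \in s -> F x < G x) ->
  \prod_(x <- s) F x <= \prod_(x <- s) G x ?= iff (s == [::]).
Proof.
elim: s => [|x s IH] F0 FG; first by rewrite !big_nil eqxx; split; rewrite ?eqxx.
rewrite !big_cons; apply/leifP => /=.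
have [H _] := IH (fun y ys => F0 y (mem_behead (s := x :: s) ys))
                 (fun y ys => FG y (mem_behead (s := x :: s) ys)).
have Fx0 := F0 x (mem_head _ _); have FGx := FG x (mem_head _ _).
have Gp : 0 < \prod_(y <- s) G y.
  rewrite big_seq; apply: prodr_gt0 => y ys.
  by apply: le_lt_trans (F0 _ _) (FG _ _); rewrite inE ys orbT.
by apply: le_lt_trans (ler_wpM2l Fx0 H) _; rewrite ltr_pM2r.
Qed.

(* A product-of-values (resultant) identity: evaluating [A1 Y^2 (A1 - B1)] at
   the roots of [P + A1 Y] gives
   [(h/2)^(s-d) = S^m * \prod_p |P + A1 Y|(p) / (h |p|^m)],
   [p] ranging over the [d] roots of [A1 - B1]. *)
Lemma resultant_bound (m s : nat) (eta : C) (h Cg Sg : R) (P B1 : {poly C})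
    (as_ ys : seq C) :
  let A1 := \prod_(a <- as_) ('X - a%:P) in
  let Y := \prod_(y <- ys) ('X - y%:P) in
  nc eta = 1 -> 0 < h < 2 -> 0 < Cg -> 0 < Sg -> (1 < s)%N ->
  P \is monic -> size P = m.+1 -> B1 \is monic -> size B1 = s.+1 ->
  size as_ = s -> (size ys + s = m)%N ->
  (forall a, a \in as_ ++ ys -> nc a = 1) ->
  P ^+ 2 - (eta * (h ^+ 2)%:C) *: 'X^m = A1 * B1 * Y ^+ 2 ->
  nc (P + A1 * Y).[0] = 2 * Cg ->
  nc (A1 - B1).[0] = 4 * Sg * Cg ->
  (forall p, root (A1 - B1) p -> h * nc p ^+ m < nc (P + A1 * Y).[p]) ->
  Sg ^+ m < h / 2.
Proof.
move=> A1 Y eta1 /andP[h0 h2] Cg0 Sg0 s1 Pm sP B1m sB1 sas sys unim PAB U0 N0 Hp.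
set U := P + A1 * Y; set N := A1 - B1.
have A1m : A1 \is monic by apply: monic_prod_XsubC.
have Ym : Y \is monic by apply: monic_prod_XsubC.
have sA1 : size A1 = s.+1 by rewrite size_prod_XsubC sas.
have sY : size Y = (size ys).+1 by rewrite size_prod_XsubC.
have AYm : A1 * Y \is monic by rewrite monicMl.
have sAY : size (A1 * Y) = m.+1 by rewrite size_monicM ?monic_neq0// sA1 sY -sys; lia.
(* [P] and [A1 * Y] are monic of the same degree, so [U] has leading coefficient 2; this turns h
   into h / 2 in the final bound. *)
have cU : U`_m = 2.
  by rewrite coefD -[m]/(m.+1.-1) -{1}sP -{1}sAY -!lead_coefE !(monicP _)// -natr1.
have sU : size U = m.+1.
  apply/eqP; rewrite eqn_leq; apply/andP; split.
    by rewrite (leq_trans (size_polyD _ _))// sP sAY maxnn.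
  by rewrite ltnNge; apply/negP => /leq_sizeP/(_ m (leqnn _)) /eqP; rewrite cU pnatr_eq0.
have lU : lead_coef U = 2 by rewrite lead_coefE sU.
have [us HU] := closed_field_poly_normal U; rewrite lU in HU.
have sus : size us = m.
  have : size U = m.+1 by [].
  by rewrite HU size_scale ?pnatr_eq0// size_prod_XsubC; case.
have N0n : N != 0.
  apply/eqP => N00; have : 0 < nc N.[0] by rewrite N0 !mulr_gt0.
  by rewrite N00 horner0 Normc.normc0 ltxx.
(* The leading terms cancel, so the number d of roots of [N] stays below s and a positive power of h
   / 2 survives. *)
have sN : (size N <= s)%N.
  apply/leq_sizeP => j; rewrite leq_eqVlt => /orP[/eqP <-|sj].
    rewrite coefB; have -> : A1`_s = 1 by move: (monicP A1m); rewrite lead_coefE sA1.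
    by have -> : B1`_s = 1; [move: (monicP B1m); rewrite lead_coefE sB1|rewrite subrr].
  by rewrite coefB !nth_default ?subrr// ?sA1 ?sB1.
have [ps HN] := closed_field_poly_normal N.
set nu := lead_coef N in HN; have nu0 : nu != 0 by rewrite lead_coef_eq0.
set d := size ps.
have dN : size N = d.+1 by rewrite HN size_scale// size_prod_XsubC.
have ds : (d < s)%N by rewrite -dN.
have nc2 : nc 2%:R = 2.
  by have := nc_real (2 : R); rewrite rmorphMn /= => ->; rewrite ger0_norm.
have Uu u : u \in us -> U.[u] = 0.
  by move=> uus; apply/eqP; rewrite -[_ == 0]/(root U u) HU rootZ ?pnatr_eq0// root_prod_XsubC.
(* At a root of [U] one has P = - A1 Y, so the factorization reads A1 Y^2 (A1 - B1) = eta h^2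
   u^m. *)
have E1 u : u \in us ->
    nc A1.[u] * nc Y.[u] ^+ 2 * nc N.[u] = h ^+ 2 * nc u ^+ m.
  move=> /Uu; rewrite hornerD hornerM => /eqP; rewrite addr_eq0 => /eqP Pu.
  have := congr1 (fun q : {poly C} => q.[u]) PAB.
  rewrite (expr2 P) (expr2 Y) hornerD hornerN hornerZ hornerXn !hornerM Pu => E.
  rewrite -(ncX Y.[u]) -!Normc.normcM.
  have -> : A1.[u] * Y.[u] ^+ 2 * N.[u] = eta * (h ^+ 2)%:C * u ^+ m.
    rewrite hornerD hornerN; move: E; set a := A1.[u]; set b := B1.[u]; set y := Y.[u].
    set c := eta * _ * u ^+ m => E.
    have -> : c = (a * y) ^+ 2 - a * b * y ^+ 2 by rewrite -E; ring.
    by ring.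
  by rewrite !Normc.normcM eta1 mul1r nc_real ncX ger0_norm// sqr_ge0.
(* At a zero of [A1 * Y] on the circle the right-hand side of the factorization vanishes, leaving
   |U| = |P| = h. *)
have unimP a : nc a = 1 -> (A1 * Y).[a] = 0 -> nc U.[a] = h.
  move=> a1 AYa; rewrite /U hornerD AYa addr0.
  have := congr1 (fun q : {poly C} => nc q.[a]) PAB; rewrite (expr2 P).
  have -> : (A1 * B1 * Y ^+ 2).[a] = 0.
    have -> : A1 * B1 * Y ^+ 2 = (A1 * Y) * (B1 * Y) by ring.
    by rewrite hornerM AYa mul0r.
  rewrite Normc.normc0 hornerD hornerN hornerZ hornerXn hornerM => /Normc.eq0_normc /eqP.
  rewrite subr_eq0 => /eqP /(congr1 nc).
  rewrite !Normc.normcM eta1 mul1r !ncX a1 expr1n mulr1 nc_real ger0_norm ?sqr_ge0//.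
  by move=> /eqP; rewrite -expr2 eqrXn2 ?nc_ge0 ?ltW// => /eqP.
have HA : 2 ^+ s * \prod_(u <- us) nc A1.[u] = h ^+ s.
  have := nc_prod_swap 2%:R us as_; rewrite nc2 sas => ->; rewrite -HU.
  rewrite (eq_big_seq (fun=> h)) ?big_const_seq ?count_predT ?sas ?iter_mulr_1// => a aas.
  apply: unimP; first by apply: unim; rewrite mem_cat aas.
  by rewrite hornerM; apply/eqP; rewrite mulf_eq0 -[_ == 0]/(root A1 a) root_prod_XsubC aas.
have HY : 2 ^+ size ys * \prod_(u <- us) nc Y.[u] = h ^+ size ys.
  have := nc_prod_swap 2%:R us ys; rewrite nc2 => ->; rewrite -HU.
  rewrite (eq_big_seq (fun=> h)) ?big_const_seq ?count_predT ?iter_mulr_1// => a aas.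
  apply: unimP; first by apply: unim; rewrite mem_cat aas orbT.
  by rewrite hornerM; apply/eqP; rewrite mulf_eq0 orbC -[_ == 0]/(root Y a) root_prod_XsubC aas.
have HNu : 2 ^+ d * \prod_(u <- us) nc N.[u] = nc nu ^+ m * \prod_(p <- ps) nc U.[p].
  rewrite [in RHS]HU -nc_prod_swap nc2 -/d mulrCA; congr (_ * _).
  rewrite -{1}sus -iter_mulr_1 -(count_predT us) -big_const_seq -big_split /=.
  by apply: eq_bigr => u _; rewrite {1}HN hornerZ Normc.normcM.
have Hus : \prod_(u <- us) nc u = Cg.
  move: U0; rewrite -/U {1}HU hornerZ Normc.normcM nc2 horner_XsubC_prod nc_prod.
  under eq_bigr do rewrite sub0r normcN.
  by move/mulfI; apply; rewrite pnatr_eq0.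
have Hps : nc nu * \prod_(p <- ps) nc p = 4 * Sg * Cg.
  rewrite -N0 -/N {1}HN hornerZ Normc.normcM horner_XsubC_prod nc_prod.
  by under [in RHS]eq_bigr do rewrite sub0r normcN.
have Hall : (\prod_(u <- us) nc A1.[u]) * (\prod_(u <- us) nc Y.[u]) ^+ 2 *
    (\prod_(u <- us) nc N.[u]) = h ^+ 2 ^+ m * Cg ^+ m.
  rewrite -Hus expr2 -prod_exp -!big_split /=; under eq_bigr do rewrite -expr2.
  by rewrite (eq_big_seq _ E1) big_split /= big_const_seq count_predT sus iter_mulr_1 prod_exp.
set pA := \prod_(u <- us) nc A1.[u] in HA Hall.
set pY := \prod_(u <- us) nc Y.[u] in HY Hall.
set pN := \prod_(u <- us) nc N.[u] in HNu Hall.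
have HU' := prod_ler_strict (s := ps) (F := fun p => h * nc p ^+ m) (G := fun p => nc U.[p]).
have [||le_pU eq_pU] := HU'.
- by move=> x _; rewrite mulr_ge0 ?exprn_ge0 ?nc_ge0// ltW.
- move=> x xs; apply: Hp; by rewrite -/N HN rootZ// root_prod_XsubC.
move: le_pU eq_pU; rewrite big_split /= big_const_seq count_predT iter_mulr_1 prod_exp -/d.
set x := \prod_(p <- ps) nc U.[p] in HNu *; set pp := \prod_(p <- ps) nc p in Hps *.
move=> le_pU eq_pU.
set X := h / 2; have X0 : 0 < X by rewrite divr_gt0.
have X1 : X < 1 by rewrite ltr_pdivrMr// mul1r.
have hX : h = 2 * X by rewrite /X; field.
have ncnu : 0 < nc nu by rewrite nc_gt0.

have key : X ^+ (size ys + m) * (nc nu ^+ m * x) = (2 ^+ d) * (h ^+ 2 ^+ m * Cg ^+ m).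
  rewrite -HNu -Hall.
  have -> : X ^+ (size ys + m) = pA * pY ^+ 2.
    have [p2s p2y] : (2 : R) ^+ s != 0 /\ (2 : R) ^+ size ys != 0.
      by rewrite !expf_neq0// pnatr_eq0.
    have -> : pA = X ^+ s.
      by apply: (mulfI p2s); rewrite HA hX exprMn.
    have -> : pY = X ^+ size ys.
      by apply: (mulfI p2y); rewrite HY hX exprMn.
    by rewrite -exprM -exprD; congr (_ ^+ _); move: sys; clear; lia.
  by ring.
have bnd : h ^+ d * (4 * Sg * Cg) ^+ m <= nc nu ^+ m * x ?= iff (ps == [::]).
  have -> : h ^+ d * (4 * Sg * Cg) ^+ m = nc nu ^+ m * (h ^+ d * pp ^+ m).
    by rewrite -Hps exprMn; ring.
  by split; [rewrite ler_pM2l ?exprn_gt0|rewrite -eq_pU; apply/eqP/eqP => [|->//]; apply: mulfI; rewrite gt_eqF ?exprn_gt0].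
(* The factor [cst] collects the powers of X, 2, 4 and Cg common to [key] and [bnd]; the exponents
   match because 2 m = (size ys + m) + s. *)
have main : X ^+ d * Sg ^+ m <= X ^+ s ?= iff (ps == [::]).
  have cst : 0 < X ^+ (size ys + m) * 2 ^+ d * 4 ^+ m * Cg ^+ m.
    by rewrite !mulr_gt0// exprn_gt0.
  have e1 : X ^+ (size ys + m) * 2 ^+ d * 4 ^+ m * Cg ^+ m * (X ^+ d * Sg ^+ m) =
     X ^+ (size ys + m) * (h ^+ d * (4 * Sg * Cg) ^+ m).
    by rewrite hX !exprMn; ring.
  have e2 : X ^+ (size ys + m) * 2 ^+ d * 4 ^+ m * Cg ^+ m * X ^+ s =
     X ^+ (size ys + m) * (nc nu ^+ m * x).
    have -> : X ^+ (size ys + m) * (nc nu ^+ m * x) =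
        2 ^+ d * (4 ^+ m * X ^+ (2 * m) * Cg ^+ m).
      rewrite key hX; congr (_ * (_ * _)).
      by rewrite [X ^+ (2 * m)]exprM -exprMn; congr (_ ^+ _); ring.
    have -> : (2 * m = (size ys + m) + s)%N by move: sys; clear; lia.
    by rewrite (exprD X (_ + _)); ring.
  split; first by rewrite -(ler_pM2l cst) e1 e2 ler_pM2l ?exprn_gt0//; case: bnd.
  case: bnd => _ <-; apply/eqP/eqP => [E|E].
    have : X ^+ (size ys + m) * (h ^+ d * (4 * Sg * Cg) ^+ m) = X ^+ (size ys + m) * (nc nu ^+ m * x).
      by rewrite -e1 -e2 E.
    by apply: mulfI; rewrite gt_eqF ?exprn_gt0.
  by apply: (mulfI (lt0r_neq0 cst)); rewrite e1 e2 E.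
case: main => le_m eq_m.
(* For constant A1 - B1 the strictness of the product is lost, and Sg^m <= X^s < X comes from s > 1
   and X < 1 instead. *)
have [d0|dpos] := posnP d.
  move: le_m; rewrite d0 expr0 mul1r => /le_lt_trans; apply.
  by rewrite -{2}(expr1 X) ltr_iXn2l.
have lt_m : X ^+ d * Sg ^+ m < X ^+ s.
  by rewrite lt_neqAle eq_m le_m andbT -size_eq0 -/d -lt0n.
have : X ^+ d * Sg ^+ m < X ^+ d * X ^+ (s - d).
  by rewrite -exprD subnKC// ltnW.
rewrite ltr_pM2l ?exprn_gt0// => /lt_le_trans; apply.
by rewrite -{2}(expr1 X) ler_iXn2l// subn_gt0.
Qed.


(* Points inside the ellipse with foci [+-2] through [p^m], seen as [u + v]. *)
Lemma ellipse_interior (m : nat) (eta p u v : C) :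
  nc eta = 1 -> u * v = eta * p ^+ m -> nc p ^+ m != 1 ->
  0 <= (nc u - 1) * (nc v - 1) ->
  exists2 sigma, nc sigma <= 1 & u + v = sigma * p ^+ m + (conjc sigma) * eta.
Proof.
move=> eta1 uv p1 uv1.
have etaJ : eta * (conjc eta) = 1 by rewrite mulJ_nc eta1 expr1n.
have pJ : (conjc (p ^+ m)) = eta * (conjc u) * (conjc v).
  have : (conjc (u * v)) = (conjc (eta * p ^+ m)) by rewrite uv.
  by rewrite !rmorphM /= => /(congr1 (fun z => eta * z)); rewrite !mulrA etaJ mul1r.
set U := nc u in uv1 *; set V := nc v in uv1 *.
have U0 : 0 <= U by apply: nc_ge0.
have V0 : 0 <= V by apply: nc_ge0.
have UV : U * V = nc p ^+ m.
  by rewrite /U /V -Normc.normcM uv Normc.normcM eta1 mul1r ncX.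
have UV1 : U * V - 1 != 0 by rewrite UV subr_eq0.
have uJ : u * (conjc u) = (U ^+ 2)%:C by apply: mulJ_nc.
have vJ : v * (conjc v) = (V ^+ 2)%:C by apply: mulJ_nc.
set D := (U * V) ^+ 2 - 1.
have DE : D = (U * V - 1) * (U * V + 1) by rewrite /D; ring.
have UVp : 0 < U * V + 1 by rewrite ltr_wpDl// mulr_ge0.
have D0 : D != 0 by rewrite DE mulf_neq0// gt_eqF.
have DC0 : D%:C != 0 by apply: contra D0 => /eqP/complexI ->.
have DCE : D%:C = u * (conjc u) * (v * (conjc v)) - 1.
  by rewrite uJ vJ -!rmorphM /= -(rmorph1 (real_complex R)) -rmorphB /= /D exprMn.
(* [sigma] is the solution of the linear system formed by the wanted equation and its conjugate,
   whose determinant is [D], up to sign. *)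
set num := (conjc v) * (u * (conjc u) - 1) + (conjc u) * (v * (conjc v) - 1).
exists (eta * num / D%:C).
  rewrite !Normc.normcM eta1 mul1r Normc.normcV nc_real.
  rewrite ler_pdivrMr ?normr_gt0// mul1r.
  have -> : num = (conjc v) * (U ^+ 2 - 1)%:C + (conjc u) * (V ^+ 2 - 1)%:C.
    by rewrite /num uJ vJ !rmorphB /= !rmorph1.
  apply: le_trans (le_normcD _ _) _; rewrite !Normc.normcM !ncJ !nc_real -/U -/V.
  have fac x : 0 <= x -> `|x ^+ 2 - 1| = `|x - 1| * (x + 1).
    move=> x0; rewrite (_ : x ^+ 2 - 1 = (x - 1) * (x + 1)); last by ring.
    by rewrite normrM (ger0_norm (_ : 0 <= x + 1))// addr_ge0.
  rewrite DE normrM (ger0_norm (ltW UVp)) !fac//.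
  have n1 := ler_norm (U * V - 1).
  have n2 : 1 - U * V <= `|U * V - 1| by rewrite distrC ler_norm.
  (* With U and V on the same side of 1 the bound reduces to U + V <= U V + 1, that is (U - 1)(V -
     1) >= 0. On opposite sides the hypothesis forces one of them to be 1. *)
  have [U1|U1] := leP 1 U; have [V1|V1] := leP 1 V.
  - have uvp : 0 <= U * V - 1 by nra.
    rewrite !ger0_norm ?subr_ge0//; last by lra.
    by have := mulr_ge0 uvp uv1; nra.
  - have Ue : U = 1 by nra.
    by rewrite Ue subrr normr0 !mul1r mul0r mulr0 add0r distrC.
  - have Ve : V = 1 by nra.
    by rewrite Ve subrr normr0 mulr1 mul0r mulr0 addr0 mul1r.
  - have uvp : 0 <= 1 - U * V by nra.
    rewrite (ltr0_norm (_ : U - 1 < 0)) ?subr_lt0// (ltr0_norm (_ : V - 1 < 0)) ?subr_lt0// ler0_norm; last by lra.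
    by have := mulr_ge0 uvp uv1; nra.
have numJ : (conjc num) = v * (u * (conjc u) - 1) + u * (v * (conjc v) - 1).
  by rewrite /num !(rmorphD, rmorphM, rmorphB, rmorphN, rmorph1) /= !conjcK; ring.
have DJ : (conjc (D%:C)) = D%:C by rewrite conjc_real.
rewrite conj_div_real numJ.
apply: (mulIf DC0).
have -> : (eta * num / D%:C * p ^+ m + (conjc eta) * (v * (u * (conjc u) - 1) + u * (v * (conjc v) - 1)) / D%:C * eta) * D%:C
   = num * (eta * p ^+ m) + (eta * (conjc eta)) * (v * (u * (conjc u) - 1) + u * (v * (conjc v) - 1)) by field.
by rewrite etaJ -uv DCE /num; ring.
Qed.

(** By [ellipse_interior], |u| and |v| lie strictly on opposite sides of 1, so |v| < 1 and |u| > |u|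
    |v| = |p|^m. *)
Lemma outer_branch (m : nat) (eta p u v : C) : (0 < m)%N ->
  nc eta = 1 -> u * v = eta * p ^+ m -> nc p != 1 -> nc v <= nc u ->
  (forall sigma, nc sigma <= 1 -> u + v != sigma * p ^+ m + (conjc sigma) * eta) ->
  nc p ^+ m < nc u.
Proof.
move=> m0 eta1 uv p1 vu out.
have pm1 : nc p ^+ m != 1 by rewrite -(expr1n _ m) eqrXn2 ?nc_ge0 ?ler01.
have UV : nc u * nc v = nc p ^+ m.
  by rewrite -Normc.normcM uv Normc.normcM eta1 mul1r ncX.
have v0 := nc_ge0 v.
have : ~~ (0 <= (nc u - 1) * (nc v - 1)).
  by apply/negP => /(ellipse_interior eta1 uv pm1)[sg sg1 /eqP]; apply/negP/out.
by rewrite -ltNge -UV => H; nra.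
Qed.

End Core.

(* Without these, arguments of type [R] would be parsed in [R_scope]. *)
Bind Scope ring_scope with R.
#[local] Arguments sin _%_ring_scope.
#[local] Arguments cos _%_ring_scope.
#[local] Arguments acos _%_ring_scope.

(** * Polynomials with zeros on the circle and real trigonometric forms *)

Section Circle.
Local Notation R := Rdefinitions.R.
Local Notation C := (complex R).
Local Notation nc := (@Normc.normc R).

Lemma PI_gt0 : 0 < PI :> R.
Proof. by apply/RltP; apply: PI_RGT_0. Qed.

Lemma two_IZR : IZR 2 = 2 :> R.
Proof. by []. Qed.

Lemma sin_pos (x : R) : 0 < x < PI -> 0 < sin x.
Proof. by move=> /andP[/RltP a /RltP b]; apply/RltP; apply: sin_gt_0. Qed.

Lemma sin_nneg (x : R) : 0 <= x <= PI -> 0 <= sin x.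
Proof. by move=> /andP[/RleP a /RleP b]; apply/RleP; apply: sin_ge_0. Qed.

Lemma sinN (x : R) : sin (- x) = - sin x.
Proof. exact: sin_neg. Qed.

Lemma cosN (x : R) : cos (- x) = cos x.
Proof. exact: cos_neg. Qed.

Lemma cos2Dsin2 (x : R) : cos x ^+ 2 + sin x ^+ 2 = 1.
Proof. by have := sin2_cos2 x; rewrite /Rsqr addrC !expr2. Qed.

Definition cis (t : R) : C := cos t +i* sin t.

Lemma cisD s t : cis (s + t) = cis s * cis t.
Proof. by rewrite /cis cosD sinD; simpc; congr (_ +i* _); rewrite addrC. Qed.

Lemma cis0 : cis 0 = 1.
Proof. by rewrite /cis cos_0 sin_0. Qed.

Lemma nc_cis t : nc (cis t) = 1.
Proof. by rewrite /= cos2Dsin2 sqrtr1. Qed.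

Lemma cis_neq0 t : cis t != 0.
Proof. by rewrite -nc_gt0 nc_cis ltr01. Qed.

Lemma conj_cis t : conjc (cis t) = cis (- t).
Proof. by rewrite /cis cosN sinN. Qed.

Lemma cis_PI : cis PI = -1.
Proof. by rewrite /cis cos_PI sin_PI; simpc; congr (_ +i* _); rewrite oppr0. Qed.

Lemma cis_2PI : cis (2 * PI) = 1.
Proof.
by rewrite (_ : 2 * PI = PI + PI) ?cisD ?cis_PI ?mulrNN ?mulr1//; ring.
Qed.

Lemma cisX t n : cis t ^+ n = cis (n%:R * t).
Proof.
elim: n => [|n IH]; first by rewrite mul0r cis0 expr0.
by rewrite exprS IH -cisD; congr cis; rewrite -natr1; ring.
Qed.

Lemma cisB_sin t x :
  cis t - cis x = 'i * cis ((t + x) / 2) * (2 * sin ((t - x) / 2))%:C.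
Proof.
have -> : cis t = cis ((t + x) / 2) * cis ((t - x) / 2).
  by rewrite -cisD; congr cis; field.
have -> : cis x = cis ((t + x) / 2) * cis (- ((t - x) / 2)).
  by rewrite -cisD; congr cis; field.
rewrite -mulrBr mulrAC [RHS]mulrC; congr (_ * _).
by rewrite /cis cosN sinN; simpc; congr (_ +i* _); ring.
Qed.

Lemma cis_inj s t : s < t < s + 2 * PI -> cis s != cis t.
Proof.
move=> /andP[st ts]; rewrite -subr_eq0 -oppr_eq0 opprB cisB_sin.
rewrite !mulf_neq0 ?cis_neq0//; first by apply/eqP => -[/eqP]; rewrite oner_eq0.
have : 0 < sin ((t - s) / 2) by apply: sin_pos; apply/andP; split; lra.
move=> H; apply/eqP => /complexI /eqP; rewrite mulf_eq0 pnatr_eq0 /=.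
by rewrite gt_eqF.
Qed.

Definition sinp (s : seq R) (t : R) : R := \prod_(x <- s) (2 * sin ((t - x) / 2)).
Definition zpoly (s : seq R) : {poly C} := \prod_(x <- s) ('X - (cis x)%:P).

Lemma zpoly_monic s : zpoly s \is monic.
Proof. exact: monic_prod_XsubC. Qed.

Lemma size_zpoly s : size (zpoly s) = (size s).+1.
Proof. exact: size_prod_XsubC. Qed.

Lemma zpoly_map s : zpoly s = \prod_(z <- map cis s) ('X - z%:P).
Proof. by rewrite big_map. Qed.

(** On the circle the polynomial is a real function times a phase. The constant part of the phase
    carries half the sum of the zeros, so comparing phases compares these sums. *)
Lemma horner_zpoly s t :
  (zpoly s).[cis t] = 'i ^+ size s * cis ((\sum_(x <- s) x) / 2) *
     cis ((size s)%:R * t / 2) * (sinp s t)%:C.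
Proof.
rewrite horner_prod /sinp; elim: s => [|x s IH].
  by rewrite !big_nil !mul0r cis0 !mulr1.
rewrite !big_cons IH hornerXsubC cisB_sin rmorphM /= exprS.
have -> : cis ((x + \sum_(j <- s) j) / 2) = cis (x / 2) * cis ((\sum_(j <- s) j) / 2).
  by rewrite -cisD; congr cis; ring.
have -> : cis ((size s).+1%:R * t / 2) = cis (t / 2) * cis ((size s)%:R * t / 2).
  by rewrite -cisD; congr cis; rewrite -natr1; ring.
have -> : cis ((t + x) / 2) = cis (t / 2) * cis (x / 2).
  by rewrite -cisD; congr cis; ring.
by ring.
Qed.

Lemma sinp_cont s : continuity (sinp s).
Proof.
elim: s => [|x s IH].
  by apply: (continuity_eq (f := fun=> 1)) => [t|]; [rewrite /sinp big_nil|apply: continuity_const].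
apply: (continuity_eq (f := fun t => (2 * sin ((t - x) / 2)) * sinp s t)).
  by move=> t; rewrite /sinp big_cons.
apply: (continuity_mult (fun t => 2 * sin ((t - x) / 2))) => //.
apply: (continuity_mult (fun=> 2)); first exact: continuity_const.
apply: (continuity_comp (fun t => (t - x) / 2) sin); last exact: continuity_sin.
apply: (continuity_mult (fun t => t - x) (fun=> 2^-1)); last exact: continuity_const.
apply: (continuity_minus id (fun=> x)); last exact: continuity_const.
by move=> t; apply: derivable_continuous_pt; apply: derivable_pt_id.
Qed.

Lemma sinp_2PI s t : sinp s (t + 2 * PI) = (-1) ^+ size s * sinp s t.
Proof.
rewrite /sinp; elim: s => [|x s IH]; first by rewrite !big_nil mulr1.
rewrite !big_cons IH exprS (_ : (t + 2 * PI - x) / 2 = (t - x) / 2 + PI); last by field.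
by rewrite neg_sin RoppE; ring.
Qed.

Lemma sign_prod (m k : nat) (F : nat -> R) :
  (forall i, (i < m)%N -> if (i < k)%N then 0 < F i else F i < 0) ->
  0 < (-1) ^+ (m - k) * \prod_(i <- iota 0 m) F i.
Proof.
elim: m => [|m IH] H; first by rewrite big_nil mulr1 ltr01.
rewrite -addn1 iotaD big_cat big_seq1 add0n /=.
have := H m (ltnSn m); have := IH (fun i im => H i (ltnW im)).
have [mk|km] := ltnP m k => P1 P2.
  have -> : (m + 1 - k = m - k)%N by lia.
  by rewrite mulrA mulr_gt0.
have -> : (m + 1 - k = (m - k).+1)%N by lia.
rewrite exprS; move: P1 P2; set a := (-1) ^+ _; set b := \prod_(i <- _) _ => P1 P2; nra.
Qed.

Lemma sign_prod_weak (m k : nat) (F : nat -> R) :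
  (forall i, (i < m)%N -> if (i < k)%N then 0 <= F i else F i <= 0) ->
  0 <= (-1) ^+ (m - k) * \prod_(i <- iota 0 m) F i.
Proof.
elim: m => [|m IH] H; first by rewrite big_nil mulr1 ler01.
rewrite -addn1 iotaD big_cat big_seq1 add0n /=.
have := H m (ltnSn m); have := IH (fun i im => H i (ltnW im)).
have [mk|km] := ltnP m k => P1 P2.
  have -> : (m + 1 - k = m - k)%N by lia.
  by rewrite mulrA mulr_ge0.
have -> : (m + 1 - k = (m - k).+1)%N by lia.
rewrite exprS; move: P1 P2; set a := (-1) ^+ _; set b := \prod_(i <- _) _ => P1 P2; nra.
Qed.

(** k counts the zeros behind t; each of the remaining m - k contributes a negative sine. *)
Lemma sinp_sign (m k : nat) (x : nat -> R) t :
  (forall i, (i < m)%N -> if (i < k)%N then x i < t < x i + 2 * PI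
                          else t < x i < t + 2 * PI) ->
  0 < (-1) ^+ (m - k) * sinp (mkseq x m) t.
Proof.
move=> H; rewrite /sinp big_map; apply: sign_prod => i /H.
case: ifP => _ /andP[h1 h2].
  by rewrite mulr_gt0//; apply: sin_pos; apply/andP; split; lra.
rewrite pmulr_rlt0// -oppr_gt0 -sinN; apply: sin_pos; apply/andP; split; lra.
Qed.

Lemma sinp_sign_weak (m k : nat) (x : nat -> R) t :
  (forall i, (i < m)%N -> if (i < k)%N then x i <= t <= x i + 2 * PI
                          else t <= x i <= t + 2 * PI) ->
  0 <= (-1) ^+ (m - k) * sinp (mkseq x m) t.
Proof.
move=> H; rewrite /sinp big_map; apply: sign_prod_weak => i /H.
case: ifP => _ /andP[h1 h2].
  by rewrite mulr_ge0//; apply: sin_nneg; apply/andP; split; lra.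
rewrite pmulr_rle0// -oppr_ge0 -sinN; apply: sin_nneg; apply/andP; split; lra.
Qed.

Lemma ivt_sign (g : R -> R) (a b : R) : continuity g -> a < b ->
  g a * g b < 0 -> exists2 z, a < z < b & g z = 0.
Proof.
move=> gc ab gab.
have [z [[/RleP az /RleP zb] gz]] := IVT_cor g a b gc (elimT RleP (ltW ab)) (elimT RleP (ltW gab)).
exists z => //; rewrite !lt_neqAle az zb !andbT; apply/andP; split; apply/eqP => E.
  by move: gab; rewrite E gz mul0r ltxx.
by move: gab; rewrite -E gz mulr0 ltxx.
Qed.

(* [g] is the real trigonometric polynomial of order [m/2] attached to [f]; each
   of its [m] sign changes in a period yields a zero. *)
Lemma circle_roots (m : nat) (f : {poly C}) (c : C) (g : R -> R) (e : R) (x : nat -> R) :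
  (0 < m)%N -> (size f <= m.+1)%N -> c != 0 ->
  (forall t, f.[cis t] = c * cis (m%:R * t / 2) * (g t)%:C) ->
  continuity g -> (forall t, g (t + 2 * PI) = (-1) ^+ m * g t) ->
  (forall i, (i < m)%N -> 0 < e * (-1) ^+ i * g (x i)) ->
  (forall i, (i.+1 < m)%N -> x i < x i.+1) -> x m.-1 < x 0%N + 2 * PI ->
  exists ts : seq R, [/\ size ts = m, f != 0, size f = m.+1 & f = lead_coef f *: zpoly ts].
Proof.
move=> m0 sf c0 fg gc gper gs xs xm.
(* The m points bound only m - 1 intervals; the last sign change is found between the last point and
   the first one shifted by a turn, where the factor (-1)^m gives the expected sign. *)
pose x' i := if (i < m)%N then x i else x 0%N + 2 * PI.
have gs' i : (i <= m)%N -> 0 < e * (-1) ^+ i * g (x' i).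
  rewrite leq_eqVlt /x' => /orP[/eqP ->|im]; last by rewrite im gs.
  rewrite ltnn gper (_ : _ * _ = e * g (x 0%N)); first by have := gs _ m0; rewrite expr0 mulr1.
  rewrite mulrA -[e * _ * _]mulrA -expr2 sqrr_sign mulr1//.
have xs' i : (i < m)%N -> x' i < x' i.+1.
  by rewrite /x' => im; rewrite im; case: ltnP => [/xs//|mi]; have -> : i = m.-1 by lia.
have [ts [sts tsb tsu]] : exists ts : seq R, [/\ size ts = m,
    forall t, t \in ts -> x 0%N < t < x' m /\ g t = 0 & uniq ts].
  have : (m <= m)%N by [].
  have x'0 : x' 0%N = x 0%N by rewrite /x' m0.
  elim: {1 3 4}m => [|k IH] km; first by exists [::].
  have [ts [sts tsb tsu]] := IH (ltnW km).
  have [||t /andP[t1 t2] gt] := @ivt_sign g (x' k) (x' k.+1) gc; first exact: xs'.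
    have := mulr_gt0 (gs' k (ltnW km)) (gs' _ km).
    rewrite exprS [X in 0 < X](_ : _ = - (e ^+ 2 * ((-1) ^+ k) ^+ 2 * (g (x' k) * g (x' k.+1)))); last by ring.
    rewrite sqrr_sign mulr1 oppr_gt0 => H; have := sqr_ge0 e; nra.
  have xk : x 0%N <= x' k.
    rewrite -x'0; elim: (k) km => // j IHj jm.
    by apply: le_trans (IHj (ltnW jm)) (ltW (xs' _ (ltnW jm))).
  exists (rcons ts t); split; first by rewrite size_rcons sts.
    move=> u; rewrite mem_rcons inE => /orP[/eqP ->|/tsb [/andP[u1 u2] gu]].
      by rewrite t2 (le_lt_trans xk t1).
    by rewrite u1 (lt_trans u2)// (lt_trans t1).
  rewrite rcons_uniq tsu andbT; apply/negP => /tsb [/andP[_]].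
  by rewrite ltNge (ltW t1).
have f0 : f != 0.
  apply/eqP => f0; have := fg (x 0%N); rewrite f0 horner0 => /esym/eqP.
  rewrite !mulf_eq0 (negPf c0) (negPf (cis_neq0 _)) /= => /eqP/complexI g0.
  by have := gs _ m0; rewrite g0 mulr0 ltxx.
have rts : all (root f) (map cis ts).
  apply/allP => z /mapP[t /tsb [_ gt] ->]; rewrite /root fg gt mulr0//.
have uts : uniq (map cis ts).
  rewrite map_inj_in_uniq// => s t /tsb [/andP[s1 s2] _] /tsb [/andP[t1 t2] _] /eqP st.
  have xm' : x' m = x 0%N + 2 * PI by rewrite /x' ltnn.
  rewrite xm' in s2 t2.
  have [lts|lts|//] := ltgtP s t; exfalso.
    by move: st; apply/negP/cis_inj; rewrite lts; lra.
  by move: st; rewrite eq_sym; apply/negP/cis_inj; rewrite lts; lra.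
have sfm : size f = m.+1.
  by apply/eqP; rewrite eqn_leq sf /= -sts -(size_map cis); apply: max_poly_roots.
exists ts; split => //; rewrite zpoly_map; apply: all_roots_prod_XsubC => //.
  by rewrite size_map sts.
by rewrite uniq_rootsE.
Qed.

End Circle.

(** * Double zeros at points of tangency, without derivatives *)

Section DoubleRoot.
Local Notation R := Rdefinitions.R.
Local Notation C := (complex R).
Local Notation nc := (@Normc.normc R).

Definition ccont (f : R -> C) : Prop :=
  continuity (fun t => complex.Re (f t)) /\ continuity (fun t => complex.Im (f t)).

Lemma ccont_const (z : C) : ccont (fun=> z).
Proof. by split; apply: continuity_const. Qed.

Lemma ccont_add f g : ccont f -> ccont g -> ccont (fun t => f t + g t).
Proof.
move=> [f1 f2] [g1 g2]; split.
  apply: (continuity_eq (f := fun t => complex.Re (f t) + complex.Re (g t))).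
    by move=> t; case: (f t) (g t) => a b [].
  exact: (continuity_plus (fun t => complex.Re (f t)) (fun t => complex.Re (g t))).
apply: (continuity_eq (f := fun t => complex.Im (f t) + complex.Im (g t))).
  by move=> t; case: (f t) (g t) => a b [].
exact: (continuity_plus (fun t => complex.Im (f t)) (fun t => complex.Im (g t))).
Qed.

Lemma ccont_mul f g : ccont f -> ccont g -> ccont (fun t => f t * g t).
Proof.
move=> [f1 f2] [g1 g2].
have M a b : continuity a -> continuity b -> continuity (fun t => a t * b t).
  exact: continuity_mult.
split.
  apply: (continuity_eq (f := fun t => complex.Re (f t) * complex.Re (g t) - complex.Im (f t) * complex.Im (g t))).
    by move=> t; case: (f t) (g t) => a b [].
  apply: (continuity_minus (fun t => complex.Re (f t) * complex.Re (g t)) (fun t => complex.Im (f t) * complex.Im (g t))); exact: M.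
apply: (continuity_eq (f := fun t => complex.Re (f t) * complex.Im (g t) + complex.Im (f t) * complex.Re (g t))).
  by move=> t; case: (f t) (g t) => a b [].
apply: (continuity_plus (fun t => complex.Re (f t) * complex.Im (g t)) (fun t => complex.Im (f t) * complex.Re (g t))); exact: M.
Qed.

Lemma ccont_cis (a b : R) : ccont (fun t => cis (a * t + b)).
Proof.
have ab : continuity (fun t => a * t + b).
  apply: (continuity_plus (fun t => a * t) (fun=> b)); last exact: continuity_const.
  apply: (continuity_mult (fun=> a) id); first exact: continuity_const.
  by move=> t; apply: derivable_continuous_pt; apply: derivable_pt_id.
split => /=; first by apply: (continuity_comp _ cos ab); apply: continuity_cos.
by apply: (continuity_comp _ sin ab); apply: continuity_sin.
Qed.

Lemma ccont_ext f g : f =1 g -> ccont f -> ccont g.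
Proof.
by move=> fg [f1 f2]; split; [apply: continuity_eq f1|apply: continuity_eq f2] => t; rewrite fg.
Qed.

Lemma ccont_poly (f : {poly C}) : ccont (fun t => f.[cis t]).
Proof.
have cc : ccont cis by apply: ccont_ext (ccont_cis 1 0) => t; rewrite mul1r addr0.
elim/poly_ind: f => [|f c IH]; first by apply: ccont_ext (ccont_const 0) => t; rewrite horner0.
apply: ccont_ext (ccont_add (ccont_mul IH cc) (ccont_const c)) => t.
by rewrite hornerD hornerC hornerMX.
Qed.

(** [sg] is the side from which y is approached, 1 for the right and -1 for the left. *)
Lemma cont_le0 (f : R -> R) (y sg e : R) : continuity f -> 0 < e -> `|sg| = 1 ->
  (forall d, 0 < d < e -> f (y + sg * d) <= 0) -> f y <= 0.
Proof.
move=> fc e0 sg1 H; rewrite leNgt; apply/negP => fy.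
have [d [/RltP d0 Hd]] := fc y (f y) (elimT RltP fy).
pose a := Num.min d e / 2.
have m0 : 0 < Num.min d e by rewrite lt_min e0 d0.
have a0 : 0 < a by rewrite divr_gt0.
have md : Num.min d e <= d by rewrite ge_min lexx.
have me : Num.min d e <= e by rewrite ge_min lexx orbT.
have ad : a < d by rewrite /a; lra.
have ae : a < e by rewrite /a; lra.
have sn0 : sg != 0 by rewrite -normr_gt0 sg1.
have := H a; rewrite a0 ae => /(_ isT) fa.
have : `|f (y + sg * a) - f y| < f y.
  apply/RltP; rewrite -RabsE; apply: Hd; split.
    split => //; apply/eqP; rewrite eq_sym -subr_eq0 addrC addKr mulf_neq0// gt_eqF//.
  apply/RltP; rewrite /= /Rdist RabsE RminusE addrC addKr normrM sg1 mul1r gtr0_norm//.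
by rewrite ltr_norml => /andP[]; lra.
Qed.

(** g keeps its sign around y while sin((t - y)/2) changes sign. Their quotient is continuous,
    nonpositive on the right and nonnegative on the left, so it vanishes at y. *)
Lemma double_root (n : nat) (F K : {poly C}) (c : C) (g : R -> R) (y e : R) :
  c != 0 -> (forall t, F.[cis t] = c * cis (n%:R * t / 2) * (g t)%:C) ->
  0 < e <= PI -> (forall t, y - e < t < y + e -> g t <= 0) ->
  F = ('X - (cis y)%:P) * K -> root K (cis y).
Proof.
move=> c0 Fg /andP[e0 ePI] ge FK.
(* [K] on the circle with its phase removed, normalized so that H(t) times 2 sin((t - y)/2) is
   g(t). *)
pose H t := K.[cis t] * ('i * c^-1) * cis ((2^-1 - n%:R / 2) * t + y / 2).
have Hc : ccont H.
  apply: ccont_mul; last exact: ccont_cis.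
  apply: ccont_mul; [exact: ccont_poly|exact: ccont_const].
have HE t : H t * (2 * sin ((t - y) / 2))%:C = (g t)%:C.
  have := Fg t; rewrite FK hornerM hornerXsubC cisB_sin => E.
  apply: (mulfI (cis_neq0 (n%:R * t / 2))); apply: (mulfI c0).
  rewrite [RHS]mulrA -E /H.
  have -> : cis ((t + y) / 2) = cis (n%:R * t / 2) * cis ((2^-1 - n%:R / 2) * t + y / 2).
    by rewrite -cisD; congr cis; field.
  by field.
have HRe t : complex.Re (H t) * (2 * sin ((t - y) / 2)) = g t.
  by have := congr1 (@complex.Re _) (HE t); case: (H t) => a b /=; rewrite mulr0 subr0.
have HIm t : complex.Im (H t) * (2 * sin ((t - y) / 2)) = 0.
  by have := congr1 (@complex.Im _) (HE t); case: (H t) => a b /=; rewrite mulr0 add0r.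
have sp d : 0 < d < e -> 0 < sin (d / 2).
  by move=> /andP[d0 de]; apply: sin_pos; apply/andP; split; lra.
have sR d : 0 < d < e -> complex.Re (H (y + 1 * d)) <= 0 /\ complex.Im (H (y + 1 * d)) = 0.
  move=> dd; have := sp d dd; case/andP: dd => d0 de s0.
  have := HRe (y + 1 * d); have := HIm (y + 1 * d); have := ge (y + 1 * d).
  rewrite (_ : (y + 1 * d - y) / 2 = d / 2); last by field.
  rewrite (_ : _ < _ < _); last by apply/andP; split; lra.
  move=> /(_ isT) g0 /eqP I0 R0; split; first by nra.
  have s2 : 2 * sin (d / 2) != 0 by rewrite gt_eqF// mulr_gt0.
  by move: I0; rewrite mulf_eq0 (negPf s2) orbF => /eqP.
have sL d : 0 < d < e -> - complex.Re (H (y + (-1) * d)) <= 0.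
  move=> dd; have := sp d dd; case/andP: dd => d0 de s0.
  have := HRe (y + (-1) * d); have := ge (y + (-1) * d).
  rewrite (_ : (y + (-1) * d - y) / 2 = - (d / 2)); last by field.
  rewrite sinN (_ : _ < _ < _); last by apply/andP; split; lra.
  by move=> /(_ isT) g0 R0; nra.
case: Hc => Rc Ic.
have n1 : `|1 : R| = 1 by rewrite normr1.
have nN1 : `|-1 : R| = 1 by rewrite normrN1.
have h1 : complex.Re (H y) <= 0.
  by apply: (cont_le0 (f := fun t => complex.Re (H t)) Rc e0 n1) => d /sR[].
have h2 : - complex.Re (H y) <= 0.
  apply: (cont_le0 (f := fun t => - complex.Re (H t)) (continuity_opp _ Rc) e0 nN1) => d /sL//.
have h3 : complex.Im (H y) <= 0.
  by apply: (cont_le0 (f := fun t => complex.Im (H t)) Ic e0 n1) => d /sR[_ ->].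
have h4 : - complex.Im (H y) <= 0.
  by apply: (cont_le0 (f := fun t => - complex.Im (H t)) (continuity_opp _ Ic) e0 n1) => d /sR[_ ->]; rewrite oppr0.
have : H y = 0.
  by case: (H y) h1 h2 h3 h4 => a b /= *; congr (_ +i* _); lra.
move=> /eqP; rewrite /H !mulf_eq0 (negPf (cis_neq0 _)) orbF invr_eq0 (negPf c0) orbF.
case/orP => //; by rewrite eq_complex /= oner_eq0 andbF.
Qed.

End DoubleRoot.

(** * The inequality for a level set with at least two segments *)

Section Banded.
Local Notation R := Rdefinitions.R.
Local Notation C := (complex R).
Local Notation nc := (@Normc.normc R).

Lemma cis_surj (z : C) : nc z = 1 -> exists t, z = cis t.
Proof.
case: z => a b /= ab1.
have ab : a ^+ 2 + b ^+ 2 = 1.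
  by rewrite -(sqr_sqrtr (addr_ge0 (sqr_ge0 a) (sqr_ge0 b))) ab1 expr1n.
have ha : Rle (-1) a /\ Rle a 1 by split; apply/RleP; nra.
have ca : cos (acos a) = a by apply: cos_acos.
have sa2 : sin (acos a) ^+ 2 = b ^+ 2.
  by have := cos2Dsin2 (acos a); rewrite ca; lra.
have [/eqP sb|/eqP sb] : sin (acos a) == b \/ sin (acos a) == - b.
  by apply/orP; rewrite -eqf_sqr sa2.
  by exists (acos a); rewrite /cis ca sb.
by exists (- acos a); rewrite /cis cosN sinN ca sb opprK.
Qed.

Lemma horner0_zpoly s : (zpoly s).[0] = (-1) ^+ size s * cis (\sum_(x <- s) x).
Proof.
rewrite horner_prod; elim: s => [|x s IH]; first by rewrite !big_nil cis0 mulr1.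
by rewrite !big_cons IH hornerXsubC exprS cisD; ring.
Qed.

Lemma cis_eq1 x : 0 < x < 4 * PI -> cis x = 1 -> x = 2 * PI.
Proof.
move=> /andP[x0 x4] cx; have p0 := PI_gt0.
have [lt|lt|//] := ltgtP x (2 * PI); exfalso.
  have : 0 < x < 0 + 2 * PI by rewrite x0 add0r.
  by move=> /cis_inj; rewrite cx cis0 eqxx.
have : 2 * PI < x < 2 * PI + 2 * PI by rewrite lt; lra.
by move=> /cis_inj; rewrite cx cis_2PI eqxx.
Qed.

Lemma nc_cisB s t : nc (cis s - cis t) = `|2 * sin ((s - t) / 2)|.
Proof.
rewrite cisB_sin !Normc.normcM nc_cis nc_real.
by rewrite /= expr0n expr1n add0r sqrtr1 !mul1r.
Qed.

Lemma nc_cisD s t : nc (cis s + cis t) = `|2 * cos ((s - t) / 2)|.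
Proof.
have -> : cis s + cis t = cis ((s + t) / 2) * (2 * cos ((s - t) / 2))%:C.
  have -> : cis s = cis ((s + t) / 2) * cis ((s - t) / 2).
    by rewrite -cisD; congr cis; field.
  have -> : cis t = cis ((s + t) / 2) * cis (- ((s - t) / 2)).
    by rewrite -cisD; congr cis; field.
  rewrite -mulrDr; congr (_ * _).
  by rewrite /cis cosN sinN; simpc; congr (_ +i* _); ring.
by rewrite Normc.normcM nc_cis nc_real mul1r.
Qed.

Lemma cis_mPI m : cis (m%:R * PI) = (-1) ^+ m.
Proof. by rewrite -cisX cis_PI. Qed.

Variables (m : nat) (h : R) (phi l r : nat -> R).
Hypothesis m_gt0 : (0 < m)%N.
Hypothesis h_gt0 : 0 < h.
Hypothesis phi_m : phi m = phi 0%N + 2 * PI.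
Hypothesis phi_l : forall i, (i < m)%N -> phi i < l i.
Hypothesis l_le_r : forall i, (i < m)%N -> l i <= r i.
Hypothesis r_phi : forall i, (i < m)%N -> r i < phi i.+1.

Lemma phi_mono i j : (i <= j <= m)%N -> phi i <= phi j.
Proof.
move=> /andP[]; elim: j => [|j IH]; first by rewrite leqn0 => /eqP ->.
rewrite leq_eqVlt => /orP[/eqP -> //|ij jm].
have := IH ij (ltnW jm); have := phi_l jm; have := l_le_r jm; have := r_phi jm; lra.
Qed.

Lemma r_lt_phi i j : (i < j <= m)%N -> r i < phi j.
Proof.
move=> /andP[ij jm]; apply: lt_le_trans (r_phi _) (phi_mono _); lia.
Qed.

Lemma phi_lt_l i j : (i <= j < m)%N -> phi i < l j.
Proof.
move=> /andP[ij jm]; apply: le_lt_trans (phi_mono _) (phi_l _); lia.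
Qed.

Lemma phi_lt_r i j : (i <= j < m)%N -> phi i < r j.
Proof. by move=> ij; apply: lt_le_trans (phi_lt_l ij) (l_le_r _); lia. Qed.

Lemma l_lt_phi i j : (i < j <= m)%N -> l i < phi j.
Proof. by move=> ij; apply: le_lt_trans (l_le_r _) (r_lt_phi ij); lia. Qed.

Lemma r_lt_l i j : (i < j < m)%N -> r i < l j.
Proof. by move=> ij; apply: lt_trans (r_lt_phi (j := j) _) (phi_lt_l _); lia. Qed.

Local Notation Q := (sinp (mkseq phi m)).
Local Notation Al := (sinp (mkseq l m)).
Local Notation Ar := (sinp (mkseq r m)).


Lemma phi_le_2PI i : (i <= m)%N -> phi i <= phi 0%N + 2 * PI.
Proof. by move=> im; rewrite -phi_m; apply: phi_mono; lia. Qed.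

Lemma phi0_le i : (i <= m)%N -> phi 0%N <= phi i.
Proof. by move=> im; apply: phi_mono; lia. Qed.

Lemma Q_sign i t : (i < m)%N -> phi i < t < phi i.+1 -> 0 < (-1) ^+ (m - i.+1) * Q t.
Proof.
move=> im /andP[t1 t2]; apply: sinp_sign => j jm.
have hi := phi0_le (ltnW im); have hi' := phi_le_2PI im; have hj := phi0_le (ltnW jm).
case: ltnP => ji; apply/andP; split.
- by apply: le_lt_trans t1; apply: phi_mono; lia.
- by lra.
- by apply: lt_le_trans t2 _; apply: phi_mono; lia.
- by have := r_phi jm; have := phi_le_2PI jm; have := phi_l jm; have := l_le_r jm; lra.
Qed.

(** Only a weak sign is available: at an isolated point [l i = r i] and [Ar] vanishes. *)
Lemma Ar_l_sign i : (i < m)%N -> 0 <= (-1) ^+ (m - i) * Ar (l i).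
Proof.
move=> im; apply: sinp_sign_weak => j jm.
have hi := phi0_le (ltnW im); have hi' := phi_le_2PI im; have hj := phi0_le (ltnW jm).
have hj' := phi_le_2PI jm.
have li := phi_l im; have ri := l_le_r im; have pi := r_phi im.
have lj := phi_l jm; have rj := l_le_r jm; have pj := r_phi jm.
case: ltnP => ji; apply/andP; split; try lra.
- by apply: ltW; apply: r_lt_l; rewrite ji.
- by move: ji; rewrite leq_eqVlt => /orP[/eqP <-//|ij]; apply: le_trans ri (ltW (lt_le_trans (r_lt_l _) rj)); rewrite ij jm.
Qed.

Lemma Ar_phi_sign i : (i < m)%N -> 0 < (-1) ^+ (m - i) * Ar (phi i).
Proof.
move=> im; apply: sinp_sign => j jm.
have hi := phi0_le (ltnW im); have hi' := phi_le_2PI im; have hj := phi0_le (ltnW jm).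
have hj' := phi_le_2PI jm.
have li := phi_l im; have ri := l_le_r im; have pi := r_phi im.
have lj := phi_l jm; have rj := l_le_r jm; have pj := r_phi jm.
case: ltnP => ji; apply/andP; split; try lra.
- by apply: r_lt_phi; rewrite ji ltnW.
- by apply: phi_lt_r; rewrite ji jm.
Qed.

Lemma Al_phi_sign i : (i < m)%N -> 0 < (-1) ^+ (m - i) * Al (phi i).
Proof.
move=> im; apply: sinp_sign => j jm.
have hi := phi0_le (ltnW im); have hi' := phi_le_2PI im; have hj := phi0_le (ltnW jm).
have hj' := phi_le_2PI jm.
have li := phi_l im; have ri := l_le_r im; have pi := r_phi im.
have lj := phi_l jm; have rj := l_le_r jm; have pj := r_phi jm.
case: ltnP => ji; apply/andP; split; try lra.
- by apply: l_lt_phi; rewrite ji ltnW.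
- by apply: phi_lt_l; rewrite ji jm.
Qed.

Lemma sgnS i : (i < m)%N -> (-1) ^+ (m - i) = - (-1) ^+ (m - i.+1) :> R.
Proof. by move=> im; rewrite (_ : (m - i = (m - i.+1).+1)%N) ?exprS ?mulN1r//; lia. Qed.

Lemma sgnE i : (i < m)%N -> (-1) ^+ (m - i.+1) = (-1) ^+ m.-1 * (-1) ^+ i :> R.
Proof.
move=> im; rewrite (_ : (m.-1 = (m - i.+1) + i)%N); last by lia.
by rewrite exprD -mulrA -expr2 sqrr_sign mulr1.
Qed.

Definition S1 := [seq i <- iota 0 m | l i < r i].
Definition T1 := [seq i <- iota 0 m | ~~ (l i < r i)].

Lemma S1P i : i \in S1 -> (i < m)%N /\ l i < r i.
Proof. by rewrite mem_filter mem_iota add0n => /andP[]. Qed.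

Lemma T1P i : i \in T1 -> (i < m)%N /\ l i = r i.
Proof.
rewrite mem_filter mem_iota add0n => /andP[lr /andP[_ im]]; split => //.
by apply/eqP; rewrite eq_le l_le_r//= leNgt.
Qed.

Local Notation A1 := (zpoly (map r S1)).
Local Notation B1 := (zpoly (map l S1)).
Local Notation Y := (zpoly (map l T1)).
Local Notation P := (zpoly (mkseq phi m)).

Lemma zpoly_rE : zpoly (mkseq r m) = A1 * Y.
Proof.
rewrite /zpoly !big_map !big_filter (bigID (fun i => l i < r i)) /=; congr (_ * _).
rewrite big_seq_cond [RHS]big_seq_cond; apply: eq_bigr => i /andP[i1 i2].
by have /T1P[_ ->] : i \in T1 by rewrite mem_filter i2 i1.
Qed.

Lemma zpoly_lE : zpoly (mkseq l m) = B1 * Y.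
Proof. by rewrite /zpoly !big_map !big_filter (bigID (fun i => l i < r i)). Qed.

Lemma size_S1T1 : (size S1 + size T1)%N = m.
Proof. by rewrite !size_filter count_predC size_iota. Qed.

(** Distinctness lets the ends be divided out of P^2 - eta h^2 z^m together, and shows that [A1] and
    [B1] have no common zero. *)
Lemma uniq_ends : uniq (map cis (map r S1 ++ map l S1 ++ map l T1)).
Proof.
have uS : uniq S1 by rewrite filter_uniq// iota_uniq.
have uT : uniq T1 by rewrite filter_uniq// iota_uniq.
have win x : x \in map r S1 ++ map l S1 ++ map l T1 -> phi 0%N < x < phi 0%N + 2 * PI.
  rewrite !mem_cat => /orP[|/orP[]] /mapP[k].
  - move=> /S1P[km lr] ->; have := phi0_le (ltnW km); have := phi_le_2PI km.
    by have := phi_l km; have := r_phi km; lra.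
  - move=> /S1P[km lr] ->; have := phi0_le (ltnW km); have := phi_le_2PI km.
    by have := phi_l km; have := r_phi km; lra.
  - move=> /T1P[km lr] ->; have := phi0_le (ltnW km); have := phi_le_2PI km.
    by have := phi_l km; have := r_phi km; lra.
have linj i j : (i < m)%N -> (j < m)%N -> l i = l j -> i = j.
  move=> im jm; have [ij|ij|//] := ltngtP i j => E; exfalso.
    by have := @r_lt_l i j; have := l_le_r im; rewrite ij jm => ? /(_ isT); lra.
  by have := @r_lt_l j i; have := l_le_r jm; rewrite ij im => ? /(_ isT); lra.
have rinj i j : (i < m)%N -> (j < m)%N -> r i = r j -> i = j.
  move=> im jm; have [ij|ij|//] := ltngtP i j => E; exfalso.
    by have := @r_lt_l i j; have := l_le_r jm; rewrite ij jm => ? /(_ isT); lra.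
  by have := @r_lt_l j i; have := l_le_r im; rewrite ij im => ? /(_ isT); lra.
have rl i j : (i < m)%N -> (j < m)%N -> l i < r i -> r i <> l j.
  move=> im jm lr; have [ij|ij|<-] := ltngtP i j => E.
  - by have := @r_lt_l i j; rewrite ij jm => /(_ isT); lra.
  - by have := @r_lt_l j i; have := l_le_r jm; rewrite ij im => ? /(_ isT); lra.
  - by lra.
rewrite map_inj_in_uniq.
  rewrite cat_uniq cat_uniq.
  rewrite !map_inj_in_uniq//; last first.
  - by move=> i j /S1P[im _] /S1P[jm _]; apply: rinj.
  - by move=> i j /S1P[im _] /S1P[jm _]; apply: linj.
  - by move=> i j /T1P[im _] /T1P[jm _]; apply: linj.
  rewrite uS uT /= andbT; apply/andP; split.
    apply/hasPn => x; rewrite mem_cat => /orP[] /mapP[j].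
      by move=> /S1P[jm _] ->; apply/negP => /mapP[i /S1P[im lr]] E; apply: (rl i j).
    by move=> /T1P[jm _] ->; apply/negP => /mapP[i /S1P[im lr]] E; apply: (rl i j).
  apply/hasPn => x /mapP[j jT ->]; apply/negP => /mapP[i iS] E.
  have [jm E1] := T1P jT; have [im E2] := S1P iS.
  by move: E2; rewrite (linj _ _ im jm (esym E)) E1 ltxx.
move=> s t /win /andP[s1 s2] /win /andP[t1 t2] /eqP st.
have [lts|lts|//] := ltgtP s t; exfalso.
  by move: st; apply/negP/cis_inj; rewrite lts; lra.
by move: st; rewrite eq_sym; apply/negP/cis_inj; rewrite lts; lra.
Qed.

(** The constant phase of [P] on the circle; its square is eta. *)
Definition kappa : C := 'i ^+ m * cis ((\sum_(0 <= i < m) phi i) / 2).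

Lemma nc_kappa : nc kappa = 1.
Proof.
by rewrite Normc.normcM ncX nc_cis mulr1 /= expr0n expr1n add0r sqrtr1 expr1n.
Qed.

Lemma sum_mkseq (f : nat -> R) : \sum_(x <- mkseq f m) x = \sum_(0 <= i < m) f i.
Proof. by rewrite big_map /index_iota subn0. Qed.

Lemma hornerP t : P.[cis t] = kappa * cis (m%:R * t / 2) * (Q t)%:C.
Proof. by rewrite horner_zpoly size_mkseq sum_mkseq. Qed.

Hypothesis Ql : forall i, (i < m)%N -> `|Q (l i)| = h.
Hypothesis Qr : forall i, (i < m)%N -> `|Q (r i)| = h.
Hypothesis Qtouch : forall i, (i < m)%N -> l i = r i ->
  forall t, phi i < t < phi i.+1 -> `|Q t| <= h.

Local Notation F := (P ^+ 2 - (kappa ^+ 2 * (h ^+ 2)%:C) *: 'X^m).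

Lemma hornerF t : F.[cis t] = kappa ^+ 2 * cis ((2 * m)%:R * t / 2) * (Q t ^+ 2 - h ^+ 2)%:C.
Proof.
rewrite hornerD hornerN hornerZ hornerXn cisX (expr2 P) hornerM hornerP.
have -> : cis ((2 * m)%:R * t / 2) = cis (m%:R * t / 2) * cis (m%:R * t / 2).
  by rewrite -cisD; congr cis; rewrite natrM; field.
have -> : cis (m%:R * t) = cis (m%:R * t / 2) * cis (m%:R * t / 2).
  by rewrite -cisD; congr cis; field.
by rewrite rmorphB /= !rmorphXn /=; ring.
Qed.

Lemma F_monic : F \is monic /\ size F = (2 * m).+1.
Proof.
have sP2 : size (P ^+ 2) = (2 * m).+1.
  by rewrite expr2 size_monicM ?zpoly_monic ?monic_neq0 ?zpoly_monic// size_zpoly size_mkseq; lia.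
have sX : (size (- ((kappa ^+ 2 * (h ^+ 2)%:C) *: 'X^m)) < size (P ^+ 2))%N.
  by rewrite size_polyN (leq_ltn_trans (size_scale_leq _ _))// size_polyXn sP2; lia.
split; last by rewrite size_polyDl.
by rewrite monicE lead_coefDl// -monicE monic_exp ?zpoly_monic.
Qed.

(** On the circle [F] is Q^2 - h^2 up to a phase. It vanishes at all ends, and doubly at the
    isolated points, where Q^2 - h^2 <= 0 on both sides. Counted so, these are 2 m zeros, the degree
    of [F]. *)
Lemma F_factor : F = A1 * B1 * Y ^+ 2.
Proof.
set L := map cis (map r S1 ++ map l S1 ++ map l T1).
have uL : uniq L by apply: uniq_ends.
have rF t : `|Q t| = h -> root F (cis t).
  by move=> Qt; rewrite /root hornerF -(real_normK (num_real (Q t))) Qt subrr mulr0.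
have rL : all (root F) L.
  apply/allP => z /mapP[x]; rewrite !mem_cat => /orP[|/orP[]] /mapP[k].
  - by move=> /S1P[im _] -> ->; apply: rF; apply: Qr.
  - by move=> /S1P[im _] -> ->; apply: rF; apply: Ql.
  - by move=> /T1P[im _] -> ->; apply: rF; apply: Ql.
set D := \prod_(z <- L) ('X - z%:P).
have DE : D = A1 * B1 * Y by rewrite /D /L big_map !big_cat /= /zpoly mulrA.
have Dm : D \is monic by apply: monic_prod_XsubC.
have sL : size L = (2 * size S1 + size T1)%N.
  by rewrite /L size_map !size_cat !size_map mul2n -addnn addnA.
have sD : size D = (2 * size S1 + size T1).+1 by rewrite size_prod_XsubC sL.
have /dvdpP[G FG] : D %| F by apply: uniq_roots_dvdp; rewrite ?uniq_rootsE.
have [Fm sF] := F_monic.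
have Gm : G \is monic by move: Fm; rewrite {1}FG monicMr.
have sG : size G = (size T1).+1.
  have := size_monicM Gm (monic_neq0 Dm); rewrite -FG sF sD.
  have := size_S1T1; have : (0 < size G)%N by rewrite size_poly_gt0 monic_neq0.
  by lia.
suff -> : Y ^+ 2 = Y * G by rewrite FG mulrA -DE mulrC.
rewrite expr2; congr (_ * _).
have uT : uniq (map cis (map l T1)).
  by move: uL; rewrite /L !map_cat !cat_uniq => /and3P[_ _ /and3P[]].
have -> : G = lead_coef G *: \prod_(z <- map cis (map l T1)) ('X - z%:P).
  apply: all_roots_prod_XsubC; rewrite ?uniq_rootsE ?size_map//.
  apply/allP => z /mapP[x /mapP[i iT ->]] ->.
  have [im lr] := T1P iT.
  have zL : cis (l i) \in L.
    by apply: map_f; rewrite !mem_cat (map_f l iT) !orbT.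
  have DD : D = ('X - (cis (l i))%:P) * \prod_(z <- rem (cis (l i)) L) ('X - z%:P).
    by rewrite /D (perm_big _ (perm_to_rem zL)) big_cons.
  have ml := phi_l im; have mr := r_phi im; have mlr := l_le_r im.
  pose e := Num.min PI (Num.min (l i - phi i) (phi i.+1 - l i)).
  have e0 : 0 < e by rewrite /e !lt_min PI_gt0 !subr_gt0; lra.
  have [e1 [e2 e3]] : e <= PI /\ e <= l i - phi i /\ e <= phi i.+1 - l i.
    by rewrite /e !ge_min !lexx !orbT.
  have := @double_root (2 * m) F (\prod_(z <- rem (cis (l i)) L) ('X - z%:P) * G)
    (kappa ^+ 2) (fun t => Q t ^+ 2 - h ^+ 2) (l i) e _ hornerF.
  have k0 : kappa ^+ 2 != 0 by rewrite expf_neq0// -nc_gt0 nc_kappa ltr01.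
  rewrite k0 e0 e1 => /(_ isT isT) H.
  have : root (\prod_(z <- rem (cis (l i)) L) ('X - z%:P) * G) (cis (l i)).
    apply: H; last by rewrite FG DD mulrC mulrA.
    move=> t /andP[t1 t2]; rewrite subr_le0 -(real_normK (num_real (Q t))).
    rewrite lerXn2r ?nnegrE ?(ltW h_gt0)//.
    by apply: (Qtouch im lr); apply/andP; split; lra.
  by rewrite rootM root_prod_XsubC mem_rem_uniqF.
by rewrite (monicP Gm) scale1r zpoly_map.
Qed.

Hypothesis s_gt1 : (1 < size S1)%N.

Local Notation Sphi := (\sum_(0 <= i < m) phi i).
Local Notation Sl := (\sum_(0 <= i < m) l i).
Local Notation Sr := (\sum_(0 <= i < m) r i).

Lemma sum_S1 : Sr - Sl = \sum_(x <- map r S1) x - \sum_(x <- map l S1) x.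
Proof.
rewrite !big_map -!sumrB big_filter (bigID (fun i => l i < r i)) /= [X in _ + X]big1_seq.
  by rewrite addr0 /index_iota subn0.
move=> i /andP[i1 i2]; have /T1P[_ ->] : i \in T1.
  by rewrite mem_filter i1 -(subn0 m).
by rewrite subrr.
Qed.

Lemma sum_S1_gt0 : 0 < Sr - Sl.
Proof.
rewrite sum_S1 !big_map -sumrB.
have : all (fun i => l i < r i) S1 by apply/allP => i /S1P[].
case: S1 s_gt1 => // i s _ /= /andP[lr /allP H].
rewrite big_cons ltr_pwDl ?subr_gt0// big_seq sumr_ge0// => j /H /ltW.
by rewrite subr_ge0.
Qed.

Lemma sum_phi_shift : \sum_(0 <= i < m) phi i.+1 = Sphi + 2 * PI.
Proof.
apply/eqP; rewrite addrC -subr_eq -sumrB telescope_sumr// phi_m.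
by apply/eqP; ring.
Qed.

Lemma sum_lr : Sphi < Sl /\ Sr < Sphi + 2 * PI.
Proof.
rewrite -sum_phi_shift; split; apply: ltr_sum_nat => // i /andP[_ im].
Qed.

(** Constant coefficients of [F_factor] show that Sr + Sl - 2 Sphi is a multiple of 2 pi;
    interlacing places it strictly between 0 and 4 pi. *)
Lemma sum_balance : Sr + Sl = 2 * Sphi + 2 * PI.
Proof.
have [h1 h2] := sum_lr; have h3 := sum_S1_gt0.
suff : Sr + Sl - 2 * Sphi = 2 * PI by lra.
apply: cis_eq1; first by apply/andP; split; lra.
have := congr1 (fun f : {poly C} => f.[0]) F_factor.
rewrite hornerD hornerN hornerZ hornerXn expr0n gtn_eqF//= mulr0 subr0.
rewrite (_ : A1 * B1 * Y ^+ 2 = zpoly (mkseq r m) * zpoly (mkseq l m)); last first.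
  by rewrite zpoly_rE zpoly_lE; ring.
rewrite (expr2 P) !hornerM !horner0_zpoly !size_mkseq !sum_mkseq.
set e := (-1) ^+ m; have e2 : e * e = 1 by rewrite -expr2 sqrr_sign.
rewrite mulrACA [RHS]mulrACA e2 !mul1r => E.
rewrite cisD [cis (_ + _)]cisD -E -!cisD (_ : _ + _ = 0) ?cis0//; ring.
Qed.

(* A quarter of the length of the complement of the level set. *)
Definition gam : R := (2 * PI - (Sr - Sl)) / 4.

Lemma gam_bounds : 0 < gam < PI / 2.
Proof.
have [h1 h2] := sum_lr; have h3 := sum_S1_gt0; have h4 := sum_balance.
by rewrite /gam; apply/andP; split; lra.
Qed.

Lemma sin_gam : 0 < sin gam.
Proof. by have /andP[? ?] := gam_bounds; apply: sin_pos; apply/andP; split; lra. Qed.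

Lemma cos_gam : 0 < cos gam.
Proof.
have /andP[? ?] := gam_bounds; have p := PI_gt0.
by rewrite cos_sin RplusE RdivE two_IZR; apply: sin_pos; apply/andP; split; lra.
Qed.

(** By [sum_balance], Sl = Sphi + 2 gam and Sr = Sphi + 2 pi - 2 gam. Relative to [P] the left ends
    are thus rotated by gam and the right ends by - gam, with a sign from the extra pi. *)
Lemma horner_l t : (zpoly (mkseq l m)).[cis t] =
  kappa * cis gam * cis (m%:R * t / 2) * (Al t)%:C.
Proof.
rewrite horner_zpoly size_mkseq sum_mkseq; congr (_ * _ * _).
rewrite -[in RHS]mulrA -cisD; congr (_ * cis _).
by rewrite /gam; have := sum_balance; lra.
Qed.

Lemma horner_r t : (zpoly (mkseq r m)).[cis t] =
  - (kappa * cis (- gam)) * cis (m%:R * t / 2) * (Ar t)%:C.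
Proof.
rewrite horner_zpoly size_mkseq sum_mkseq; congr (_ * _ * _).
rewrite -mulrN -[in RHS]mulrA; congr (_ * _).
rewrite -mulrN1 -cis_PI -!cisD; congr cis.
by rewrite /gam; have := sum_balance; lra.
Qed.

Lemma root_on_circle (ts : seq R) (f : {poly C}) p :
  f != 0 -> f = lead_coef f *: zpoly ts -> root f p -> nc p = 1.
Proof.
move=> f0 -> ; rewrite rootZ ?lead_coef_eq0// zpoly_map root_prod_XsubC.
by move=> /mapP[t _ ->]; rewrite nc_cis.
Qed.

Lemma sinp_self (x : nat -> R) i : (i < m)%N -> sinp (mkseq x m) (x i) = 0.
Proof.
move=> im; apply/eqP; rewrite prodf_seq_eq0; apply/hasP.
exists (x i); first by apply/mapP; exists i; rewrite ?mem_iota.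
by rewrite /= subrr mul0r sin_0 mulr0.
Qed.

(* [P / A] at a point where [A = B] lies in the cone spanned by [cis gam] and
   [cis (- gam)], since every other real combination of [P], [A], [B] changes
   sign [m] times. *)
Lemma comb_roots (k1 k2 : R) p :
  (0 <= k1) && (0 <= k2) || (k1 * k2 < 0) ->
  root (P + (k1%:C * cis gam) *: zpoly (mkseq r m) +
        (k2%:C * cis (- gam)) *: zpoly (mkseq l m)) p -> nc p = 1.
Proof.
set f := P + _ + _ => kk.
pose g t := Q t - k1 * Ar t + k2 * Al t.
have fg t : f.[cis t] = kappa * cis (m%:R * t / 2) * (g t)%:C.
  rewrite !hornerD !hornerZ hornerP horner_l horner_r /g.
  have gg : cis gam * cis (- gam) = 1 by rewrite -cisD subrr cis0.
  have -> : (Q t - k1 * Ar t + k2 * Al t)%:C =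
      (Q t)%:C - k1%:C * (Ar t)%:C + k2%:C * (Al t)%:C.
    by rewrite rmorphD rmorphB !rmorphM.
  set a := cis gam in gg *; set b := cis (- gam) in gg *.
  set z := cis (_ / 2).
  have -> : k1%:C * a * (- (kappa * b) * z * (Ar t)%:C) = - ((a * b) * kappa * z * k1%:C * (Ar t)%:C) by ring.
  have -> : k2%:C * b * (kappa * a * z * (Al t)%:C) = (a * b) * kappa * z * k2%:C * (Al t)%:C by ring.
  by rewrite gg; ring.
have k0 : kappa != 0 by rewrite -nc_gt0 nc_kappa ltr01.
have gc : continuity g.
  apply: (continuity_plus (fun t => Q t - k1 * Ar t) (fun t => k2 * Al t)).
    apply: (continuity_minus Q (fun t => k1 * Ar t)); first exact: sinp_cont.
    by apply: (continuity_mult (fun=> k1) Ar); [exact: continuity_const|exact: sinp_cont].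
  by apply: (continuity_mult (fun=> k2) Al); [exact: continuity_const|exact: sinp_cont].
have gp t : g (t + 2 * PI) = (-1) ^+ m * g t.
  by rewrite /g !sinp_2PI !size_mkseq; ring.
have sf : (size f <= m.+1)%N.
  rewrite !(leq_trans (size_polyD _ _))// !geq_max.
  rewrite (leq_trans (size_polyD _ _))/= ?geq_max ?size_zpoly ?size_mkseq ?leqnn//=.
    by rewrite (leq_trans (size_scale_leq _ _))// size_zpoly size_mkseq.
  by rewrite (leq_trans (size_scale_leq _ _))// size_zpoly size_mkseq.
suff [ts [_ f0 _ fE]] : exists ts : seq R, [/\ size ts = m, f != 0,
    size f = m.+1 & f = lead_coef f *: zpoly ts] by apply: (root_on_circle f0 fE).
have Qphi i : (i < m)%N -> Q (phi i) = 0 by apply: sinp_self.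
have phiS i : (i.+1 < m)%N -> phi i < phi i.+1.
  by move=> im; apply: lt_trans (phi_l (ltnW im)) (l_lt_phi _); lia.
have phiL : phi m.-1 < phi 0%N + 2 * PI.
  rewrite -phi_m; apply: lt_trans (phi_l (i := m.-1) _) (l_lt_phi _); lia.
(* For nonnegative coefficients the signs are read at the left ends, where [Al] vanishes and - [Ar]
   does not oppose [Q]. For opposite signs they are read at the zeros of [Q], where [Ar] and [Al]
   have equal sign. *)
case/orP: kk => [/andP[k10 k20]|kk].
  apply: (@circle_roots m f kappa g ((-1) ^+ m.-1) l) => //.
  - move=> i im; rewrite -sgnE// /g (sinp_self l im) mulr0 addr0.
    have := Q_sign im (t := l i); have := Ar_l_sign im; rewrite sgnS//.
    rewrite phi_l// (le_lt_trans (l_le_r im) (r_phi im)) => H1 /(_ isT) H2.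
    by set e := (-1) ^+ _ in H1 H2 *; nra.
  - by move=> i im; apply: le_lt_trans (l_le_r (ltnW im)) (r_lt_l _); lia.
  - have := @l_lt_phi m.-1 m; rewrite (_ : (_ < _ <= _)%N); last lia.
    by move=> /(_ isT); rewrite phi_m; have := phi_l m_gt0; lra.
have [k10|k10] := ltP 0 k1.
  have k20 : k2 < 0 by nra.
  apply: (@circle_roots m f kappa g ((-1) ^+ m.-1) phi) => // i im.
  rewrite -sgnE// /g Qphi//.
  have := Ar_phi_sign im; have := Al_phi_sign im; rewrite sgnS// => H1 H2.
  by set e := (-1) ^+ _ in H1 H2 *; nra.
have k11 : k1 < 0.
  by rewrite lt_neqAle k10 andbT; apply: contraTneq kk => ->; rewrite mul0r ltxx.
have k20 : 0 < k2 by nra.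
apply: (@circle_roots m f kappa g (- (-1) ^+ m.-1) phi) => // i im.
rewrite mulNr -sgnE// /g Qphi//.
have := Ar_phi_sign im; have := Al_phi_sign im; rewrite sgnS// => H1 H2.
by set e := (-1) ^+ _ in H1 H2 *; nra.
Qed.

Lemma real_mulJ (w : C) : w + conjc w = (2 * complex.Re w)%:C.
Proof.
case: w => a b; apply/eqP; rewrite eq_complex /=.
by apply/andP; split; apply/eqP; ring.
Qed.

Lemma Re_le_nc (w : C) : `|complex.Re w| <= nc w.
Proof.
case: w => a b /=; rewrite -sqrtr_sqr ler_wsqrtr// lerDl sqr_ge0//.
Qed.

(** Each zero on the circle is at distance at least | |p| - 1 | from p. The bound is independent of
    the zeros, which move with [lam] in [ellipse_free]. *)
Lemma nc_prod_ge (ts : seq R) p : nc p != 1 ->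
  `|nc p - 1| ^+ size ts <= nc (zpoly ts).[p].
Proof.
move=> p1; rewrite horner_prod nc_prod; elim: ts => [|t ts IH].
  by rewrite big_nil expr0.
rewrite big_cons exprS ler_pM ?exprn_ge0 ?normr_ge0// hornerXsubC.
have h1 := nc_subge p (cis t); have h2 := nc_subge (cis t) p.
rewrite -ncB_sym in h2; rewrite !nc_cis in h1 h2.
by rewrite ler_norml; apply/andP; split; lra.
Qed.

Lemma sign_perturb n (q x lam : R) : 0 < (-1) ^+ n * q -> `|q| = h ->
  0 <= lam -> lam < 1 -> `|x| <= 1 -> 0 < (-1) ^+ n * (q - lam * h * x).
Proof.
move=> q0 qh l0 l1 x1.
have xh : `|lam * h * x| < h.
  rewrite !normrM (ger0_norm l0) (gtr0_norm h_gt0) -mulrA.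
  have : h * `|x| <= h by rewrite -{2}(mulr1 h) ler_pM2l.
  have : 0 <= h * `|x| by rewrite mulr_ge0// ltW.
  by have := h_gt0; nra.
have -> : (-1) ^+ n * (q - lam * h * x) = `|q| - (-1) ^+ n * (lam * h * x).
  by rewrite mulrBr -(gtr0_norm q0) normrM normrX normrN1 expr1n mul1r.
rewrite subr_gt0 qh; apply: le_lt_trans (ler_norm _) _.
by rewrite normrM normrX normrN1 expr1n mul1r.
Qed.

Hypothesis h_lt2 : h < 2.

(* With [lam < 1] the difference of [P] and [lam] times the right-hand side has
   all its zeros on the circle, hence a lower bound at [p] uniform in [lam]. *)
Lemma ellipse_free (sg p : C) : nc sg <= 1 -> nc p != 1 ->
  P.[p] != (h / 2)%:C * (sg * p ^+ m + conjc sg * kappa ^+ 2).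
Proof.
move=> sg1 p1; apply/eqP => Pp.
have P0 := nc_ge0 P.[p].
(* [K] bounds |f(p)| from below for every lam in [0, 1): the leading coefficient of f has modulus at
   least 1 - h/2, and its zeros lie on the circle. *)
have [K [K0 KE]] : exists K, 0 < K /\ K = (1 - h / 2) * `|nc p - 1| ^+ m.
  exists ((1 - h / 2) * `|nc p - 1| ^+ m); split => //.
  apply: mulr_gt0; first by have := h_lt2; lra.
  by rewrite exprn_gt0// normr_gt0 subr_eq0.
(* If the equality held at p, then f(p) = (1 - lam) P(p); this [lam] is close enough to 1 to bring
   it below [K]. At lam = 1 the sign of g at [l i] could be lost, since |Q| is only h there. *)
have [lam [lam0 lam1 lamK]] : exists lam, [/\ 0 <= lam, lam < 1 &
    (1 - lam) * (nc P.[p] + 1 + K) = K].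
  have D0 : 0 < nc P.[p] + 1 + K by lra.
  exists (1 - K / (nc P.[p] + 1 + K)); split.
  - by rewrite subr_ge0 ler_pdivrMr// mul1r; lra.
  - by rewrite ltrBlDr ltrDl divr_gt0.
  - by rewrite opprB addrC subrK mulfVK ?gt_eqF.
pose f := P - (lam * (h / 2))%:C *: (sg *: 'X^m + (conjc sg * kappa ^+ 2)%:P).
pose w t := sg * conjc kappa * cis (m%:R * t / 2).
pose g t := Q t - lam * h * complex.Re (w t).
have kJ : kappa * conjc kappa = 1 by rewrite mulJ_nc nc_kappa expr1n.
have k0 : kappa != 0 by rewrite -nc_gt0 nc_kappa ltr01.
have fg t : f.[cis t] = kappa * cis (m%:R * t / 2) * (g t)%:C.
  rewrite hornerD hornerN hornerZ hornerD hornerZ hornerXn hornerC hornerP cisX /g.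
  set z := cis (m%:R * t / 2).
  have zz : cis (m%:R * t) = z * z by rewrite /z -cisD; congr cis; field.
  have zJ : z * conjc z = 1 by rewrite mulJ_nc nc_cis expr1n.
  have wJ : sg * cis (m%:R * t) + conjc sg * kappa ^+ 2 = kappa * z * (w t + conjc (w t)).
    have -> : conjc (w t) = conjc sg * kappa * conjc z.
      by rewrite /w -/z (rmorphM conjc) (rmorphM conjc) /= conjcK.
    rewrite zz /w -/z.
    have -> : kappa * z * (sg * conjc kappa * z + conjc sg * kappa * conjc z) =
      (kappa * conjc kappa) * (sg * (z * z)) + (z * conjc z) * (conjc sg * kappa ^+ 2) by ring.
    by rewrite kJ zJ !mul1r.
  rewrite wJ real_mulJ.
  have -> : (lam * (h / 2))%:C * (kappa * z * (2 * complex.Re (w t))%:C) =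
     kappa * z * ((lam * (h / 2)) * (2 * complex.Re (w t)))%:C.
    by rewrite [in RHS]rmorphM /=; ring.
  by rewrite -mulrBr -rmorphB; congr (_ * _%:C); field.
have wc : ccont w.
  apply: ccont_mul; first exact: ccont_const.
  by apply: ccont_ext (ccont_cis (m%:R / 2) 0) => t; rewrite addr0; congr cis; ring.
have gc : continuity g.
  apply: (continuity_minus Q (fun t => lam * h * complex.Re (w t))); first exact: sinp_cont.
  by apply: (continuity_mult (fun=> lam * h)); [exact: continuity_const|case: wc].
have gp t : g (t + 2 * PI) = (-1) ^+ m * g t.
  rewrite /g sinp_2PI size_mkseq.
  have -> : w (t + 2 * PI) = (((-1) ^+ m : R)%:C) * w t.
    rewrite /w (_ : m%:R * (t + 2 * PI) / 2 = m%:R * t / 2 + m%:R * PI); last by field.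
    by rewrite cisD cis_mPI rmorphXn rmorphN1; ring.
  have -> : complex.Re (((-1) ^+ m : R)%:C * w t) = (-1) ^+ m * complex.Re (w t).
    by case: (w t) => a b; simpc.
  by ring.
have w1 t : `|complex.Re (w t)| <= 1.
  apply: le_trans (Re_le_nc _) _.
  by rewrite /w !Normc.normcM ncJ nc_kappa nc_cis !mulr1.
have sT : (size (sg *: 'X^m + (conjc sg * kappa ^+ 2)%:P)%R <= m.+1)%N.
  rewrite (leq_trans (size_polyD _ _))// geq_max (leq_trans (size_scale_leq _ _)) ?size_polyXn//.
  by rewrite (leq_trans (size_polyC_leq1 _)).
have sf : (size f <= m.+1)%N.
  rewrite (leq_trans (size_polyD _ _))// geq_max size_zpoly size_mkseq leqnn /=.
  by rewrite size_polyN (leq_trans (size_scale_leq _ _)).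
have [|||ts [sts f0 sfm fE]] := @circle_roots m f kappa g ((-1) ^+ m.-1) l m_gt0 sf k0 fg gc gp.
- move=> i im; rewrite -sgnE//.
  have := Q_sign im (t := l i); rewrite phi_l// (le_lt_trans (l_le_r im) (r_phi im)) => /(_ isT).
  have := Ql im; have := w1 (l i); rewrite /g.
  by move=> x1 Qh Q0; apply: sign_perturb.
- by move=> i im; apply: le_lt_trans (l_le_r (ltnW im)) (r_lt_l _); rewrite ltnSn.
- have := @l_lt_phi m.-1 m; rewrite leqnn andbT prednK// leqnn => /(_ isT).
  by rewrite phi_m; have := phi_l m_gt0; lra.
have lf : 1 - h / 2 <= nc (lead_coef f).
  have -> : lead_coef f = 1 - (lam * (h / 2))%:C * sg.
    rewrite lead_coefE sfm /= coefB coefZ coefD coefZ coefXn eqxx mulr1 coefC gtn_eqF// addr0.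
    by have := zpoly_monic (mkseq phi m); rewrite monicE lead_coefE size_zpoly size_mkseq /= => /eqP ->.
  have := nc_subge 1 ((lam * (h / 2))%:C * sg); rewrite Normc.normc1 Normc.normcM nc_real.
  rewrite (ger0_norm (_ : 0 <= lam * (h / 2))); last by rewrite mulr_ge0// divr_ge0// ltW.
  move=> H; apply: le_trans H; have := nc_ge0 sg => sg0.
  have h20 : 0 < h / 2 by rewrite divr_gt0.
  have b0 := mulr_ge0 lam0 (ltW h20).
  have : lam * (h / 2) * nc sg <= lam * (h / 2) by rewrite ler_piMr.
  have : lam * (h / 2) <= h / 2 by apply: ler_piMl; exact: ltW.
  by lra.
have fp1 : K <= nc f.[p].
  rewrite {1}fE hornerZ Normc.normcM KE ler_pM//.
  - by have := h_lt2; lra.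
  - by rewrite exprn_ge0.
  - by have := nc_prod_ge ts p1; rewrite sts.
have fp2 : nc f.[p] = (1 - lam) * nc P.[p].
  have -> : f.[p] = (1 - lam)%:C * P.[p].
    rewrite hornerD hornerN hornerZ hornerD hornerZ hornerXn hornerC.
    rewrite rmorphB rmorph1 mulrBl mul1r; congr (_ - _).
    have cM : (lam * (h / 2))%:C = lam%:C * (h / 2)%:C by exact: (rmorphM (real_complex R)).
    by rewrite cM -mulrA -Pp.
  by rewrite Normc.normcM nc_real ger0_norm// subr_ge0 ltW.
have := lamK; rewrite !mulrDr mulr1; have := fp1; rewrite fp2.
have l1 : 0 < 1 - lam by rewrite subr_gt0.
have := mulr_gt0 l1 K0; lra.
Qed.

Lemma nc_sub_le_add (q : C) : 0 <= complex.Re q -> nc (q - 1) <= nc (q + 1).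
Proof.
case: q => a b /= a0; apply: ler_wsqrtr; rewrite oppr0 addr0.
by nra.
Qed.

(** Otherwise q = P/(A1 Y) has negative real part, and - q = k1 cis(gam) + k2 cis(- gam) with real
    k1, k2 of positive sum. They are both nonnegative or of opposite sign, so [comb_roots] puts p on
    the circle. *)
Lemma branch p : nc p != 1 -> root (A1 - B1) p ->
  nc (P - A1 * Y).[p] <= nc (P + A1 * Y).[p].
Proof.
move=> p1; rewrite /root hornerD hornerN subr_eq0 => /eqP AB.
rewrite !hornerD hornerN hornerM.
set a := A1.[p] * Y.[p].
have [->|a0] := eqVneq a 0; first by rewrite subr0 addr0.
set q := P.[p] / a.
have Pq : P.[p] = q * a by rewrite /q mulfVK.
have -> : P.[p] - a = (q - 1) * a by rewrite Pq; ring.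
have -> : P.[p] + a = (q + 1) * a by rewrite Pq; ring.
rewrite (Normc.normcM _ a) (Normc.normcM (q + 1) a).
rewrite ler_pM2r ?nc_gt0//; apply: nc_sub_le_add.
rewrite leNgt; apply/negP => q0.
have c0 := cos_gam; have s0 := sin_gam.
pose x := - complex.Re q / cos gam; pose y := - complex.Im q / sin gam.
pose k1 := (x + y) / 2; pose k2 := (x - y) / 2.
have x0 : 0 < x by rewrite divr_gt0// oppr_gt0.
have kq : k1%:C * cis gam + k2%:C * cis (- gam) = - q.
  have xc : x * cos gam = - complex.Re q by rewrite mulfVK ?gt_eqF.
  have yc : y * sin gam = - complex.Im q by rewrite mulfVK ?gt_eqF.
  case: (q) xc yc => u v /= xc yc.
  by rewrite /cis cosN sinN; simpc; rewrite -xc -yc /k1 /k2; congr (_ +i* _); field.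
apply/negP: p1; rewrite negbK; apply/eqP; apply: (@comb_roots k1 k2).
  have [y1|y1] := lerP y x; have [y2|y2] := lerP (- x) y.
  - by rewrite /k1 /k2 !divr_ge0//; lra.
  - by rewrite (_ : k1 * k2 < 0) ?orbT// /k1 /k2; nra.
  - by rewrite (_ : k1 * k2 < 0) ?orbT// /k1 /k2; nra.
  - by lra.
rewrite /root zpoly_rE zpoly_lE !hornerD !hornerZ !hornerM -AB -/a Pq.
by rewrite -addrA -mulrDl kq mulNr subrr.
Qed.

(** On the circle the phases of [A1] and [B1] differ by (Sr - Sl)/2, strictly between 0 and pi.
    Equal values must then both be 0, but there is no common zero. *)
Lemma root_off_circle p : root (A1 - B1) p -> nc p != 1.
Proof.
rewrite /root hornerD hornerN subr_eq0 => /eqP AB; apply/eqP => /cis_surj[t pt].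
move: AB; rewrite pt !horner_zpoly !size_map.
set i0 := 'i ^+ _; set z := cis (_ * t / 2); have z0 : z != 0 by apply: cis_neq0.
set u := sinp _ t; set v := sinp _ t => E.
have i0n : i0 != 0 by rewrite expf_neq0// eq_complex /= oner_eq0 andbF.
have {E} E : cis ((Sr - Sl) / 2) * u%:C = v%:C.
  apply: (mulfI (cis_neq0 ((\sum_(x <- map l S1) x) / 2))).
  rewrite mulrA -cisD -mulrDl addrC sum_S1 subrK.
  apply: (mulfI (mulf_neq0 i0n z0)).
  move: E; set x := cis _; set y := cis _ => E.
  by transitivity (i0 * x * z * u%:C); [|rewrite E]; ring.
have sM : 0 < sin ((Sr - Sl) / 2).
  by have := sum_lr; have := sum_S1_gt0; move=> ? [? ?]; apply: sin_pos; apply/andP; split; lra.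
have u0 : u = 0.
  have := congr1 (@complex.Im _) E; rewrite /= mulr0 add0r => /eqP.
  by rewrite mulf_eq0 gt_eqF//= => /eqP.
have v0 : v = 0 by move: E; rewrite u0 rmorph0 mulr0 => /complexI.
have rA : root A1 (cis t) by rewrite /root horner_zpoly -/u u0 mulr0.
have rB : root B1 (cis t) by rewrite /root horner_zpoly -/v v0 mulr0.
move: rA rB; rewrite !zpoly_map !root_prod_XsubC => rA rB.
have := uniq_ends; rewrite !map_cat cat_uniq => /and3P[_ /hasPn H _].
by have := H (cis t); rewrite mem_cat rB => /(_ isT) /negP; apply.
Qed.

Theorem banded_bound : sin gam ^+ m < h / 2.
Proof.
have kk : nc (kappa ^+ 2) = 1 by rewrite ncX nc_kappa expr1n.
have h02 : 0 < h < 2 by rewrite h_gt0.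
have hC : h%:C != 0 by apply: contraTneq h_gt0 => /complexI ->; rewrite ltxx.
apply: (@resultant_bound _ m (size S1) (kappa ^+ 2) h (cos gam) (sin gam) P B1
   (map cis (map r S1)) (map cis (map l T1))) => //.
- exact: cos_gam.
- exact: sin_gam.
- exact: zpoly_monic.
- by rewrite size_zpoly size_mkseq.
- exact: zpoly_monic.
- by rewrite size_zpoly size_map.
- by rewrite !size_map.
- by rewrite !size_map addnC size_S1T1.
- by move=> a; rewrite mem_cat => /orP[] /mapP[t _ ->]; apply: nc_cis.
- by rewrite -!zpoly_map; apply: F_factor.
- rewrite -!zpoly_map -zpoly_rE hornerD !horner0_zpoly !size_mkseq !sum_mkseq -mulrDr.
  rewrite Normc.normcM ncX normcN Normc.normc1 expr1n mul1r nc_cisD.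
  have -> : (Sphi - Sr) / 2 = gam - PI by rewrite /gam; have := sum_balance; lra.
  rewrite -cosN opprB cosD cosN sinN cos_PI sin_PI.
  by rewrite mul0r subr0 mulN1r mulrN normrN ger0_norm// mulr_ge0// ltW// cos_gam.
(* |Y(0)| = 1, so [Y] may be multiplied in to reach the full sums of ends; 2 sin((Sr - Sl)/2) is
   then 2 sin(2 gam). *)
- rewrite -!zpoly_map; have -> : nc ((A1 - B1).[0]) = nc ((A1 * Y - B1 * Y).[0]).
    rewrite -mulrBl hornerM Normc.normcM horner0_zpoly.
    by rewrite Normc.normcM nc_cis ncX normcN Normc.normc1 expr1n !mulr1.
  rewrite -zpoly_rE -zpoly_lE hornerD hornerN !horner0_zpoly !size_mkseq !sum_mkseq -mulrBr.
  rewrite Normc.normcM ncX normcN Normc.normc1 expr1n mul1r nc_cisB.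
  have -> : (Sr - Sl) / 2 = PI - (gam + gam) by rewrite /gam; have := sum_balance; lra.
  rewrite sinD cosN sinN cos_PI sin_PI sinD mul0r add0r mulN1r opprK.
  have := mulr_gt0 sin_gam cos_gam => sc; rewrite ger0_norm; first by ring.
  by nra.
- move=> p; rewrite -!zpoly_map => rp.
  have p1 := root_off_circle rp; have br := branch p1 rp.
  set U := (P + A1 * Y).[p] in br *; set V := (P - A1 * Y).[p] in br.
  have := @outer_branch _ m (kappa ^+ 2) p (U / h%:C) (V / h%:C) m_gt0 kk.
  have nh : nc h%:C = h by rewrite nc_real gtr0_norm.
  rewrite !Normc.normcM !Normc.normcV nh.
  rewrite [h * _]mulrC -ltr_pdivlMr//; apply.
  (* Since A1 = B1 at p, the product (P + A1 Y)(P - A1 Y) equals P^2 - A1 B1 Y^2, which the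
     factorization evaluates. *)
  + have UV : U * V = kappa ^+ 2 * (h ^+ 2)%:C * p ^+ m.
      have := congr1 (fun f : {poly C} => f.[p]) F_factor.
      rewrite hornerD hornerN hornerZ hornerXn (expr2 P) (expr2 Y) !hornerM.
      have AB : A1.[p] = B1.[p].
        by move: rp; rewrite /root hornerD hornerN subr_eq0 => /eqP.
      rewrite /U /V !hornerD hornerN hornerM -AB => /eqP; rewrite subr_eq => /eqP E.
      have -> : (P.[p] + A1.[p] * Y.[p]) * (P.[p] - A1.[p] * Y.[p]) =
        P.[p] * P.[p] - A1.[p] * A1.[p] * (Y.[p] * Y.[p]) by ring.
      by rewrite E; ring.
    rewrite mulrACA UV rmorphXn /= expr2; field.
    exact: hC.
  + exact: p1.
  + by rewrite ler_pM2r ?invr_gt0.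
  + move=> sg sg1; have := ellipse_free sg1 p1; apply: contra => /eqP E.
    have -> : P.[p] = (U + V) / 2 by rewrite /U /V !hornerD hornerN; field.
    have -> : U + V = h%:C * (U / h%:C + V / h%:C) by field; exact: hC.
    by rewrite E rmorphM fmorphV rmorph_nat /=; apply/eqP; field.
Qed.

End Banded.

(** * The least maximum on the circle and Chebyshev polynomials of an arc *)

Section Extremal.
Local Notation R := Rdefinitions.R.
Local Notation C := (complex R).
Local Notation nc := (@Normc.normc R).

Lemma nc_i : nc 'i = 1.
Proof. by rewrite /= expr0n expr1n add0r sqrtr1. Qed.

Lemma nc_zpoly_cis s t : nc (zpoly s).[cis t] = `|sinp s t|.
Proof.
by rewrite horner_zpoly !Normc.normcM ncX nc_i expr1n !nc_cis nc_real !mul1r.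
Qed.

Lemma cosPI : cos PI = -1 :> R. Proof. exact: cos_PI. Qed.
Lemma sinPI : sin PI = 0 :> R. Proof. exact: sin_PI. Qed.
Lemma cos0 : cos 0 = 1 :> R. Proof. exact: cos_0. Qed.

Lemma cos_nPI (i : nat) : cos (i%:R * PI) = (-1) ^+ i.
Proof.
elim: i => [|i IH]; first by rewrite mul0r cos_0 expr0.
by rewrite -natr1 mulrDl mul1r cosD IH cosPI sinPI exprS; ring.
Qed.

Lemma sin_nPI (i : nat) : sin (i%:R * PI) = 0.
Proof.
elim: i => [|i IH]; first by rewrite mul0r sin_0.
by rewrite -natr1 mulrDl mul1r sinD IH cosPI sinPI; ring.
Qed.

Lemma rcB (x y : R) : (x - y)%:C = x%:C - y%:C :> C.
Proof. exact: (rmorphB (real_complex R)). Qed.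

Lemma rcM (x y : R) : (x * y)%:C = x%:C * y%:C :> C.
Proof. exact: (rmorphM (real_complex R)). Qed.

(** If |Q| <= h < 2 everywhere, a cosine of amplitude 2 minus Q alternates at the m extrema of the
    cosine. It then has m zeros, yet its polynomial has degree below m. *)
Lemma sinp_exceeds (s : seq R) (h : R) : (0 < size s)%N -> h < 2 ->
  exists t, h < `|sinp s t|.
Proof.
set m := size s => m0 h2; apply: Classical_Prop.NNPP => H.
have Qh t : `|sinp s t| <= h.
  by rewrite leNgt; apply/negP => Ht; apply: H; exists t.
pose k := 'i ^+ m * cis ((\sum_(x <- s) x) / 2).
have nk : nc k = 1 by rewrite /k Normc.normcM ncX nc_i nc_cis expr1n mulr1.
have k0 : k != 0 by rewrite -nc_gt0 nk ltr01.
(* This phase makes the cosine correspond to z^m + k^2, so that the leading term of the monic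
   [zpoly s] cancels. *)
have [th kth] : exists th, conjc k = cis th by apply: cis_surj; rewrite ncJ.
have kJ : k * conjc k = 1 by rewrite mulJ_nc nk expr1n.
pose g t := 2 * cos (th + m%:R * t / 2) - sinp s t.
pose f := 'X^m + (k ^+ 2)%:P - zpoly s.
have fg t : f.[cis t] = k * cis (m%:R * t / 2) * (g t)%:C.
  rewrite /f hornerD hornerN hornerD hornerXn hornerC cisX horner_zpoly -/m -/k.
  rewrite /g rcB mulrBr; congr (_ - _).
  set z := cis (m%:R * t / 2).
  have zz : cis (m%:R * t) = z * z by rewrite /z -cisD; congr cis; field.
  have zJ : z * conjc z = 1 by rewrite mulJ_nc nc_cis expr1n.
  have -> : (2 * cos (th + m%:R * t / 2))%:C = conjc k * z + conjc (conjc k * z).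
    by rewrite kth -cisD real_mulJ.
  rewrite (rmorphM conjc (conjc k)) /= conjcK zz mulrDr.
  have -> : k * z * (conjc k * z) = (k * conjc k) * (z * z) by ring.
  have -> : k * z * (k * conjc z) = (z * conjc z) * k ^+ 2 by ring.
  by rewrite kJ zJ !mul1r.
have gc : continuity g.
  apply: (continuity_minus (fun t => 2 * cos (th + m%:R * t / 2)) (sinp s)); last exact: sinp_cont.
  apply: (continuity_mult (fun=> 2)); first exact: continuity_const.
  have [cc _] := ccont_cis (m%:R / 2) th.
  by apply: continuity_eq cc => t /=; congr cos; ring.
have gp t : g (t + 2 * PI) = (-1) ^+ m * g t.
  rewrite /g sinp_2PI -/m.
  have -> : th + m%:R * (t + 2 * PI) / 2 = (th + m%:R * t / 2) + m%:R * PI by field.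
  rewrite [in LHS]cosD cos_nPI.
  by rewrite sin_nPI; ring.
have mR : 0 < m%:R :> R by rewrite ltr0n.
have sf : (size f <= m)%N.
  apply/leq_sizeP => j; rewrite leq_eqVlt => /orP[/eqP <-|mj].
    rewrite coefB coefD coefXn eqxx coefC gtn_eqF// addr0.
    by have := zpoly_monic s; rewrite monicE lead_coefE size_zpoly /= => /eqP ->; rewrite subrr.
  rewrite coefB coefD coefXn coefC !gtn_eqF// ?(ltn_trans _ mj)//.
  by rewrite nth_default ?size_zpoly// addr0 subrr.
have [|||ts [_ _ sf' _]] := @circle_roots m f k g 1 (fun i => (2 * (i%:R * PI) - 2 * th) / m%:R)
   m0 (leqW sf) k0 fg gc gp.
- move=> i im; rewrite mul1r /g.
  have -> : th + m%:R * ((2 * (i%:R * PI) - 2 * th) / m%:R) / 2 = i%:R * PI.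
    by field; rewrite gt_eqF.
  rewrite cos_nPI mulrBr mulrCA -expr2 sqrr_sign mulr1 subr_gt0.
  apply: le_lt_trans (ler_norm _) _; rewrite normrM normrX normrN1 expr1n mul1r.
  exact: le_lt_trans (Qh _) h2.
- move=> i im; rewrite ltr_pM2r ?invr_gt0// -natr1; have := PI_gt0; lra.
- rewrite -ltrBlDl -mulrBl ltr_pdivrMr//.
  have -> : (m.-1)%:R = m%:R - 1 :> R by rewrite -[in RHS](prednK m0) -natr1; ring.
  have := PI_gt0; lra.
by move: sf; rewrite sf' ltnn.
Qed.

(* [cheb c n t = (2 c^n T_n(x), 2 c^(n+1) T_(n+1)(x))] at [x = cos(t/2) / c]. *)
Fixpoint cheb (c : R) (n : nat) : (R -> R) * (R -> R) :=
  if n is k.+1 then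
    ((cheb c k).2, fun t => 2 * cos (t / 2) * (cheb c k).2 t - c ^+ 2 * (cheb c k).1 t)
  else ((fun=> 2), fun t => 2 * cos (t / 2)).

(** The recurrence of [cheb] multiplied by its phase: 2 cos(t/2) becomes z + 1, and the lag of two
    steps costs a factor z. *)
Fixpoint chebp (c : R) (n : nat) : {poly C} * {poly C} :=
  if n is k.+1 then
    ((chebp c k).2, ('X + 1) * (chebp c k).2 - (c ^+ 2)%:C *: ('X * (chebp c k).1))
  else (2%:P, 'X + 1).

Lemma horner_chebp c n t :
  (chebp c n).1.[cis t] = cis (n%:R * t / 2) * ((cheb c n).1 t)%:C /\
  (chebp c n).2.[cis t] = cis (n.+1%:R * t / 2) * ((cheb c n).2 t)%:C.
Proof.
have X1 : cis t + 1 = cis (t / 2) * (2 * cos (t / 2))%:C.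
  have -> : cis t = cis (t / 2) * cis (t / 2) by rewrite -cisD; congr cis; field.
  have E1 : 1 = cis (t / 2) * cis (- (t / 2)) by rewrite -cisD subrr cis0.
  rewrite [X in _ + X]E1 -mulrDr -conj_cis real_mulJ //.
elim: n => [|n [IH1 IH2]].
  rewrite /= hornerC mul0r mul0r cis0 mul1r hornerD hornerX hornerC mul1r X1; split => //.
  by rewrite rmorph_nat.
split; first exact: IH2.
rewrite /= hornerD hornerN hornerZ !hornerM hornerD hornerX hornerC IH1 IH2 X1.
set a := (cheb c n).2 t; set b := (cheb c n).1 t.
have -> : cis (n.+2%:R * t / 2) = cis (t / 2) * cis (n.+1%:R * t / 2).
  by rewrite -cisD; congr cis; rewrite -!natr1; ring.
have -> : cis (n.+1%:R * t / 2) = cis (t / 2) * cis (n%:R * t / 2).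
  by rewrite -cisD; congr cis; rewrite -!natr1; ring.
have -> : cis t = cis (t / 2) * cis (t / 2) by rewrite -cisD; congr cis; field.
have -> : (2 * cos (t / 2) * a - c ^+ 2 * b)%:C = (2 * cos (t / 2))%:C * a%:C - (c ^+ 2)%:C * b%:C.
  by rewrite rcB !rcM.
by ring.
Qed.

Lemma chebp_size c n : [/\ (size (chebp c n).1 <= n.+1)%N, (chebp c n).2 \is monic
  & size (chebp c n).2 = n.+2].
Proof.
have X1 : ('X + 1 : {poly C}) = 'X - (-1)%:P by rewrite polyCN opprK.
elim: n => [|n [h1 h2 h3]].
  by split; rewrite /= ?size_polyC_leq1// X1 ?monicXsubC// size_XsubC.
have sM : size (('X + 1) * (chebp c n).2) = n.+3.
  by rewrite size_monicM ?X1 ?monicXsubC ?monic_neq0// size_XsubC h3.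
have sl : (size (- ((c ^+ 2)%:C *: ('X * (chebp c n).1))) < size (('X + 1) * (chebp c n).2)%R)%N.
  rewrite size_polyN (leq_ltn_trans (size_scale_leq _ _))// sM ltnS.
  by apply: leq_trans (size_polyMleq _ _) _; rewrite size_polyX; exact: h1.
split; rewrite /= ?h3//; last by rewrite size_polyDl.
by rewrite monicE lead_coefDl// -monicE monicMl// X1 monicXsubC.
Qed.

Lemma cheb_cos c n t th : cos (t / 2) = c * cos th ->
  (cheb c n).1 t = 2 * c ^+ n * cos (n%:R * th) /\
  (cheb c n).2 t = 2 * c ^+ n.+1 * cos (n.+1%:R * th).
Proof.
move=> ct; elim: n => [|n [IH1 IH2]].
  by have E1 : 1%:R * th = th; [rewrite mul1r|rewrite /= mul0r cos0 E1 ct; split; ring].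
split => //=; rewrite IH1 IH2 ct.
have -> : n.+2%:R * th = n.+1%:R * th + th by rewrite -[n.+2%:R]natr1; ring.
have -> : n%:R * th = n.+1%:R * th - th by rewrite -[n.+1%:R]natr1; ring.
rewrite !cosD cosN sinN !exprS; ring.
Qed.

Lemma cheb_cont c n : continuity (cheb c n).1 /\ continuity (cheb c n).2.
Proof.
have cc : continuity (fun t => 2 * cos (t / 2)).
  apply: (continuity_mult (fun=> 2)); first exact: continuity_const.
  have [cc _] := ccont_cis (2^-1) 0.
  by apply: continuity_eq cc => t /=; congr cos; ring.
elim: n => [|n [IH1 IH2]]; first by split => //; exact: continuity_const.
split => //=.
apply: (continuity_minus (fun t => 2 * cos (t / 2) * (cheb c n).2 t) (fun t => c ^+ 2 * (cheb c n).1 t)).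
  exact: (continuity_mult _ _ cc IH2).
by apply: (continuity_mult (fun=> c ^+ 2)); first exact: continuity_const.
Qed.

Lemma cheb_2PI c n t : (cheb c n).1 (t + 2 * PI) = (-1) ^+ n * (cheb c n).1 t /\
  (cheb c n).2 (t + 2 * PI) = (-1) ^+ n.+1 * (cheb c n).2 t.
Proof.
have c2 : cos ((t + 2 * PI) / 2) = - cos (t / 2).
  by rewrite (_ : _ / 2 = t / 2 + PI) ?neg_cos//; field.
elim: n => [|n [IH1 IH2]]; first by rewrite /= c2; split; ring.
by split => //=; rewrite c2 IH1 IH2 !exprS; ring.
Qed.

Lemma cosK (x : R) : -1 <= x <= 1 -> cos (acos x) = x.
Proof. by move=> /andP[/RleP a /RleP b]; apply: cos_acos. Qed.

Lemma cosK_lt (x : R) : -1 < x < 1 -> cos (acos x) = x.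
Proof. by move=> /andP[a b]; apply: cosK; rewrite !ltW. Qed.

(* The zeros of [c^m T_m(cos(t/2)/c)]. *)
Lemma chebyshev_competitor (m : nat) (c : R) : (0 < m)%N -> 0 < c < 1 ->
  exists ts : seq R, size ts = m /\
    forall t, `|cos (t / 2)| <= c -> `|sinp ts t| <= 2 * c ^+ m.
Proof.
case: m => // m _ /andP[c0 c1].
have [_ pm ps] := chebp_size c m.
set f := (chebp c m).2 in pm ps.
have fg t : f.[cis t] = 1 * cis (m.+1%:R * t / 2) * ((cheb c m).2 t)%:C.
  by rewrite mul1r; have [] := horner_chebp c m t.
have mR : 0 < m.+1%:R :> R by rewrite ltr0n.
pose th i : R := i%:R * PI / m.+1%:R.
have p0 := PI_gt0.
have th_b i : (i <= m)%N -> 0 <= th i < PI.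
  move=> im; rewrite /th; apply/andP; split.
    by apply: divr_ge0; [apply: mulr_ge0; [exact: ler0n|exact: ltW]|exact: ltW].
  by rewrite ltr_pdivrMr// mulrC ltr_pM2l// ltr_nat.
have th_s i : th i < th i.+1.
  by rewrite /th ltr_pM2r ?invr_gt0// ltr_pM2r// ltr_nat.
have cos1 x : -1 <= cos x <= 1.
  by have [/RleP a /RleP b] := COS_bound x; apply/andP.
have ccos i : -1 < c * cos (th i) < 1 by have /andP[] := cos1 (th i); nra.
have sf : (size f <= m.+2)%N by rewrite ps.
(* At these points cos(t/2)/c runs through the extremal points cos(i pi/m) of T_m, with m the
   degree, so the values alternate in sign. Since c < 1 the first point is positive, and all of them
   fit into one period. *)
pose x i := 2 * acos (c * cos (th i)).
have gs i : (i < m.+1)%N -> 0 < 1 * (-1) ^+ i * (cheb c m).2 (x i).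
  move=> im; rewrite mul1r.
  have E : cos (x i / 2) = c * cos (th i).
    rewrite (_ : _ / 2 = acos (c * cos (th i))); last by rewrite /x; field.
    by rewrite cosK_lt.
  have [_ ->] := cheb_cos m E.
  rewrite (_ : m.+1%:R * th i = i%:R * PI); last by rewrite /th mulrC mulfVK// gt_eqF.
  by rewrite cos_nPI mulrCA -expr2 sqrr_sign mulr1 mulr_gt0// exprn_gt0.
have xs i : (i.+1 < m.+1)%N -> x i < x i.+1.
  move=> im; rewrite /x ltr_pM2l//.
  have /andP[a b] := ccos i; have /andP[a' b'] := ccos i.+1.
  have /andP[u v] := th_b i (ltnW im); have /andP[u' v'] := th_b i.+1 im.
  have lc : c * cos (th i.+1) < c * cos (th i).
    rewrite ltr_pM2l//; apply/RltP; apply: cos_decreasing_1; try (by apply/RleP; exact: ltW).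
    - exact/RleP.
    - exact/RleP.
    - by apply/RltP.
  rewrite ltNge; apply/negP => le.
  have [p1 p2] := acos_bound (c * cos (th i)).
  have [p3 p4] := acos_bound (c * cos (th i.+1)).
  have /RleP := cos_decr_1 _ _ p3 p4 p1 p2 (elimT RleP le).
  rewrite !cosK_lt// => le2.
  by have := lt_le_trans lc le2; rewrite ltxx.
have xm : x m < x 0%N + 2 * PI.
  have h1 : 0 < acos (c * cos (th 0%N)).
    have [/RleP a _] := acos_bound (c * cos (th 0%N)).
    rewrite lt_neqAle a andbT; apply/eqP => E.
    have /andP[u v] := ccos 0%N.
    by move: v; rewrite -(cosK_lt (ccos 0%N)) -E cos0 ltxx.
  have [_ /RleP h2] := acos_bound (c * cos (th m)).
  by rewrite /x; lra.
have [ts [sts _ _ fE]] := circle_roots (isT : (0 < m.+1)%N) sf (oner_neq0 _) fg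
  (cheb_cont c m).2 (fun t => (cheb_2PI c m t).2) gs xs xm.
exists ts; split => // t ct.
rewrite -nc_zpoly_cis.
have -> : zpoly ts = f by rewrite [RHS]fE (monicP pm) scale1r.
rewrite fg mul1r Normc.normcM nc_cis nc_real mul1r.
(* On the arc cos(t/2)/c lies in [-1, 1] and is a cosine, so [cheb_cos] bounds the value by 2 c^m, m
   being the degree. *)
have E : cos (t / 2) = c * cos (acos (cos (t / 2) / c)).
  rewrite cosK; first by field; rewrite gt_eqF.
  by rewrite -ler_norml normrM normfV (gtr0_norm c0) ler_pdivrMr// mul1r.
have [_ ->] := cheb_cos m E.
rewrite normrM ger0_norm; last by rewrite mulr_ge0// exprn_ge0// ltW.
rewrite -{2}(mulr1 (2 * _)) ler_pM2l ?mulr_gt0 ?exprn_gt0// ler_norml; exact: cos1.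
Qed.

End Extremal.

(** * Transfer between the two forms of the sine product and of the reals *)

Section Bridge.
Local Notation R := Rdefinitions.R.

Lemma Qf_sinp (L : seq R) t : LevelSets.Qf L t = sinp L t.
Proof.
by elim: L => [|x L IH]; rewrite /sinp ?big_nil// big_cons /= IH RdivE.
Qed.

Lemma absQ_sinp (L : seq R) t : LevelSets.absQ L t = `|sinp L t|.
Proof. by rewrite /LevelSets.absQ Qf_sinp RabsE. Qed.

Lemma zeros_mkseq (phi : nat -> R) m : LevelSets.zeros phi m = mkseq phi m.
Proof.
by rewrite /LevelSets.zeros /mkseq; congr List.map.
Qed.

Lemma fold_sum (f : nat -> R) m :
  List.fold_right (fun i a => Rplus (f i) a) (IZR 0) (List.seq 0 m) = \sum_(0 <= i < m) f i.
Proof.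
rewrite /index_iota subn0.
by elim: m {1 2}0%N => [|m IH] n; rewrite ?big_nil// big_cons /= IH.
Qed.

Lemma exceeds (m : nat) (h : R) (L : seq R) : Peano.le 1 m -> Rlt h (IZR 2) ->
  List.length L = m -> exists t, Rlt h (LevelSets.absQ L t).
Proof.
move=> /ssrnat.leP m1 /RltP h2 Lm.
have [t ht] := @sinp_exceeds L h (etrans (congr1 _ Lm) m1 : (0 < size L)%N) h2.
by exists t; apply/RltP; rewrite absQ_sinp.
Qed.

Lemma competitor (m : nat) (c : R) : Peano.le 1 m -> Rlt (IZR 0) c /\ Rlt c (IZR 1) ->
  exists L : seq R, List.length L = m /\
    forall t, Rle (Rabs (cos (Rdiv t (IZR 2)))) c -> Rle (LevelSets.absQ L t) (Rmult (IZR 2) (pow c m)).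
Proof.
move=> /ssrnat.leP m1 [/RltP c0 /RltP c1].
have [L [sL HL]] := @chebyshev_competitor m c m1 (introT andP (conj c0 c1)).
exists L; split => // t /RleP tc; apply/RleP.
by rewrite absQ_sinp RpowE; apply: HL; move: tc; rewrite RabsE RdivE.
Qed.

Lemma two_segments (m : nat) (h : R) (phi l r : nat -> R) : Peano.le 1 m ->
  Rlt (IZR 0) h /\ Rlt h (IZR 2) -> LevelSets.normal phi m ->
  (forall i, Peano.lt i m -> Rlt (phi i) (l i) /\ Rle (l i) (r i) /\ Rlt (r i) (phi i.+1) /\
    LevelSets.absQ (LevelSets.zeros phi m) (l i) = h /\ LevelSets.absQ (LevelSets.zeros phi m) (r i) = h /\
    (l i = r i -> forall t, Rle (phi i) t /\ Rle t (phi i.+1) -> Rle (LevelSets.absQ (LevelSets.zeros phi m) t) h)) ->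
  (exists i j, Peano.lt i m /\ Peano.lt j m /\ i <> j /\ Rlt (l i) (r i) /\ Rlt (l j) (r j)) ->
  let g := Rdiv (Rminus (Rmult (IZR 2) PI)
    (List.fold_right (fun i a => Rplus (Rminus (r i) (l i)) a) (IZR 0) (List.seq 0 m))) (IZR 4) in
  (Rlt (IZR 0) g /\ Rlt g (Rdiv PI (IZR 2))) /\ Rlt (pow (sin g) m) (Rdiv h (IZR 2)).
Proof.
move=> /ssrnat.leP m1 [/RltP h0 /RltP h2] [_ [phim _]] H [i [j [/ssrnat.ltP im [/ssrnat.ltP jm [ij [/RltP lri /RltP lrj]]]]]].
rewrite fold_sum => g.
have {}H k : (k < m)%N -> [/\ phi k < l k, l k <= r k, r k < phi k.+1,
    `|sinp (mkseq phi m) (l k)| = h /\ `|sinp (mkseq phi m) (r k)| = h &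
    l k = r k -> forall t, phi k < t < phi k.+1 -> `|sinp (mkseq phi m) t| <= h].
  move=> /ssrnat.ltP /H [/RltP H1 [/RleP H2 [/RltP H3 [H4 [H5 H6]]]]].
  rewrite !zeros_mkseq !absQ_sinp in H4 H5; split => // lr t /andP[t1 t2].
  have /RleP := H6 lr t (conj (elimT RleP (ltW t1)) (elimT RleP (ltW t2))).
  by rewrite zeros_mkseq absQ_sinp.
have s1 : (1 < size (S1 m l r))%N.
  apply: (@leq_trans (size [:: i; j])) => //; apply: uniq_leq_size.
    by rewrite /= inE andbT; apply/eqP.
  by move=> k; rewrite !inE => /orP[] /eqP ->; rewrite mem_filter mem_iota ?lri ?lrj.
have phi_m : phi m = phi 0%N + 2 * PI by exact: phim.
have H1 k : (k < m)%N -> phi k < l k by move=> /H[].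
have H2 k : (k < m)%N -> l k <= r k by move=> /H[].
have H3 k : (k < m)%N -> r k < phi k.+1 by move=> /H[].
have H4 k : (k < m)%N -> `|sinp (mkseq phi m) (l k)| = h by move=> /H[_ _ _ []].
have H5 k : (k < m)%N -> `|sinp (mkseq phi m) (r k)| = h by move=> /H[_ _ _ []].
have H6 k : (k < m)%N -> l k = r k -> forall t, phi k < t < phi k.+1 ->
  `|sinp (mkseq phi m) t| <= h by move=> /H[].
have gE : g = gam m l r.
  have E4 : IZR 4 = 4%:R :> R by have := INR_IZR_INZ 4; rewrite INRE => <-.
  by rewrite /g /gam sumrB RdivE E4.
have /andP[g0 g1] := gam_bounds m1 h0 phi_m H1 H2 H3 H4 H5 H6 s1.
have gm := banded_bound m1 h0 phi_m H1 H2 H3 H4 H5 H6 s1 h2.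
rewrite gE !RdivE RpowE; split; first split; exact/RltP.
Qed.

End Bridge.

End BandedLevel.

Theorem theorem2 (m : nat) (h : R) (phis : list R) :
  (1 <= m)%nat -> 0 < h < 2 -> length phis = m ->
  mes (sup_set phis h) = delta m h ->
  exists (a b : R) (pts : list R),
    a < b /\ b - a < 2 * PI /\
    length pts = (m - 1)%nat /\ NoDup pts /\
    (forall p, In p pts -> 0 <= p < 2 * PI /\ ~ in_arc a b p) /\
    (forall t, 0 <= t < 2 * PI ->
       (sup_set phis h t <-> in_arc a b t \/ In t pts)).
Proof.
  intros m1 hb len E.
  apply (LevelSets.one_segment_of_bounds m h phis); trivial.
  - apply (@BandedLevel.exceeds m h phis); tauto.
  - intros c Hc. now apply BandedLevel.competitor.
  - intros phi l r N H two. now apply (@BandedLevel.two_segments m h phi l r).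
Qed.
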